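(* Let $(M,F=\alpha^2/\beta)$ be a Kropina space with navigation data $(h,W)$, and let $K=K(x)$ be a function on $M$. Then $(M,F)$ is of $p$-scalar flag curvature $K=K(x)$ if and only if the following two conditions hold: (a) the unit vector field $W$ is a Killing vector field of $(M,h)$; (b) the Riemannian space $(M,h)$ is of scalar sectional curvature $K=K(x)$. Furthermore, in this case $K(x)\ge 0$ for all $x\in M$.
   Context: Kropina space: $M$ is an $n$-dimensional differentiable manifold ($n\ge2$, so that flag and sectional curvatures make sense), $\alpha=\sqrt{a_{ij}(x)y^iy^j}$ is a Riemannian metric on $M$, $\beta=b_i(x)y^i$ is a nowhere vanishing 1-form, and $F=\alpha^2/\beta$ is regarded as a conic Finsler metric on the domain $\{(x,y)\in TM:\beta(x,y)>0\}$. Navigation data: with $b^2:=a^{ij}b_ib_j$ ($(a^{ij})$ the inverse matrix of $(a_{ij})$), let $\kappa=\kappa(x)$ be the function on $M$ defined by $e^{\kappa}b^2=4$, and put $h_{ij}:=e^{\kappa}a_{ij}$, $2W_i:=e^{\kappa}b_i$, $W^i:=h^{ij}W_j$, where $(h^{ij})$ is the inverse matrix of $(h_{ij})$. Then $h=\sqrt{h_{ij}y^iy^j}$ is a Riemannian metric and $W=W^i\,\partial/\partial x^i$ is a vector field of constant $h$-length $1$; $(h,W)$ is called the navigation data of $F$. Flag curvature: let $G^i=\frac14 g^{il}\left(\frac{\partial^2F^2}{\partial x^k\partial y^l}y^k-\frac{\partial F^2}{\partial x^l}\right)$, $g_{ij}=\frac12\frac{\partial^2F^2}{\partial y^i\partial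 y^j}$, be the geodesic spray coefficients and ${R^i}_k=2\frac{\partial G^i}{\partial x^k}-y^j\frac{\partial^2G^i}{\partial x^j\partial y^k}+2G^j\frac{\partial^2G^i}{\partial y^j\partial y^k}-\frac{\partial G^i}{\partial y^j}\frac{\partial G^j}{\partial y^k}$. The (conic) Finsler space $(M,F)$ is of scalar flag curvature $K=K(x,y)$ if ${R^i}_k=K(x,y)\left(F^2\delta^i_k-F\frac{\partial F}{\partial y^k}y^i\right)$ on the domain of $F$ (i.e. the flag curvature does not depend on the transverse edge of the flag). It is of $p$-scalar flag curvature if in addition $K(x,y)=K(x)$ is independent of $y$. The Riemannian space $(M,h)$ is of scalar sectional curvature $K=K(x)$ if at each $x\in M$ every 2-plane of $T_xM$ has sectional curvature $K(x)$. *)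

(* Defs.v *)
From HB Require Import structures.
From mathcomp Require Import all_boot all_order all_algebra.
From mathcomp Require Import all_classical all_reals all_analysis.
Set Implicit Arguments.
Unset Strict Implicit.
Unset Printing Implicit Defensive.
Import Order.TTheory GRing.Theory Num.Theory.
Import numFieldNormedType.Exports.
Local Open Scope classical_set_scope.
Local Open Scope ring_scope.

Definition partial (R : realType) (n : nat) (i : 'I_n)
    (f : 'rV[R]_n -> R) (x : 'rV[R]_n) : R :=
  'D_(delta_mx 0 i) f x.

(* C^oo on an open set U: all iterated partial derivatives (the zeroth one
   included) are differentiable, hence continuous, at every point of U. *)
Definition smooth_on (R : realType) (n : nat) (U : set 'rV[R]_n)
    (f : 'rV[R]_n -> R) : Prop :=
  forall (s : seq 'I_n) (x : 'rV[R]_n), U x ->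
    differentiable (foldr (@partial R n) f s : 'rV[R]_n -> R) x.

(* The charts phi c : dom c -> cod c and their inverses psi c are total
   functions that matter only on dom c and on cod c.  The atlas need not be
   maximal: tensor fields and the properties below are invariant under smooth
   changes of coordinates, so it is the same to give them on a generating
   atlas.  Hausdorffness and second countability of M are stated separately. *)
Record smooth_atlas (R : realType) (n : nat) (M : topologicalType) :=
  SmoothAtlas {
    chart : Type;
    dom : chart -> set M;
    cod : chart -> set 'rV[R]_n;
    phi : chart -> M -> 'rV[R]_n;
    psi : chart -> 'rV[R]_n -> M;
    dom_open : forall c, open (dom c);
    cod_open : forall c, open (cod c);
    phi_cod : forall c p, dom c p -> cod c (phi c p);
    psi_dom : forall c x, cod c x -> dom c (psi c x);
    phiK : forall c p, dom c p -> psi c (phi c p) = p;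
    psiK : forall c x, cod c x -> phi c (psi c x) = x;
    phi_cont : forall c p, dom c p -> {for p, continuous (phi c)};
    psi_cont : forall c x, cod c x -> {for x, continuous (psi c)};
    dom_cover : forall p, exists c, dom c p;
    transition_smooth : forall c d (j : 'I_n),
      smooth_on [set x | cod c x /\ dom d (psi c x)]
                (fun x => phi d (psi c x) 0 j)
  }.

(* Components (t_i), (t^i) or (t_ij) of a tensor field in every chart, as
   functions of the coordinates; only the values on cod c matter. *)
Definition field1 (R : realType) (n : nat) (M : topologicalType)
    (A : smooth_atlas R n M) : Type := chart A -> 'rV[R]_n -> 'rV[R]_n.
Definition field2 (R : realType) (n : nat) (M : topologicalType)
    (A : smooth_atlas R n M) : Type := chart A -> 'rV[R]_n -> 'M[R]_n.

(* The entry (i, j) of the library's 'J f x is d f^j / d x^i, so the two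
   transformation laws below are b_i = d_i tau^k b'_k and
   a_ij = d_i tau^k d_j tau^l a'_kl. *)
Definition one_form (R : realType) (n : nat) (M : topologicalType)
    (A : smooth_atlas R n M) (b : field1 A) : Prop :=
  (forall c i, smooth_on (cod c) (fun x => b c x 0 i)) /\
  (forall c d x, cod c x -> dom d (psi c x) ->
     let tau := fun z : 'rV[R]_n => phi d (psi c z) in
     b c x = b d (tau x) *m ('J tau x)^T).

Definition nowhere_vanishing (R : realType) (n : nat) (M : topologicalType)
    (A : smooth_atlas R n M) (b : field1 A) : Prop :=
  forall c x, cod c x -> b c x != 0.

Definition riemannian_metric (R : realType) (n : nat) (M : topologicalType)
    (A : smooth_atlas R n M) (a : field2 A) : Prop :=
  [/\ forall c i j, smooth_on (cod c) (fun x => a c x i j),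
      forall c x, cod c x -> (a c x)^T = a c x,
      forall c x, cod c x -> forall y : 'rV[R]_n, y != 0 ->
        0 < (y *m a c x *m y^T) 0 0 &
      forall c d x, cod c x -> dom d (psi c x) ->
        let tau := fun z : 'rV[R]_n => phi d (psi c z) in
        a c x = 'J tau x *m a d (tau x) *m ('J tau x)^T].

Definition alpha (R : realType) (n : nat) (a : 'rV[R]_n -> 'M[R]_n)
    (x y : 'rV[R]_n) : R :=
  Num.sqrt (\sum_i \sum_j a x i j * y 0 i * y 0 j).

Definition beta (R : realType) (n : nat) (b : 'rV[R]_n -> 'rV[R]_n)
    (x y : 'rV[R]_n) : R :=
  \sum_i b x 0 i * y 0 i.

Definition kropina (R : realType) (n : nat) (a : 'rV[R]_n -> 'M[R]_n)
    (b : 'rV[R]_n -> 'rV[R]_n) (x y : 'rV[R]_n) : R :=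
  alpha a x y ^+ 2 / beta b x y.

Definition sqnorm_form (R : realType) (n : nat) (a : 'rV[R]_n -> 'M[R]_n)
    (b : 'rV[R]_n -> 'rV[R]_n) (x : 'rV[R]_n) : R :=
  \sum_i \sum_j invmx (a x) i j * b x 0 i * b x 0 j.

Definition navigation_factor (R : realType) (n : nat) (M : topologicalType)
    (A : smooth_atlas R n M) (a : field2 A) (b : field1 A) (kappa : M -> R)
    : Prop :=
  forall c x, cod c x ->
    expR (kappa (psi c x)) * sqnorm_form (a c) (b c) x = 4.

Definition nav_metric (R : realType) (n : nat) (M : topologicalType)
    (A : smooth_atlas R n M) (kappa : M -> R) (a : field2 A) : field2 A :=
  fun c x => expR (kappa (psi c x)) *: a c x.

Definition nav_form (R : realType) (n : nat) (M : topologicalType)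
    (A : smooth_atlas R n M) (kappa : M -> R) (b : field1 A) : field1 A :=
  fun c x => (expR (kappa (psi c x)) / 2) *: b c x.

Definition nav_field (R : realType) (n : nat) (M : topologicalType)
    (A : smooth_atlas R n M) (kappa : M -> R) (a : field2 A) (b : field1 A)
    : field1 A :=
  fun c x => \row_i \sum_j
    invmx (nav_metric kappa a c x) i j * nav_form kappa b c x 0 j.

Definition dx (R : realType) (n : nat) (k : 'I_n)
    (f : 'rV[R]_n -> 'rV[R]_n -> R) (x y : 'rV[R]_n) : R :=
  partial k (fun z => f z y) x.

Definition dy (R : realType) (n : nat) (k : 'I_n)
    (f : 'rV[R]_n -> 'rV[R]_n -> R) (x y : 'rV[R]_n) : R :=
  partial k (f x) y.

Definition fundamental_tensor (R : realType) (n : nat)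
    (F : 'rV[R]_n -> 'rV[R]_n -> R) (x y : 'rV[R]_n) : 'M[R]_n :=
  \matrix_(i, j) (2^-1 * dy i (dy j (fun u v => F u v ^+ 2)) x y).

Definition spray (R : realType) (n : nat) (F : 'rV[R]_n -> 'rV[R]_n -> R)
    (i : 'I_n) (x y : 'rV[R]_n) : R :=
  let F2 := fun u v => F u v ^+ 2 in
  4^-1 * \sum_l invmx (fundamental_tensor F x y) i l *
    (\sum_k dx k (dy l F2) x y * y 0 k - dx l F2 x y).

Definition finsler_curvature (R : realType) (n : nat)
    (F : 'rV[R]_n -> 'rV[R]_n -> R) (i k : 'I_n) (x y : 'rV[R]_n) : R :=
  let G := spray F in
  2 * dx k (G i) x y
  - \sum_j y 0 j * dx j (dy k (G i)) x y
  + 2 * \sum_j G j x y * dy j (dy k (G i)) x y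
  - \sum_j dy j (G i) x y * dy k (G j) x y.

(* A function K(x, y) on the domain of F is given by its expressions in the
   charts. *)
Definition scalar_flag_curvature (R : realType) (n : nat) (M : topologicalType)
    (A : smooth_atlas R n M) (a : field2 A) (b : field1 A)
    (K : chart A -> 'rV[R]_n -> 'rV[R]_n -> R) : Prop :=
  forall c x y, cod c x -> 0 < beta (b c) x y ->
    let F := kropina (a c) (b c) in
    forall i k : 'I_n,
      finsler_curvature F i k x y =
      K c x y * (F x y ^+ 2 * (i == k)%:R - F x y * dy k F x y * y 0 i).

Definition p_scalar_flag_curvature (R : realType) (n : nat)
    (M : topologicalType) (A : smooth_atlas R n M) (a : field2 A)
    (b : field1 A) (K : M -> R) : Prop :=
  scalar_flag_curvature a b (fun c x _ => K (psi c x)).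

(* (L_W h)_ij = 0. *)
Definition killing (R : realType) (n : nat) (M : topologicalType)
    (A : smooth_atlas R n M) (h : field2 A) (W : field1 A) : Prop :=
  forall c x, cod c x -> forall i j : 'I_n,
    \sum_k (W c x 0 k * partial k (fun z => h c z i j) x
            + h c x k j * partial i (fun z => W c z 0 k) x
            + h c x i k * partial j (fun z => W c z 0 k) x) = 0.

Definition christoffel (R : realType) (n : nat) (h : 'rV[R]_n -> 'M[R]_n)
    (i j k : 'I_n) (x : 'rV[R]_n) : R :=
  2^-1 * \sum_l invmx (h x) i l *
    (partial j (fun z => h z l k) x + partial k (fun z => h z l j) x
     - partial l (fun z => h z j k) x).

(* R(d_k, d_l) d_j = R^i_jkl d_i, with
   R(X, Y) = [nabla_X, nabla_Y] - nabla_[X, Y]. *)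
Definition riemann_curvature (R : realType) (n : nat)
    (h : 'rV[R]_n -> 'M[R]_n) (i j k l : 'I_n) (x : 'rV[R]_n) : R :=
  partial k (christoffel h i l j) x - partial l (christoffel h i k j) x
  + \sum_m (christoffel h i k m x * christoffel h m l j x
            - christoffel h i l m x * christoffel h m k j x).

Definition inner (R : realType) (n : nat) (h : 'rV[R]_n -> 'M[R]_n)
    (x u v : 'rV[R]_n) : R :=
  \sum_i \sum_j h x i j * u 0 i * v 0 j.

(* h(R(u, v) v, u) / (|u|^2 |v|^2 - h(u, v)^2). *)
Definition sectional_curvature (R : realType) (n : nat)
    (h : 'rV[R]_n -> 'M[R]_n) (x u v : 'rV[R]_n) : R :=
  inner h x
    (\row_i \sum_j \sum_k \sum_l
       riemann_curvature h i j k l x * v 0 j * u 0 k * v 0 l) u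
  / (inner h x u u * inner h x v v - inner h x u v ^+ 2).

(* The 2-planes of the tangent space are given by their bases (u, v). *)
Definition scalar_sectional_curvature (R : realType) (n : nat)
    (M : topologicalType) (A : smooth_atlas R n M) (h : field2 A)
    (K : M -> R) : Prop :=
  forall c x, cod c x -> forall u v : 'rV[R]_n,
    row_free (col_mx u v) ->
    sectional_curvature (h c) x u v = K (psi c x).

(* Main.v *)
Require Import Defs.
From mathcomp Require Import all_boot all_order all_algebra.
From mathcomp Require Import all_classical all_reals all_analysis.
From mathcomp Require Import ring lra.

(** Everything happens in one chart.  In terms of the navigation data the
    Kropina metric is [F = <y, y> / (2 <W, y>)] with [<W, W> = 1], inner
    products being those of [h]; write [S v] for the covariant derivative of
    [W] along [v].  Solving the Euler-Lagrange equation of [F ^+ 2] gives the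
    spray of [F] as the geodesic spray of [h] plus an expression in [S] and [F]
    ([spray_nav]).  Its only term with [<y, y>] in the denominator is radial:
    [- <S y, y> <W, y> / <y, y>] times [y].

    Suppose the flag curvature is a function [K(x)].  A radial term [P y]
    changes the curvature of a spray, modulo [y], by the multiple
    [P ^+ 2 - (derivative of P along the first spray)] of the identity
    ([projective_change]).  Here this multiple is
    [3 (<S y, y> <W, y>) ^+ 2 / <y, y> ^+ 2] plus terms with at most a simple
    pole in [<y, y>], whereas the prescribed curvature has no such pole at all.
    Hence [<y, y>] divides the square of [<S y, y> <W, y>].  On a line
    [y = W + t f] with [f] orthogonal to [W] one has [<W, y> = 1], all regular
    terms are polynomials in [t], and [<y, y> = 1 + <f, f> t ^+ 2] has no real
    root; a square of [t (A + B t)] divisible by it vanishes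
    ([quadratic_pole]).  This gives [<S y, y> = 0] for all [y], which means that
    [W] is a Killing field ([killing_of_curvature]).

    If [W] is a Killing field, the spray is the one of [h] minus [F S y], and
    Kostant's formula [cov2_killing] for the second derivatives of [W] reduces
    its curvature to that of [h]: with [u = y - F W] and [v'] the part of [v]
    tangent to the indicatrix, [R_F(y) v = R_h(v', u) u]
    ([killing_spray_curvature]).  The vectors [u] that occur contain [e] or [- e]
    for each [e <> 0], so [F] has flag curvature [K(x)] if and only if
    [R_h(v, u) u = K (<u, u> v - <u, v> u)] for all [u] and [v]
    ([scalar_flag_killing]), which is the condition on sectional curvatures
    ([sectional_operator]).  Finally [<S v, S v> = <R_h(v, W) W, v> = K <v, v>]
    for [v] orthogonal to [W], so [0 <= K] ([curv_operator_nonneg]). *)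

Set Implicit Arguments.
Unset Strict Implicit.
Unset Printing Implicit Defensive.
Import Order.TTheory GRing.Theory Num.Theory.
Import numFieldNormedType.Exports.
Local Open Scope classical_set_scope.
Local Open Scope ring_scope.

(** * Directional derivatives *)

Lemma near_eq_differentiable (R : realType) (V W : normedModType R)
    (f g : V -> W) (x : V) :
  (\forall z \near x, f z = g z) -> differentiable f x -> differentiable g x.
Proof.
move=> fg df; have [dfc dfE] := (diff_locallyP _ _).1 df.
have gE : g \o shift x = cst (g x) + 'd f x +o_ 0 id.
  apply/eqaddoP => e e0; have /eqaddoP/(_ e e0) := dfE.
  move: (fg); rewrite (near_shift 0); apply: filterS2 => h /=.
  by rewrite subr0 !fctE /= => ->; rewrite (nbhs_singleton fg).
by apply/diff_locallyP; rewrite (diff_unique dfc gE).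
Qed.

Section DirectionalDerivative.
Variables (R : realType) (V : normedModType R).
Implicit Types (f g : V -> R) (x v : V).

Lemma is_derive_cast f x v (df df' : R) :
  is_derive x v f df -> df = df' -> is_derive x v f df'.
Proof. by move=> ? <-. Qed.

(** The rules of differentiation for functions in lambda form; they are meant
    to be composed as explicit terms, which fixes the shape of the derivative. *)
Lemma is_derive_add f g x v (df dg : R) :
  is_derive x v f df -> is_derive x v g dg ->
  is_derive x v (fun z => f z + g z) (df + dg).
Proof. by move=> hf hg; exact: (is_deriveD hf hg). Qed.

Lemma is_derive_opp f x v (df : R) :
  is_derive x v f df -> is_derive x v (fun z => - f z) (- df).
Proof. by move=> hf; exact: (is_deriveN hf). Qed.

Lemma is_derive_mul f g x v (df dg : R) :
  is_derive x v f df -> is_derive x v g dg ->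
  is_derive x v (fun z => f z * g z) (df * g x + f x * dg).
Proof.
move=> hf hg; apply: is_derive_cast (is_deriveM hf hg) _.
by rewrite /GRing.scale /= addrC (mulrC (g x)).
Qed.

Lemma is_derive_scale f x v (k df : R) :
  is_derive x v f df -> is_derive x v (fun z => k * f z) (k * df).
Proof. by move=> hf; exact: (is_deriveZ k hf). Qed.

Lemma is_derive_inv f x v (df : R) : f x != 0 ->
  is_derive x v f df -> is_derive x v (fun z => (f z)^-1) (- df / f x ^+ 2).
Proof.
move=> fx0 hf; apply: DeriveDef; first exact: derivableV.
by rewrite deriveV// derive_val /GRing.scale /= mulrC mulrN mulNr.
Qed.

Lemma is_derive_const x v (k : R) : is_derive x v (fun=> k) 0.
Proof. exact: is_derive_cst. Qed.

Lemma is_derive_bigsum (I : Type) (s : seq I) (f : I -> V -> R) x v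
    (df : I -> R) : (forall i, is_derive x v (f i) (df i)) ->
  is_derive x v (fun z => \sum_(i <- s) f i z) (\sum_(i <- s) df i).
Proof.
move=> hf; elim: s => [|i s IHs].
  under eq_fun do rewrite big_nil.
  by rewrite big_nil; exact: is_derive_const.
under eq_fun do rewrite big_cons.
by rewrite big_cons; exact: is_derive_add.
Qed.

Lemma differentiable_bigsum (I : Type) (s : seq I) (f : I -> V -> R) x :
  (forall i, differentiable (f i) x) ->
  differentiable (fun z => \sum_(i <- s) f i z) x.
Proof.
move=> df; elim: s => [|i s IHs].
  by under eq_fun do rewrite big_nil; exact: differentiable_cst.
by under eq_fun do rewrite big_cons; exact: differentiableD (df i) IHs.
Qed.

Lemma differentiable_is_derive f x v :
  differentiable f x -> is_derive x v f ('D_v f x).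
Proof. by move=> df; apply/derivableP/diff_derivable. Qed.

Lemma derive_linear f x (k : R) v w : differentiable f x ->
  'D_(k *: v + w) f x = k * 'D_v f x + 'D_w f x.
Proof. by move=> df; rewrite !deriveE// linearP. Qed.

End DirectionalDerivative.

Section SmoothFunctions.
Variables (R : realType) (n : nat) (U : set 'rV[R]_n).
Hypothesis openU : open U.
Implicit Types (f g : 'rV[R]_n -> R) (x v w : 'rV[R]_n).

Lemma near_open x : U x -> \forall z \near x, U z.
Proof. by move=> Ux; apply: open_nbhs_nbhs; split. Qed.

Lemma near_eq_open f g x : (forall z, U z -> f z = g z) -> U x ->
  \forall z \near x, f z = g z.
Proof. by move=> fg /near_open; apply: filterS => z /fg. Qed.

Lemma differentiable_eq_on f g x : (forall z, U z -> f z = g z) -> U x ->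
  differentiable f x -> differentiable g x.
Proof.
by move=> fg Ux; apply: near_eq_differentiable; exact: near_eq_open.
Qed.

Lemma derive_sum_partial f x v : differentiable f x ->
  'D_v f x = \sum_i v 0 i * partial i f x.
Proof.
move=> df; rewrite /partial; under eq_bigr do rewrite deriveE//.
rewrite deriveE// {1}(row_sum_delta v) linear_sum.
by apply: eq_bigr => i _; rewrite linearZ.
Qed.

Lemma derive_eq_cst f (k : R) x v :
  (forall z, U z -> f z = k) -> U x -> 'D_v f x = 0.
Proof.
move=> fk Ux; rewrite -[RHS](derive_cst k x v).
exact: near_eq_derive (near_eq_open fk Ux).
Qed.

End SmoothFunctions.

(** * Symmetry of second derivatives *)

Section Schwarz.
Variables (R : realType) (V : normedModType R).
Implicit Types (f : V -> R) (x v w c : V).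

Lemma is_derive_line f c v (s : R) : differentiable f (s *: v + c) ->
  is_derive s 1 (fun t : R => f (t *: v + c)) ('D_v f (s *: v + c)).
Proof.
move=> df; pose l := fun t : R => t *: v + c.
have dl : is_diff s l (fun t : R => t *: v + 0) by exact: is_diffD.
have dfl : differentiable (f \o l) s by apply: differentiable_comp.
apply: DeriveDef; first exact: diff_derivable.
rewrite deriveE// diff_comp//= diff_val /= deriveE// scale1r addr0.
by [].
Qed.

Lemma differentiable_bound f x (e : R) : 0 < e -> differentiable f x ->
  \forall k \near 0, `|f (k + x) - f x - 'D_k f x| <= e * `|k|.
Proof.
move=> e0 df; have [_ dfE] := (diff_locallyP _ _).1 df.
have /eqaddoP/(_ e e0) := dfE; apply: filterS => k /=.
by rewrite deriveE// !fctE /= opprD addrA.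
Qed.

(** By the mean value theorem applied to the first increment, the second
    difference of [f] along [v] and [w] is [t ^+ 2] times the iterated
    derivative up to [o (t ^+ 2)]; being symmetric in [v] and [w], it forces
    the two iterated derivatives to agree. *)
Lemma second_difference f x v w (e : R) : 0 < e ->
  (\forall z \near x, differentiable f z) -> differentiable ('D_v f) x ->
  exists2 d, 0 < d & forall t, 0 < t < d ->
   `|f (t *: v + (t *: w + x)) - f (t *: v + x) - f (t *: w + x) + f x
     - t ^+ 2 * 'D_w ('D_v f) x| <= e * t ^+ 2.
Proof.
move=> e0 df dDf.
(* For [0 <= s <= t] the points [s *: v + t *: w] and [s *: v] have norms that
   add up to at most [t * C]. *)
pose C := 2 * `|v| + `|w| + 1.
have C0 : 0 < C by rewrite ltr_wpDl// addr_ge0// mulr_ge0.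
have eC0 : 0 < e / C by rewrite divr_gt0.
move: df; rewrite (near_shift 0) => df.
have /nbhs_normP[d /= d0 dP] : \forall k \near 0,
    `|'D_v f (k + x) - 'D_v f x - 'D_k ('D_v f) x| <= e / C * `|k| /\
    differentiable f (k + x).
  apply: filterS2 (differentiable_bound eC0 dDf) df => k /=.
  by rewrite subr0.
exists (d / C); first by rewrite divr_gt0.
move=> t /andP[t0]; rewrite ltr_pdivlMr// => td.
have inball k : `|k| < d ->
    `|'D_v f (k + x) - 'D_v f x - 'D_k ('D_v f) x| <= e / C * `|k| /\
    differentiable f (k + x).
  by move=> kd; apply: dP; rewrite /= sub0r normrN.
have small s a : 0 <= s <= t -> `|a| <= t * `|w| -> `|s *: v + a| < d.
  move=> /andP[s0 st] ha; apply: le_lt_trans td.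
  apply: le_trans (ler_normD _ _) _; rewrite normrZ (ger0_norm s0).
  have := ler_wpM2r (normr_ge0 v) st; have := mulr_ge0 (ltW t0) (normr_ge0 v).
  by rewrite /C; lra.
have w0 : `|t *: w| <= t * `|w| by rewrite normrZ gtr0_norm.
have o0 : `|0 : V| <= t * `|w| by rewrite normr0 mulr_ge0// ltW.
have dtw s : 0 <= s <= t -> differentiable f (s *: v + (t *: w + x)).
  by move=> st; rewrite addrA; exact: (inball _ (small _ _ st w0)).2.
have dx s : 0 <= s <= t -> differentiable f (s *: v + x).
  by move=> st; rewrite -[s *: v]addr0; exact: (inball _ (small _ _ st o0)).2.
have dg s : s \in `[0, t] -> is_derive s 1
    (fun s : R => f (s *: v + (t *: w + x)) - f (s *: v + x))
    ('D_v f (s *: v + (t *: w + x)) - 'D_v f (s *: v + x)).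
  rewrite in_itv /= => st; apply: is_derive_add; first exact/is_derive_line/dtw.
  exact/is_derive_opp/is_derive_line/dx.
have [s0|s] := MVT t0 (fun s st => dg s (subset_itv_oo_cc st)).
  by apply: derivable_within_continuous => s /dg[].
move=> /subset_itv_oo_cc; rewrite in_itv /= => st.
rewrite !scale0r !add0r subr0 => E.
have [B1 _] := inball _ (small _ _ st w0).
have [B2 _] := inball _ (small _ _ st o0).
have dlin : 'D_(s *: v + t *: w) ('D_v f) x =
    'D_(s *: v + 0) ('D_v f) x + t * 'D_w ('D_v f) x.
  by rewrite !deriveE// addr0 linearD !linearZ.
rewrite addr0 in B2 dlin; rewrite dlin -[s *: v + t *: w + x]addrA in B1.
have nsv : `|s *: v| <= t * `|v|.
  have /andP[s0 st'] := st.
  by rewrite normrZ (ger0_norm s0) ler_wpM2r.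
have nsvw : `|s *: v + t *: w| <= t * `|v| + t * `|w|.
  exact: le_trans (ler_normD _ _) (lerD nsv w0).
have -> (r1 r2 r3 r4 : R) : r1 - r2 - r3 + r4 = r1 - r2 - (r3 - r4) by ring.
rewrite E.
have alg (P1 P2 p0 D1 D2 : R) : (P1 - P2) * t - t ^+ 2 * D2 =
    t * (P1 - p0 - (D1 + t * D2) - (P2 - p0 - D1)) by ring.
rewrite (alg _ _ ('D_v f x) ('D_(s *: v) ('D_v f) x)).
rewrite normrM gtr0_norm// expr2 mulrCA ler_pM2l//.
apply: le_trans (ler_normB _ _) _; apply: le_trans (lerD B1 B2) _.
have -> : e * t = e / C * (t * C).
  by rewrite mulrCA divfK ?lt0r_neq0// mulrC.
rewrite -mulrDr ler_pM2l// /C.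
apply: le_trans (lerD nsvw nsv) _.
have {}t0 := ltW t0; clear -t0; move: `|v| `|w| t0 => a b t0; lra.
Qed.

Lemma schwarz f x v w :
  (\forall z \near x, differentiable f z) ->
  differentiable ('D_v f) x -> differentiable ('D_w f) x ->
  'D_w ('D_v f) x = 'D_v ('D_w f) x.
Proof.
move=> df dv dw; apply/eqP; rewrite -subr_eq0 -normr_le0.
apply/ler_addgt0Pl => e e0; rewrite addr0.
have e20 : 0 < e / 2 by rewrite divr_gt0.
have [d1 d10 H1] := second_difference w e20 df dv.
have [d2 d20 H2] := second_difference v e20 df dw.
pose t := Num.min d1 d2 / 2.
have t0 : 0 < t by rewrite divr_gt0// lt_min d10.
have tm : t < Num.min d1 d2.
  by rewrite /t ltr_pdivrMr// ltr_pMr ?lt_min ?d10// ltr1n.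
move: tm; rewrite lt_min => /andP[td1 td2].
have := H1 t; have := H2 t; rewrite !t0 td1 td2 => /(_ isT) B2 /(_ isT) B1.
have t20 : 0 < t ^+ 2 by rewrite exprn_gt0.
rewrite -(ler_pM2l t20) -(gtr0_norm t20) -normrM (gtr0_norm t20).
rewrite addrCA in B2.
move: (f (t *: v + (t *: w + x))) B1 B2 => D B1 B2.
have alg (p q r Dvw Dwv : R) : t ^+ 2 * (Dwv - Dvw) =
  (D - p - q + r - t ^+ 2 * Dvw) - (D - q - p + r - t ^+ 2 * Dwv) by ring.
rewrite (alg (f (t *: w + x)) (f (t *: v + x)) (f x)).
apply: le_trans (ler_normB _ _) _; apply: le_trans (lerD B2 B1) _.
by rewrite -mulrDl -splitr mulrC.
Qed.

End Schwarz.

(** * Closure properties of smooth functions *)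

Section SmoothClosure.
Variables (R : realType) (n : nat) (U : set 'rV[R]_n).
Hypothesis openU : open U.
Implicit Types (f g : 'rV[R]_n -> R) (x v w : 'rV[R]_n).

(** Smoothness as a nested condition, so that closure properties follow by
    induction on the order [m]. *)
Fixpoint differentiable_upto (m : nat) f : Prop :=
  (forall x, U x -> differentiable f x) /\
  (if m is m'.+1 then forall i, differentiable_upto m' (partial i f) else True).
Local Notation Ck := differentiable_upto.

Lemma smooth_on_partial f i : smooth_on U f -> smooth_on U (partial i f).
Proof. by move=> sf s x Ux; rewrite -foldr_rcons; exact: sf. Qed.

Lemma smooth_on_differentiable f x : smooth_on U f -> U x -> differentiable f x.
Proof. by move=> sf Ux; exact: (sf [::]). Qed.

Lemma smooth_onP f : smooth_on U f <-> forall m, Ck m f.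
Proof.
split.
  move=> + m; elim: m f => [|m IHm] f sf /=.
    by split=> // x; exact: smooth_on_differentiable.
  split=> [x|i]; first exact: smooth_on_differentiable.
  exact/IHm/smooth_on_partial.
move=> + s; elim/last_ind: s f => [|s i IHs] f Cf x Ux.
  by have [df _] := Cf 0%N; exact: df.
rewrite foldr_rcons; apply: IHs Ux => m.
by have [_ /(_ i)] := Cf m.+1.
Qed.

Lemma Ck_differentiable m f x : Ck m f -> U x -> differentiable f x.
Proof. by case: m => [|m] [df _]; exact: df. Qed.

Lemma CkW m f : Ck m.+1 f -> Ck m f.
Proof.
elim: m f => [|m IHm] f [df dpf]; first by split.
by split=> // i; exact/IHm/dpf.
Qed.

Lemma partial_eq_on f g i x : (forall z, U z -> f z = g z) -> U x ->
  partial i f x = partial i g x.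
Proof. by move=> fg Ux; exact: near_eq_derive (near_eq_open openU fg Ux). Qed.

Lemma Ck_eq_on m f g : (forall z, U z -> f z = g z) -> Ck m f -> Ck m g.
Proof.
elim: m f g => [|m IHm] f g fg [df dpf].
  by split=> // x Ux; exact: (differentiable_eq_on openU fg Ux (df _ Ux)).
split=> [x Ux|i]; first exact: (differentiable_eq_on openU fg Ux (df _ Ux)).
by apply: IHm (dpf i) => z Uz; exact: partial_eq_on.
Qed.

Lemma Ck_cst m (k : R) : Ck m (fun=> k).
Proof.
elim: m k => [|m IHm] k; first by split=> // x _; exact: differentiable_cst.
split=> [x _|i]; first exact: differentiable_cst.
by apply: Ck_eq_on (IHm 0) => x _; exact/esym/derive_cst.
Qed.

Lemma partial_is_derive f x i : differentiable f x ->
  is_derive x (delta_mx 0 i) f (partial i f x).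
Proof. exact: differentiable_is_derive. Qed.

Lemma Ck_add m f g : Ck m f -> Ck m g -> Ck m (fun x => f x + g x).
Proof.
elim: m f g => [|m IHm] f g Cf Cg.
  split=> // x Ux.
  exact: differentiableD (Ck_differentiable Cf Ux) (Ck_differentiable Cg Ux).
split=> [x Ux|i].
  exact: differentiableD (Ck_differentiable Cf Ux) (Ck_differentiable Cg Ux).
have [df pf] := Cf; have [dg pg] := Cg.
apply: Ck_eq_on (IHm _ _ (pf i) (pg i)) => x Ux; apply: esym.
by apply: derive_val; apply: is_derive_add; exact: partial_is_derive (_ x Ux).
Qed.

Lemma Ck_mul m f g : Ck m f -> Ck m g -> Ck m (fun x => f x * g x).
Proof.
elim: m f g => [|m IHm] f g Cf Cg.
  split=> // x Ux.
  exact: differentiableM (Ck_differentiable Cf Ux) (Ck_differentiable Cg Ux).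
split=> [x Ux|i].
  exact: differentiableM (Ck_differentiable Cf Ux) (Ck_differentiable Cg Ux).
have [df pf] := Cf; have [dg pg] := Cg.
have H := Ck_add (IHm _ _ (pf i) (CkW Cg)) (IHm _ _ (CkW Cf) (pg i)).
apply: Ck_eq_on H => x Ux; apply: esym.
by apply: derive_val; apply: is_derive_mul; exact: partial_is_derive (_ x Ux).
Qed.

Lemma Ck_inv m f : (forall x, U x -> f x != 0) -> Ck m f ->
  Ck m (fun x => (f x)^-1).
Proof.
move=> f0; elim: m => [|m IHm] Cf.
  split=> // x Ux.
  exact: differentiableV (Ck_differentiable Cf Ux) (f0 _ Ux).
split=> [x Ux|i].
  exact: differentiableV (Ck_differentiable Cf Ux) (f0 _ Ux).
have [df pf] := Cf; have Vf := IHm (CkW Cf).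
have H := Ck_mul (Ck_cst m (-1)) (Ck_mul (pf i) (Ck_mul Vf Vf)).
apply: Ck_eq_on H => x Ux; apply: esym.
apply: derive_val; apply: is_derive_cast.
  by apply: is_derive_inv (f0 _ Ux) _; exact: partial_is_derive (df x Ux).
by rewrite mulN1r mulNr expr2 invfM.
Qed.

Lemma smooth_on_eq f g : (forall z, U z -> f z = g z) ->
  smooth_on U f -> smooth_on U g.
Proof.
by move=> fg /smooth_onP sf; apply/smooth_onP => m; exact: Ck_eq_on (sf m).
Qed.

Lemma smooth_on_cst (k : R) : smooth_on U (fun=> k).
Proof. by apply/smooth_onP => m; exact: Ck_cst. Qed.

Lemma smooth_on_add f g : smooth_on U f -> smooth_on U g ->
  smooth_on U (fun x => f x + g x).
Proof.
by move=> /smooth_onP sf /smooth_onP sg; apply/smooth_onP => m; exact: Ck_add.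
Qed.

Lemma smooth_on_mul f g : smooth_on U f -> smooth_on U g ->
  smooth_on U (fun x => f x * g x).
Proof.
by move=> /smooth_onP sf /smooth_onP sg; apply/smooth_onP => m; exact: Ck_mul.
Qed.

Lemma smooth_on_inv f : (forall x, U x -> f x != 0) -> smooth_on U f ->
  smooth_on U (fun x => (f x)^-1).
Proof.
by move=> f0 /smooth_onP sf; apply/smooth_onP => m; exact: Ck_inv.
Qed.

Lemma smooth_on_opp f : smooth_on U f -> smooth_on U (fun x => - f x).
Proof.
move=> sf; apply: smooth_on_eq (smooth_on_mul (smooth_on_cst (-1)) sf) => x _.
by rewrite mulN1r.
Qed.

Lemma smooth_on_bigsum (I : Type) (s : seq I) (P : pred I)
    (f : I -> 'rV[R]_n -> R) : (forall i, smooth_on U (f i)) ->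
  smooth_on U (fun x => \sum_(i <- s | P i) f i x).
Proof.
move=> sf; elim: s => [|i s IHs].
  by under eq_fun do rewrite big_nil; exact: smooth_on_cst.
under eq_fun do rewrite big_cons; case: (P i) => //.
exact: smooth_on_add.
Qed.

Lemma smooth_on_bigprod (I : Type) (s : seq I) (P : pred I)
    (f : I -> 'rV[R]_n -> R) : (forall i, smooth_on U (f i)) ->
  smooth_on U (fun x => \prod_(i <- s | P i) f i x).
Proof.
move=> sf; elim: s => [|i s IHs].
  by under eq_fun do rewrite big_nil; exact: smooth_on_cst.
under eq_fun do rewrite big_cons; case: (P i) => //.
exact: smooth_on_mul.
Qed.

Lemma smooth_on_det p (A : 'rV[R]_n -> 'M[R]_p) :
  (forall i j, smooth_on U (fun x => A x i j)) ->
  smooth_on U (fun x => \det (A x)).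
Proof.
move=> sA; rewrite /determinant; apply: smooth_on_bigsum => s.
by apply: smooth_on_mul; [exact: smooth_on_cst|exact: smooth_on_bigprod].
Qed.

Lemma smooth_on_invmx p (A : 'rV[R]_n -> 'M[R]_p) :
  (forall x, U x -> A x \in unitmx) ->
  (forall i j, smooth_on U (fun x => A x i j)) ->
  forall i j, smooth_on U (fun x => invmx (A x) i j).
Proof.
move=> uA sA i j.
apply: (@smooth_on_eq (fun x => (\det (A x))^-1 * cofactor (A x) j i)).
  by move=> x Ux; rewrite /invmx uA// !mxE.
apply: smooth_on_mul.
  apply: smooth_on_inv; last exact: smooth_on_det.
  by move=> x /uA; rewrite unitmxE unitfE.
rewrite /cofactor; apply: smooth_on_mul; first exact: smooth_on_cst.
apply: smooth_on_det => k l; under eq_fun do rewrite !mxE; exact: sA.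
Qed.

Lemma smooth_on_derive f v : smooth_on U f -> smooth_on U ('D_v f).
Proof.
move=> sf; apply: (@smooth_on_eq (fun x => \sum_i v 0 i * partial i f x)).
  by move=> x Ux; rewrite derive_sum_partial//; exact: smooth_on_differentiable.
apply: smooth_on_bigsum => i.
by apply: smooth_on_mul; [exact: smooth_on_cst|exact: smooth_on_partial].
Qed.

Lemma derive_comm f x v w : smooth_on U f -> U x ->
  'D_w ('D_v f) x = 'D_v ('D_w f) x.
Proof.
move=> sf Ux; apply: schwarz.
- by apply: filterS (near_open openU Ux) => z; exact: smooth_on_differentiable.
- exact: smooth_on_differentiable (smooth_on_derive v sf) Ux.
- exact: smooth_on_differentiable (smooth_on_derive w sf) Ux.
Qed.

End SmoothClosure.

(** * Bilinear forms and the Levi-Civita connection *)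

Section Bilinear.
Variables (R : realType) (n : nat).
Implicit Types (B : 'I_n -> 'I_n -> R) (a b u v : 'rV[R]_n).

Lemma rowDE a b i : (a + b) 0 i = a 0 i + b 0 i. Proof. exact: mxE. Qed.
Lemma rowNE a i : (- a) 0 i = - a 0 i. Proof. exact: mxE. Qed.
Lemma rowZE k a i : (k *: a) 0 i = k * a 0 i. Proof. exact: mxE. Qed.
Lemma row0E i : (0 : 'rV[R]_n) 0 i = 0. Proof. exact: mxE. Qed.
Definition rowE := (rowDE, rowNE, rowZE, row0E).

Definition bform B a b : R := \sum_i \sum_j B i j * a 0 i * b 0 j.

Lemma bformPl B k u v b : bform B (k *: u + v) b = k * bform B u b + bform B v b.
Proof.
rewrite /bform mulr_sumr -big_split; apply: eq_bigr => i _ /=.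
rewrite mulr_sumr -big_split; apply: eq_bigr => j _ /=; rewrite !mxE; ring.
Qed.

Lemma bformPr B k u v a : bform B a (k *: u + v) = k * bform B a u + bform B a v.
Proof.
rewrite /bform mulr_sumr -big_split; apply: eq_bigr => i _ /=.
rewrite mulr_sumr -big_split; apply: eq_bigr => j _ /=; rewrite !mxE; ring.
Qed.

Lemma bform_eq B B' a b : (forall i j, B i j = B' i j) ->
  bform B a b = bform B' a b.
Proof.
by move=> BB'; apply: eq_bigr => i _; apply: eq_bigr => j _; rewrite BB'.
Qed.

Lemma bformPm k B B' a b :
  bform (fun i j => k * B i j + B' i j) a b = k * bform B a b + bform B' a b.
Proof.
rewrite /bform mulr_sumr -big_split; apply: eq_bigr => i _ /=.
rewrite mulr_sumr -big_split; apply: eq_bigr => j _ /=; ring.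
Qed.

Lemma bformC B a b : (forall i j, B i j = B j i) -> bform B a b = bform B b a.
Proof.
move=> symB; rewrite /bform exchange_big; apply: eq_bigr => i _.
by apply: eq_bigr => j _; rewrite symB mulrAC.
Qed.

(** With [bilinear_expand], the passage from index formulas to identities
    between vectors. *)
Lemma linear_expand (f : 'rV[R]_n -> R) a :
  (forall k u v, f (k *: u + v) = k * f u + f v) ->
  f a = \sum_i a 0 i * f (delta_mx 0 i).
Proof.
move=> flin; have f0 : f 0 = 0.
  by have := flin (-1) 0 0; rewrite scaler0 addr0 mulN1r addNr.
rewrite {1}(row_sum_delta a).
elim/big_rec2: _ => [//|i x y _ <-]; exact: flin.
Qed.

Lemma bform_delta B i j : bform B (delta_mx 0 i) (delta_mx 0 j) = B i j.
Proof.
rewrite /bform (bigD1 i)//= [X in _ + X]big1 ?addr0 => [|k ki]; last first.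
  by apply: big1 => l _; rewrite !mxE eqxx (negbTE ki) mulr0 mul0r.
rewrite (bigD1 j)//= [X in _ + X]big1 ?addr0 => [|l lj]; last first.
  by rewrite !mxE eqxx (negbTE lj) mulr0.
by rewrite !mxE !eqxx !mulr1.
Qed.

Lemma bilinear_expand (f : 'rV[R]_n -> 'rV[R]_n -> R) a b :
  (forall k u v w, f (k *: u + v) w = k * f u w + f v w) ->
  (forall k u v w, f w (k *: u + v) = k * f w u + f w v) ->
  f a b = bform (fun i j => f (delta_mx 0 i) (delta_mx 0 j)) a b.
Proof.
move=> fl fr; rewrite (linear_expand (f := f^~ b)) => [|k u v]; last exact: fl.
apply: eq_bigr => i _; rewrite (linear_expand (f := f _)) => [|k u v]; last exact: fr.
by rewrite mulr_sumr; apply: eq_bigr => j _; ring.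
Qed.

Lemma is_derive_bform (V : normedModType R) (B : 'I_n -> 'I_n -> V -> R)
    (X Y : V -> 'rV[R]_n) (x v : V) (dB : 'I_n -> 'I_n -> R) (dX dY : 'rV[R]_n) :
  (forall i j, is_derive x v (B i j) (dB i j)) ->
  (forall i, is_derive x v (fun z => X z 0 i) (dX 0 i)) ->
  (forall i, is_derive x v (fun z => Y z 0 i) (dY 0 i)) ->
  is_derive x v (fun z => bform (fun i j => B i j z) (X z) (Y z))
    (bform dB (X x) (Y x) + bform (fun i j => B i j x) dX (Y x)
      + bform (fun i j => B i j x) (X x) dY).
Proof.
move=> hB hX hY; pose D i j := is_derive_mul (is_derive_mul (hB i j) (hX i)) (hY j).
apply: is_derive_cast (is_derive_bigsum _ (fun i => is_derive_bigsum _ (D i))) _.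
rewrite /bform -!big_split; apply: eq_bigr => i _ /=.
by rewrite -!big_split; apply: eq_bigr => j _ /=; ring.
Qed.

End Bilinear.

Section RiemannianGeometry.
Variables (R : realType) (n : nat) (U : set 'rV[R]_n).
Variable h : 'rV[R]_n -> 'M[R]_n.

Record local_metric : Prop := LocalMetric {
  local_metric_open : open U;
  local_metric_smooth : forall i j, smooth_on U (fun x => h x i j);
  local_metric_sym : forall x, U x -> (h x)^T = h x;
  local_metric_pos : forall x, U x -> forall y, y != 0 -> 0 < inner h x y y
}.

Hypothesis gh : local_metric.
Let openU : open U := local_metric_open gh.
Let smooth_h := local_metric_smooth gh.
Let sym_h := local_metric_sym gh.
Let pos_h := local_metric_pos gh.
Implicit Types (x a b c u v w : 'rV[R]_n).

Local Notation "<[ a , b ]_ x" := (inner h x a b)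
  (at level 0, x at level 2, format "<[ a ,  b ]_ x").

Lemma innerDl x a b c : <[a + b, c]_x = <[a, c]_x + <[b, c]_x.
Proof. by have := bformPl (h x) 1 a b c; rewrite scale1r mul1r. Qed.
Lemma innerDr x a b c : <[c, a + b]_x = <[c, a]_x + <[c, b]_x.
Proof. by have := bformPr (h x) 1 a b c; rewrite scale1r mul1r. Qed.
Lemma inner0l x c : <[0, c]_x = 0.
Proof. by apply: (addIr <[0, c]_x); rewrite -innerDl !add0r. Qed.
Lemma inner0r x c : <[c, 0]_x = 0.
Proof. by apply: (addIr <[c, 0]_x); rewrite -innerDr !add0r. Qed.
Lemma innerZl x k a c : <[k *: a, c]_x = k * <[a, c]_x.
Proof.
have : <[k *: a + 0, c]_x = k * <[a, c]_x + <[0, c]_x by exact: bformPl.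
by rewrite inner0l !addr0.
Qed.
Lemma innerZr x k a c : <[c, k *: a]_x = k * <[c, a]_x.
Proof.
have : <[c, k *: a + 0]_x = k * <[c, a]_x + <[c, 0]_x by exact: bformPr.
by rewrite inner0r !addr0.
Qed.
Lemma innerNl x a c : <[- a, c]_x = - <[a, c]_x.
Proof. by rewrite -scaleN1r innerZl mulN1r. Qed.
Lemma innerNr x a c : <[c, - a]_x = - <[c, a]_x.
Proof. by rewrite -scaleN1r innerZr mulN1r. Qed.

Lemma sym_hE x i j : U x -> h x i j = h x j i.
Proof. by move=> Ux; rewrite -[in RHS](sym_h Ux) mxE. Qed.

Lemma innerC x a b : U x -> <[a, b]_x = <[b, a]_x.
Proof. by move=> Ux; apply: bformC => i j; exact: sym_hE. Qed.

Lemma inner_eq0 x a : U x -> <[a, a]_x = 0 -> a = 0.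
Proof.
move=> Ux aa0; apply/eqP; apply: contraT => a0.
by have := pos_h Ux a0; rewrite aa0 ltxx.
Qed.

Lemma inner_nondeg x a b : U x -> (forall c, <[a, c]_x = <[b, c]_x) -> a = b.
Proof.
move=> Ux ab; apply/eqP; rewrite -subr_eq0; apply/eqP/(inner_eq0 Ux).
by rewrite innerDl innerNl ab subrr.
Qed.

Lemma innerE x a b : <[a, b]_x = (a *m h x *m b^T) 0 0.
Proof.
rewrite /inner mxE exchange_big; apply: eq_bigr => j _.
rewrite !mxE mulr_suml; apply: eq_bigr => i _; ring.
Qed.

Lemma unit_h x : U x -> h x \in unitmx.
Proof.
move=> Ux; rewrite -row_free_unit -kermx_eq0; apply/eqP/row_matrixP => i.
rewrite row0; apply: (inner_eq0 Ux); rewrite innerE.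
by rewrite -row_mul mulmx_ker row0 mul0mx mxE.
Qed.

Definition sharp x (l : 'I_n -> R) : 'rV[R]_n :=
  \row_i \sum_j invmx (h x) i j * l j.

Lemma inner_sharp x l b : U x -> <[sharp x l, b]_x = \sum_j l j * b 0 j.
Proof.
move=> Ux; rewrite innerE.
have -> : sharp x l = (\row_j l j) *m invmx (h x).
  apply/rowP => i; rewrite !mxE; apply: eq_bigr => j _; rewrite !mxE mulrC.
  by rewrite -[in RHS](sym_h Ux) -trmx_inv mxE.
by rewrite mulmxKV ?unit_h// mxE; apply: eq_bigr => j _; rewrite !mxE.
Qed.

Definition dmetric x v a b : R :=
  bform (fun i j => 'D_v (fun z => h z i j) x) a b.

Lemma is_derive_inner (X Y : 'rV[R]_n -> 'rV[R]_n) x v (dX dY : 'rV[R]_n) :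
  U x ->
  (forall i, is_derive x v (fun z => X z 0 i) (dX 0 i)) ->
  (forall i, is_derive x v (fun z => Y z 0 i) (dY 0 i)) ->
  is_derive x v (fun z => <[X z, Y z]_z)
    (dmetric x v (X x) (Y x) + <[dX, Y x]_x + <[X x, dY]_x).
Proof.
move=> Ux hX hY; apply: is_derive_bform hX hY => i j.
exact/differentiable_is_derive/smooth_on_differentiable.
Qed.

Lemma is_derive_inner_cst x v a b :
  U x -> is_derive x v (fun z => <[a, b]_z) (dmetric x v a b).
Proof.
move=> Ux; apply: is_derive_cast.
  apply: (is_derive_inner (X := fun=> a) (Y := fun=> b) (dX := 0) (dY := 0)) => // i;
  rewrite mxE; exact: is_derive_const.
by rewrite inner0l inner0r !addr0.
Qed.

Lemma dmetricC x v a b : U x -> dmetric x v a b = dmetric x v b a.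
Proof.
move=> Ux; apply: bformC => i j; apply: near_eq_derive.
by apply: (near_eq_open openU) Ux => z; exact: sym_hE.
Qed.

Lemma dmetricPv x k v w a b : U x ->
  dmetric x (k *: v + w) a b = k * dmetric x v a b + dmetric x w a b.
Proof.
move=> Ux; rewrite /dmetric -bformPm; apply: bform_eq => i j.
by rewrite derive_linear//; exact: smooth_on_differentiable.
Qed.

Lemma dmetricPl x v k a b c :
  dmetric x v (k *: a + b) c = k * dmetric x v a c + dmetric x v b c.
Proof. exact: bformPl. Qed.
Lemma dmetricPr x v k a b c :
  dmetric x v c (k *: a + b) = k * dmetric x v c a + dmetric x v c b.
Proof. exact: bformPr. Qed.

(** The Christoffel symbols as a bilinear map.  This map and several below are
    known only through an opaque specification, so that unification compares
    them by their arguments and never by unfolding. *)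
Fact chr_sig : {f : 'rV[R]_n -> 'rV[R]_n -> 'rV[R]_n -> 'rV[R]_n |
  forall x a b i, f x a b 0 i = bform (fun j k => christoffel h i j k x) a b}.
Proof.
exists (fun x a b => \row_i bform (fun j k => christoffel h i j k x) a b).
by move=> x a b i; rewrite mxE.
Qed.

Definition chr := sval chr_sig.

Lemma chrE x a b i : chr x a b 0 i = bform (fun j k => christoffel h i j k x) a b.
Proof. exact: (svalP chr_sig). Qed.

Lemma chrPl x k u v b : chr x (k *: u + v) b = k *: chr x u b + chr x v b.
Proof. by apply/rowP => i; rewrite !rowE !chrE bformPl. Qed.
Lemma chrPr x k u v a : chr x a (k *: u + v) = k *: chr x a u + chr x a v.
Proof. by apply/rowP => i; rewrite !rowE !chrE bformPr. Qed.

Lemma christoffelC i j k x : U x ->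
  christoffel h i j k x = christoffel h i k j x.
Proof.
move=> Ux; rewrite /christoffel; congr (_ * _); apply: eq_bigr => l _.
congr (_ * _); congr (_ - _); first by rewrite addrC.
apply: near_eq_derive.
by apply: (near_eq_open openU) Ux => z; exact: sym_hE.
Qed.

Lemma chrC x a b : U x -> chr x a b = chr x b a.
Proof.
move=> Ux; apply/rowP => i; rewrite !chrE; apply: bformC => j k.
exact: christoffelC.
Qed.

(** Koszul's formula. *)
Lemma inner_chr x a b c : U x ->
  <[chr x a b, c]_x = 2^-1 * (dmetric x a c b + dmetric x b c a - dmetric x c a b).
Proof.
move=> Ux; pose f a b := sharp x (fun l => 2^-1 *
  (dmetric x a (delta_mx 0 l) b + dmetric x b (delta_mx 0 l) a
   - dmetric x (delta_mx 0 l) a b)).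
have fC u v : f u v = f v u.
  apply/rowP => i; rewrite !mxE; apply: eq_bigr => l _; congr (_ * (_ * _)).
  by congr (_ - _); [exact: addrC|exact: dmetricC].
have fl i k u v w : f (k *: u + v) w 0 i = k * f u w 0 i + f v w 0 i.
  rewrite !mxE mulr_sumr -big_split; apply: eq_bigr => l _ /=.
  rewrite dmetricPv// dmetricPr dmetricPl; ring.
have -> : chr x a b = f a b.
  apply/rowP => i; rewrite chrE [RHS](bilinear_expand (f := fun a b => f a b 0 i)).
  - rewrite /bform; apply: eq_bigr => j _; apply: eq_bigr => k _.
    congr (_ * _ * _); rewrite mxE /christoffel mulr_sumr; apply: eq_bigr => l _.
    by rewrite /dmetric !bform_delta /partial mulrCA.
  - by move=> k u v w; rewrite fl.
  - by move=> k u v w; rewrite fC fl !(fC w).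
rewrite inner_sharp// [dmetric x a c b](linear_expand (f := fun c => dmetric x a c b));
  last by move=> k u v; exact: dmetricPl.
rewrite [dmetric x b c a](linear_expand (f := fun c => dmetric x b c a));
  last by move=> k u v; exact: dmetricPl.
rewrite [dmetric x c a b](linear_expand (f := fun c => dmetric x c a b)); last first.
  by move=> k u v; exact: dmetricPv.
rewrite -sumrN -!big_split mulr_sumr; apply: eq_bigr => l _ /=; ring.
Qed.

Lemma metric_compat x v a b : U x ->
  dmetric x v a b = <[chr x v a, b]_x + <[a, chr x v b]_x.
Proof.
move=> Ux; rewrite (innerC _ (chr x v b))// !inner_chr//.
rewrite (dmetricC _ b a)// (dmetricC _ a v)// (dmetricC _ b v)//.
rewrite (dmetricC _ v a)//.
by move: (dmetric x v a b) (dmetric x a v b) (dmetric x b a v) => p q r; lra.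
Qed.

End RiemannianGeometry.

(** * Riemann curvature *)

Ltac abstract_inner :=
  repeat match goal with |- context [inner ?h ?x ?a ?b] =>
    let t := fresh "t" in generalize (inner h x a b); intro t end.

Section Curvature.
Variables (R : realType) (n : nat) (U : set 'rV[R]_n).
Variable h : 'rV[R]_n -> 'M[R]_n.
Hypothesis gh : local_metric U h.
Let openU : open U := local_metric_open gh.
Implicit Types (x a b c u v w : 'rV[R]_n).

Local Notation "<[ a , b ]_ x" := (inner h x a b)
  (at level 0, x at level 2, format "<[ a ,  b ]_ x").
Local Notation chr := (chr h).
Local Notation dmetric := (dmetric h).
Local Notation christoffelC := (christoffelC gh).
Local Notation unit_h := (unit_h gh).
Local Notation chrC := (chrC gh).
Local Notation innerC := (innerC gh).
Local Notation metric_compat := (metric_compat gh).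
Local Notation is_derive_inner := (is_derive_inner gh).
Local Notation is_derive_inner_cst := (is_derive_inner_cst gh).
Local Notation smooth_h := (local_metric_smooth gh).

Lemma chrDl x a b c : chr x (a + b) c = chr x a c + chr x b c.
Proof. by rewrite -[a]scale1r chrPl !scale1r. Qed.
Lemma chrDr x a b c : chr x c (a + b) = chr x c a + chr x c b.
Proof. by rewrite -[a]scale1r chrPr !scale1r. Qed.
Lemma chr0l x a : chr x 0 a = 0.
Proof. by apply: (addIr (chr x 0 a)); rewrite -chrDl !add0r. Qed.
Lemma chr0r x a : chr x a 0 = 0.
Proof. by apply: (addIr (chr x a 0)); rewrite -chrDr !add0r. Qed.
Lemma chrZl x k a c : chr x (k *: a) c = k *: chr x a c.
Proof. by rewrite -[k *: a]addr0 chrPl chr0l addr0. Qed.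
Lemma chrZr x k a c : chr x c (k *: a) = k *: chr x c a.
Proof. by rewrite -[k *: a]addr0 chrPr chr0r addr0. Qed.

Lemma smooth_christoffel i j k : smooth_on U (christoffel h i j k).
Proof.
apply: smooth_on_mul => //; first exact: smooth_on_cst.
apply: smooth_on_bigsum => // l; apply: smooth_on_mul => //.
  by apply: smooth_on_invmx => // [x|]; [exact: unit_h|exact: smooth_h].
apply: smooth_on_add => //; first apply: smooth_on_add => //.
- exact/smooth_on_partial/smooth_h.
- exact/smooth_on_partial/smooth_h.
- by apply: smooth_on_opp => //; exact/smooth_on_partial/smooth_h.
Qed.

Fact dchr_sig : {f : 'rV[R]_n -> 'rV[R]_n -> 'rV[R]_n -> 'rV[R]_n -> 'rV[R]_n |
  forall x v a b i,
    f x v a b 0 i = bform (fun j k => 'D_v (christoffel h i j k) x) a b}.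
Proof.
exists (fun x v a b => \row_i bform (fun j k => 'D_v (christoffel h i j k) x) a b).
by move=> x v a b i; rewrite mxE.
Qed.

Definition dchr := sval dchr_sig.

Lemma dchrE x v a b i :
  dchr x v a b 0 i = bform (fun j k => 'D_v (christoffel h i j k) x) a b.
Proof. exact: (svalP dchr_sig). Qed.

Lemma is_derive_chr (X Y : 'rV[R]_n -> 'rV[R]_n) x v (dX dY : 'rV[R]_n) i :
  U x ->
  (forall i, is_derive x v (fun z => X z 0 i) (dX 0 i)) ->
  (forall i, is_derive x v (fun z => Y z 0 i) (dY 0 i)) ->
  is_derive x v (fun z => chr z (X z) (Y z) 0 i)
    ((dchr x v (X x) (Y x) + chr x dX (Y x) + chr x (X x) dY) 0 i).
Proof.
move=> Ux hX hY.
have -> : (fun z => chr z (X z) (Y z) 0 i) =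
    (fun z => bform (fun j k => christoffel h i j k z) (X z) (Y z)).
  by apply/funext => z; rewrite chrE.
have dB j k : is_derive x v (christoffel h i j k) ('D_v (christoffel h i j k) x).
  apply: differentiable_is_derive.
  exact: smooth_on_differentiable (smooth_christoffel _ _ _) Ux.
by apply: is_derive_cast (is_derive_bform dB hX hY) _; rewrite !rowE dchrE !chrE.
Qed.

Lemma dchrPl x v k a b c : dchr x v (k *: a + b) c = k *: dchr x v a c + dchr x v b c.
Proof. by apply/rowP => i; rewrite !rowE !dchrE bformPl. Qed.
Lemma dchrPr x v k a b c : dchr x v c (k *: a + b) = k *: dchr x v c a + dchr x v c b.
Proof. by apply/rowP => i; rewrite !rowE !dchrE bformPr. Qed.
Lemma dchrPv x k v w a b : U x ->
  dchr x (k *: v + w) a b = k *: dchr x v a b + dchr x w a b.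
Proof.
move=> Ux; apply/rowP => i.
rewrite !rowE !dchrE -bformPm; apply: bform_eq => j l.
rewrite derive_linear//.
exact: smooth_on_differentiable (smooth_christoffel _ _ _) Ux.
Qed.
Lemma dchrC x v a b : U x -> dchr x v a b = dchr x v b a.
Proof.
move=> Ux; apply/rowP => i; rewrite !dchrE; apply: bformC => j k.
apply: near_eq_derive; apply: (near_eq_open openU) Ux => z Uz.
exact: christoffelC.
Qed.

(** The curvature [R(v, w) a] of [h], where [v], [w] and [a] are extended by
    constant coordinate fields. *)
Fact curv_sig : {f : 'rV[R]_n -> 'rV[R]_n -> 'rV[R]_n -> 'rV[R]_n -> 'rV[R]_n |
  forall x v w a, f x v w a =
    dchr x v w a - dchr x w v a + chr x v (chr x w a) - chr x w (chr x v a)}.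
Proof.
by exists (fun x v w a =>
  dchr x v w a - dchr x w v a + chr x v (chr x w a) - chr x w (chr x v a)).
Qed.

Definition curv := sval curv_sig.

Lemma curvE x v w a : curv x v w a =
  dchr x v w a - dchr x w v a + chr x v (chr x w a) - chr x w (chr x v a).
Proof. exact: (svalP curv_sig). Qed.

Lemma curv_anti x v w a : curv x w v a = - curv x v w a.
Proof.
by rewrite !curvE; apply/rowP => i; rewrite !rowE; ring.
Qed.

Lemma bianchi x a b c : U x -> curv x a b c + curv x b c a + curv x c a b = 0.
Proof.
move=> Ux; rewrite !curvE (chrC c a)// (chrC c b)// (chrC b a)//.
rewrite (dchrC b c a)// (dchrC a c b)// (dchrC c b a)//.
by apply/rowP => i; rewrite !rowE; ring.
Qed.

Lemma curvPv x k v w a b : U x ->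
  curv x (k *: v + w) a b = k *: curv x v a b + curv x w a b.
Proof.
move=> Ux; rewrite !curvE dchrPv// !chrPl !chrPr dchrPl.
apply/rowP => i; rewrite !rowE; ring.
Qed.
Lemma curvPr x k v w a b :
  curv x v w (k *: a + b) = k *: curv x v w a + curv x v w b.
Proof.
rewrite !curvE !dchrPr !chrPr; apply/rowP => i; rewrite !rowE; ring.
Qed.
(** Two derivatives of [<a, b>] along constant fields commute, and metric
    compatibility turns this into the skew-symmetry. *)
Lemma curv_skew x v w a b : U x ->
  <[curv x v w a, b]_x = - <[a, curv x v w b]_x.
Proof.
move=> Ux.
have E v1 v2 : 'D_v1 ('D_v2 (fun z => <[a, b]_z)) x =
    <[chr x v1 (chr x v2 a), b]_x + <[chr x v2 a, chr x v1 b]_x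
    + <[dchr x v1 v2 a, b]_x + (<[chr x v1 a, chr x v2 b]_x
    + <[a, chr x v1 (chr x v2 b)]_x + <[a, dchr x v1 v2 b]_x).
  rewrite (near_eq_derive (g := fun z => <[chr z v2 a, b]_z + <[a, chr z v2 b]_z)).
    have cst0 (c : 'rV[R]_n) i : is_derive x v1 (fun=> c 0 i) ((0 : 'rV[R]_n) 0 i).
      by rewrite mxE; exact: is_derive_const.
    have dc c i := is_derive_chr i Ux (cst0 v2) (cst0 c).
    have D := is_derive_add (is_derive_inner Ux (dc a) (cst0 b))
      (is_derive_inner Ux (cst0 a) (dc b)).
    rewrite (derive_val (is_derive := D)) !metric_compat// !chr0l !chr0r !inner0l !inner0r.
    by rewrite !addr0.
  apply: (near_eq_open openU) Ux => z Uz.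
  rewrite -metric_compat//; apply: derive_val; exact: is_derive_inner_cst.
have C : 'D_v ('D_w (fun z => <[a, b]_z)) x = 'D_w ('D_v (fun z => <[a, b]_z)) x.
  apply: derive_comm Ux => //; apply: smooth_on_bigsum => // i.
  apply: smooth_on_bigsum => // j.
  apply: smooth_on_mul => //; last exact: smooth_on_cst.
  by apply: smooth_on_mul => //; [exact: smooth_h|exact: smooth_on_cst].
move: C; rewrite !E !curvE !(innerDl, innerDr, innerNl, innerNr).
by abstract_inner => *; lra.
Qed.

Lemma curvDl x v w a b : U x -> curv x (v + w) a b = curv x v a b + curv x w a b.
Proof. by move=> Ux; rewrite -[v]scale1r curvPv// !scale1r. Qed.
Lemma curv0l x a b : U x -> curv x 0 a b = 0.
Proof. by move=> Ux; apply: (addIr (curv x 0 a b)); rewrite -curvDl// !add0r. Qed.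
Lemma curvZl x k v a b : U x -> curv x (k *: v) a b = k *: curv x v a b.
Proof. by move=> Ux; rewrite -[k *: v]addr0 curvPv// curv0l// addr0. Qed.
Lemma curvDm x v w a b : U x -> curv x a (v + w) b = curv x a v b + curv x a w b.
Proof.
by move=> Ux; rewrite !(curv_anti x _ a) curvDl// opprD.
Qed.
Lemma curvZm x k v a b : U x -> curv x a (k *: v) b = k *: curv x a v b.
Proof. by move=> Ux; rewrite !(curv_anti x _ a) curvZl// scalerN. Qed.
Lemma curvDr x v w a b : curv x v w (a + b) = curv x v w a + curv x v w b.
Proof. by rewrite -[a]scale1r curvPr !scale1r. Qed.
Lemma curv0r x v w : curv x v w 0 = 0.
Proof. by apply: (addIr (curv x v w 0)); rewrite -curvDr !add0r. Qed.
Lemma curvZr x k v w a : curv x v w (k *: a) = k *: curv x v w a.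
Proof. by rewrite -[k *: a]addr0 curvPr curv0r addr0. Qed.
Lemma curvNl x v a b : U x -> curv x (- v) a b = - curv x v a b.
Proof. by move=> Ux; rewrite -[in LHS]scaleN1r -[RHS]scaleN1r curvZl. Qed.
Lemma curvNm x v a b : U x -> curv x a (- v) b = - curv x a v b.
Proof. by move=> Ux; rewrite -[in LHS]scaleN1r -[RHS]scaleN1r curvZm. Qed.
Lemma curvNr x v w a : curv x v w (- a) = - curv x v w a.
Proof. by rewrite -[in LHS]scaleN1r -[RHS]scaleN1r curvZr. Qed.

Lemma curv_diag x v a : curv x v v a = 0.
Proof.
have E := curv_anti x v v a.
have : 2 *: curv x v v a = 0 by rewrite scaler_nat mulr2n {1}E addNr.
by move/eqP; rewrite scaler_eq0 pnatr_eq0 /= => /eqP.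
Qed.

(** The four Bianchi identities at the faces of the octahedron of index
    arrangements add up to the pair symmetry. *)
Lemma curv_pair x a b c d : U x ->
  <[curv x a b c, d]_x = <[curv x c d a, b]_x.
Proof.
move=> Ux; pose Rm a b c d := <[curv x a b c, d]_x.
have B p q r s : Rm p q r s + Rm q r p s + Rm r p q s = 0.
  by rewrite /Rm -!innerDl bianchi// inner0l.
have A p q r s : Rm p q r s = - Rm q p r s by rewrite /Rm curv_anti innerNl.
have K p q r s : Rm p q r s = - Rm p q s r.
  by rewrite /Rm curv_skew// innerC.
rewrite -!/(Rm _ _ _ _).
move: (B a b c d) (B b c d a) (B c d a b) (B d a b c).
move: (A b c a d) (A c a b d) (A c d b a) (A d b c a) (A d a c b) (A a c d b)
  (A a b d c) (A b d a c).
move: (K a b c d) (K b c a d) (K c a b d) (K c d a b) (K d b c a) (K d a b c)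
  (K a c b d) (K b d c a) (K c b a d) (K a d b c)  (K b c d a)
  (K c d b a) (K b d a c) (K d a c b) (K a c d b).
move: Rm {A B K} => Rm.
by move=> *; lra.
Qed.

Lemma bform_delta_l (B : 'I_n -> 'I_n -> R) k b :
  bform B (delta_mx 0 k) b = \sum_m B k m * b 0 m.
Proof.
rewrite (linear_expand (f := bform B (delta_mx 0 k))) => [|r u v]; last exact: bformPr.
by apply: eq_bigr => m _; rewrite bform_delta mulrC.
Qed.

Lemma curv_entry x u v w i : curv x u v w 0 i =
  bform (fun j k => 'D_u (christoffel h i j k) x) v w
  - bform (fun j k => 'D_v (christoffel h i j k) x) u w
  + bform (fun j k => christoffel h i j k x) u (chr x v w)
  - bform (fun j k => christoffel h i j k x) v (chr x u w).
Proof.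
rewrite curvE !rowDE !rowNE (dchrE x u) (dchrE x v).
by rewrite (chrE h x u (chr x v w)) (chrE h x v (chr x u w)).
Qed.

(** Both sides are trilinear, so that basis vectors suffice. *)
Lemma riemann_curvatureE x u v w i : U x ->
  \sum_j \sum_k \sum_l riemann_curvature h i j k l x * w 0 j * u 0 k * v 0 l
  = curv x u v w 0 i.
Proof.
move=> Ux.
rewrite [RHS](linear_expand (f := fun w => curv x u v w 0 i)) => [|r a b]; last first.
  by rewrite curvPr !rowE.
apply: eq_bigr => j _.
rewrite (linear_expand (f := fun u => curv x u v (delta_mx 0 j) 0 i))
  => [|r a b]; last first.
  by rewrite curvPv// !rowE.
rewrite mulr_sumr; apply: eq_bigr => k _.
rewrite (linear_expand
  (f := fun v => curv x (delta_mx 0 k) v (delta_mx 0 j) 0 i)) => [|r a b]; last first.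
  by rewrite curvDm// curvZm// !rowE.
rewrite !mulr_sumr; apply: eq_bigr => l _.
have -> : riemann_curvature h i j k l x =
    curv x (delta_mx 0 k) (delta_mx 0 l) (delta_mx 0 j) 0 i.
  rewrite curv_entry /riemann_curvature sumrB addrA.
  congr (_ - _ + _ - _); apply: esym.
  - exact: bform_delta.
  - exact: bform_delta.
  - apply: etrans (bform_delta_l _ _ _) _; apply: eq_bigr => m _.
    by congr (_ * _); exact: etrans (chrE _ _ _ _ _) (bform_delta _ _ _).
  - apply: etrans (bform_delta_l _ _ _) _; apply: eq_bigr => m _.
    by congr (_ * _); exact: etrans (chrE _ _ _ _ _) (bform_delta _ _ _).
by move: (curv _ _ _ _ _ _) (w _ _) (u _ _) (v _ _) => *; ring.
Qed.

End Curvature.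

(** * Unit fields and Killing fields *)


Section UnitField.
Variables (R : realType) (n : nat) (U : set 'rV[R]_n).
Variables (h : 'rV[R]_n -> 'M[R]_n) (W : 'rV[R]_n -> 'rV[R]_n).

Record local_unit_field : Prop := LocalUnitField {
  unit_field_metric : local_metric U h;
  unit_field_smooth : forall i, smooth_on U (fun x => W x 0 i);
  unit_field_norm : forall x, U x -> inner h x (W x) (W x) = 1
}.

Hypothesis gW : local_unit_field.
Let gh := unit_field_metric gW.
Let openU : open U := local_metric_open gh.
Implicit Types (x a b c u v w : 'rV[R]_n).

Local Notation "<[ a , b ]_ x" := (inner h x a b)
  (at level 0, x at level 2, format "<[ a ,  b ]_ x").
Local Notation chr := (chr h).
Local Notation dchr := (dchr h).
Local Notation curv := (curv h).
Local Notation dmetric := (dmetric h).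

Fact dfield_sig : {f : 'rV[R]_n -> 'rV[R]_n -> 'rV[R]_n |
  forall x v i, f x v 0 i = 'D_v (fun z => W z 0 i) x}.
Proof.
by exists (fun x v => \row_i 'D_v (fun z => W z 0 i) x) => x v i; rewrite mxE.
Qed.
Definition dfield := sval dfield_sig.
Lemma dfieldE x v i : dfield x v 0 i = 'D_v (fun z => W z 0 i) x.
Proof. exact: (svalP dfield_sig). Qed.

Fact d2field_sig : {f : 'rV[R]_n -> 'rV[R]_n -> 'rV[R]_n -> 'rV[R]_n |
  forall x v a i, f x v a 0 i = 'D_v ('D_a (fun z => W z 0 i)) x}.
Proof.
exists (fun x v a => \row_i 'D_v ('D_a (fun z => W z 0 i)) x) => x v a i.
by rewrite mxE.
Qed.
Definition d2field := sval d2field_sig.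
Lemma d2fieldE x v a i : d2field x v a 0 i = 'D_v ('D_a (fun z => W z 0 i)) x.
Proof. exact: (svalP d2field_sig). Qed.

(** The covariant derivative of [W] along a vector. *)
Fact cov_sig : {f : 'rV[R]_n -> 'rV[R]_n -> 'rV[R]_n |
  forall x v, f x v = dfield x v + chr x v (W x)}.
Proof. by exists (fun x v => dfield x v + chr x v (W x)). Qed.
Definition cov := sval cov_sig.
Lemma covE x v : cov x v = dfield x v + chr x v (W x).
Proof. exact: (svalP cov_sig). Qed.

Lemma covP x k a b : U x -> cov x (k *: a + b) = k *: cov x a + cov x b.
Proof.
move=> Ux; rewrite !covE chrPl; apply/rowP => i; rewrite !rowE !dfieldE.
rewrite derive_linear; last exact: smooth_on_differentiable (unit_field_smooth gW i) Ux.
ring.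
Qed.
Lemma covD x a b : U x -> cov x (a + b) = cov x a + cov x b.
Proof. by move=> Ux; rewrite -[a]scale1r covP// !scale1r. Qed.
Lemma cov0 x : U x -> cov x 0 = 0.
Proof. by move=> Ux; apply: (addIr (cov x 0)); rewrite -covD// !add0r. Qed.
Lemma covZ x k a : U x -> cov x (k *: a) = k *: cov x a.
Proof. by move=> Ux; rewrite -[k *: a]addr0 covP// cov0// addr0. Qed.
Lemma covN x a : U x -> cov x (- a) = - cov x a.
Proof. by move=> Ux; rewrite -[- a]scaleN1r covZ// scaleN1r. Qed.

Lemma is_derive_field x v i : U x ->
  is_derive x v (fun z => W z 0 i) (dfield x v 0 i).
Proof.
move=> Ux; rewrite dfieldE; apply: differentiable_is_derive.
exact: smooth_on_differentiable (unit_field_smooth gW i) Ux.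
Qed.

Lemma is_derive_row_cst (a x v : 'rV[R]_n) i :
  is_derive x v (fun=> a 0 i) ((0 : 'rV[R]_n) 0 i).
Proof. by rewrite row0E; exact: is_derive_const. Qed.

Lemma is_derive_cov x v a i : U x ->
  is_derive x v (fun z => cov z a 0 i)
    ((d2field x v a + dchr x v a (W x) + chr x a (dfield x v)) 0 i).
Proof.
move=> Ux.
have -> : (fun z => cov z a 0 i) =
    (fun z => 'D_a (fun z => W z 0 i) z + chr z a (W z) 0 i).
  by apply/funext => z; rewrite covE rowE dfieldE.
have D1 : is_derive x v ('D_a (fun z => W z 0 i)) (d2field x v a 0 i).
  rewrite d2fieldE; apply: differentiable_is_derive.
  apply: smooth_on_differentiable Ux.
  by apply: smooth_on_derive => //; exact: unit_field_smooth.
have D2 := is_derive_chr gh i Ux (is_derive_row_cst a x v)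
  (fun j => is_derive_field v j Ux).
apply: is_derive_cast (is_derive_add D1 D2) _.
by rewrite chr0l !rowE addr0 addrA.
Qed.

(** Metric compatibility, with [chr x v b] as the covariant derivative of the
    constant coordinate field [b]. *)
Lemma is_derive_dual x v b : U x ->
  is_derive x v (fun z => <[W z, b]_z) (<[cov x v, b]_x + <[W x, chr x v b]_x).
Proof.
move=> Ux.
have D := is_derive_inner gh Ux (fun i => is_derive_field v i Ux)
  (is_derive_row_cst b x v).
apply: is_derive_cast D _.
rewrite (metric_compat gh)// inner0r covE innerDl.
by abstract_inner => *; ring.
Qed.

Lemma inner_cov_field x v : U x -> <[cov x v, W x]_x = 0.
Proof.
move=> Ux.
have D := is_derive_inner gh Ux (fun i => is_derive_field v i Ux)
  (fun i => is_derive_field v i Ux).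
have : 'D_v (fun z => <[W z, W z]_z) x = 0.
  by apply: (derive_eq_cst openU _ _ Ux); exact: unit_field_norm.
rewrite (derive_val (is_derive := D)) (metric_compat gh)//.
rewrite !(innerC gh (W x) _ Ux) covE innerDl.
by abstract_inner => *; lra.
Qed.

Lemma inner_field_cov x v : U x -> <[W x, cov x v]_x = 0.
Proof. by move=> Ux; rewrite (innerC gh)// inner_cov_field. Qed.

(** The second covariant derivative of [W], that is the covariant derivative
    along [v] of the endomorphism [cov], applied to [a]. *)
Definition cov2 x v a : 'rV[R]_n :=
  d2field x v a + dchr x v a (W x) + chr x a (dfield x v)
  + chr x v (cov x a) - cov x (chr x v a).

Lemma ricci_identity x v a : U x ->
  cov2 x v a - cov2 x a v = curv x v a (W x).
Proof.
move=> Ux; have d2C : d2field x v a = d2field x a v.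
  apply/rowP => i; rewrite !d2fieldE.
  by apply: derive_comm Ux => //; exact: unit_field_smooth.
rewrite /cov2 curvE d2C (chrC gh v a)// !covE !(chrDr h).
by apply/rowP => i; rewrite !rowE; ring.
Qed.

(** Metric compatibility removes the derivatives of [h] from the Lie derivative
    of [h] along [W]. *)
Lemma local_killing_basis x : U x ->
  (forall i j : 'I_n,
    \sum_k (W x 0 k * partial k (fun z => h z i j) x
            + h x k j * partial i (fun z => W z 0 k) x
            + h x i k * partial j (fun z => W z 0 k) x) = 0) <->
  (forall a b, <[cov x a, b]_x + <[a, cov x b]_x = 0).
Proof.
move=> Ux.
have E i j : \sum_k (W x 0 k * partial k (fun z => h z i j) x
            + h x k j * partial i (fun z => W z 0 k) x
            + h x i k * partial j (fun z => W z 0 k) x) =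
    <[cov x (delta_mx 0 i), delta_mx 0 j]_x
    + <[delta_mx 0 i, cov x (delta_mx 0 j)]_x.
  have C := chrC gh.
  rewrite !covE (C x (delta_mx 0 i))// (C x (delta_mx 0 j))// innerDl innerDr.
  have -> (p q r s : R) : p + q + (r + s) = (q + s) + p + r by ring.
  rewrite -(metric_compat gh)// !big_split /=; congr (_ + _ + _).
  - apply: etrans _ (esym (bform_delta _ _ _)).
    rewrite derive_sum_partial//.
    exact: smooth_on_differentiable (local_metric_smooth gh i j) Ux.
  - rewrite [RHS](linear_expand (f := fun a => <[a, delta_mx 0 j]_x)) => [|r u v]; last first.
      by rewrite innerDl innerZl.
    apply: eq_bigr => k _; rewrite dfieldE mulrC; congr (_ * _).
    exact: (esym (bform_delta _ _ _)).
  - rewrite [RHS](linear_expand (f := fun a => <[delta_mx 0 i, a]_x)) => [|r u v]; last first.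
      by rewrite innerDr innerZr.
    apply: eq_bigr => k _; rewrite dfieldE mulrC; congr (_ * _).
    exact: (esym (bform_delta _ _ _)).
split=> [K a b|K i j]; last by rewrite E K.
rewrite (bilinear_expand (f := fun a b => <[cov x a, b]_x + <[a, cov x b]_x)).
- apply: big1 => i _; apply: big1 => j _.
  by rewrite -E K !mul0r.
- move=> r u v w; rewrite covP// !innerDl !innerZl.
  by abstract_inner => *; ring.
- move=> r u v w; rewrite covP// !innerDr !innerZr.
  by abstract_inner => *; ring.
Qed.

End UnitField.

Section KillingField.
Variables (R : realType) (n : nat) (U : set 'rV[R]_n).
Variables (h : 'rV[R]_n -> 'M[R]_n) (W : 'rV[R]_n -> 'rV[R]_n).
Hypothesis gW : local_unit_field U h W.
Let gh := unit_field_metric gW.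
Let openU : open U := local_metric_open gh.
Implicit Types (x a b c u v w : 'rV[R]_n).

Local Notation "<[ a , b ]_ x" := (inner h x a b)
  (at level 0, x at level 2, format "<[ a ,  b ]_ x").
Local Notation chr := (chr h).
Local Notation dchr := (dchr h).
Local Notation curv := (curv h).
Local Notation cov := (cov h W).
Local Notation cov2 := (cov2 h W).

Hypothesis killingW : forall x, U x ->
  forall a b, <[cov x a, b]_x + <[a, cov x b]_x = 0.

Lemma cov_skew x a b : U x -> <[cov x a, b]_x = - <[a, cov x b]_x.
Proof. by move=> Ux; apply/eqP; rewrite -addr_eq0 killingW. Qed.

Lemma cov2_skew x v a b : U x ->
  <[cov2 x v a, b]_x = - <[a, cov2 x v b]_x.
Proof.
move=> Ux.
have c0 := is_derive_row_cst.
have dS a i := is_derive_cov gW v a i Ux.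
have D := is_derive_add (is_derive_inner gh Ux (dS a) (c0 _ _ b x v))
  (is_derive_inner gh Ux (c0 _ _ a x v) (dS b)).
have : 'D_v (fun z => <[cov z a, b]_z + <[a, cov z b]_z) x = 0.
  by apply: (derive_eq_cst openU _ _ Ux) => z Uz; exact: killingW.
rewrite (derive_val (is_derive := D)) !(metric_compat gh)// inner0l inner0r.
rewrite /cov2 !(innerDl, innerDr, innerNl, innerNr).
rewrite (cov_skew (chr x v a))// -(opprK <[a, cov x (chr x v b)]_x) -(cov_skew a)//.
by abstract_inner => *; lra.
Qed.

(** Kostant's formula: skew-symmetry of [cov2 x v] and the Ricci identity
    determine the second derivative of a Killing field, as the Koszul argument
    determines the Levi-Civita connection. *)
Lemma cov2_killing x v a : U x -> cov2 x v a = - curv x (W x) v a.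
Proof.
move=> Ux; apply: (inner_nondeg gh Ux) => c; rewrite innerNl.
pose T p q r := <[cov2 x p q, r]_x.
have A p q r : T p q r = - T p r q by rewrite /T cov2_skew// (innerC gh).
pose M r p q := <[curv x (W x) r p, q]_x.
have C p q r : T p q r - T q p r = M r p q.
  by rewrite /T /M -innerNl -innerDl (ricci_identity gW)// (curv_pair gh).
have K r p q : M r p q = - M r q p.
  by rewrite /M (curv_skew gh)// (innerC gh).
have B p q r : M r p q - M q p r + M p q r = 0.
  have -> : M r p q = <[curv x p q (W x), r]_x by rewrite /M (curv_pair gh).
  rewrite /M -innerNl -(curv_anti h) -!innerDl (bianchi gh)//.
  exact: inner0l.
rewrite -/(T v a c) -/(M v a c).
move: (C v a c) (C a c v) (C c v a) (A v a c) (A a c v) (A c v a) (B a c v)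
  (B v a c) (K v a c) (K a c v) (K c v a).
by move: T M {A C K B} => T M *; lra.
Qed.

(** The derivative along [v] of [<W, cov a> = 0]. *)
Lemma inner_cov_cov x v a : U x ->
  <[cov x v, cov x a]_x = <[curv x (W x) v a, W x]_x.
Proof.
move=> Ux.
have D := is_derive_inner gh Ux (fun i => is_derive_field gW v i Ux)
  (fun i => is_derive_cov gW v a i Ux).
have : 'D_v (fun z => <[W z, cov z a]_z) x = 0.
  by apply: (derive_eq_cst openU _ _ Ux) => z Uz; exact: (inner_field_cov gW).
rewrite (derive_val (is_derive := D)) (metric_compat gh)//.
have -> : curv x (W x) v a = - cov2 x v a by rewrite cov2_killing// opprK.
have E := inner_field_cov gW (chr x v a) Ux.
rewrite (innerC gh (- _))// [cov x v]covE /cov2 !(innerDr, innerNr, innerDl) E.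
by move=> {E D}; abstract_inner => *; lra.
Qed.

Lemma cov_cov x v : U x -> cov x (cov x v) = curv x (W x) v (W x).
Proof.
move=> Ux; apply: (inner_nondeg gh Ux) => c.
rewrite cov_skew// inner_cov_cov// (curv_skew gh)// opprK (innerC gh)//.
Qed.

End KillingField.

(** * Curvature of sprays with rational coefficients *)

Section DirectionalOperators.
Variables (R : realType) (n : nat).
Local Notation V := 'rV[R]_n.
Implicit Types (f g : V -> V -> R) (x y v w : V).

(** Derivatives along an arbitrary direction; [dx k] and [dy k] are those along
    the basis vectors. *)
Definition dirx v f x y : R := 'D_v (fun z => f z y) x.
Definition diry v f x y : R := 'D_v (f x) y.

Variables (U : set V) (D : V -> V -> R) (Omega : V -> V -> Prop).

(** Partial derivatives only need openness in each variable separately. *)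
Record slit_domain : Prop := SlitDomain {
  slit_base_open : open U;
  slit_base : forall x y, Omega x y -> U x;
  slit_openx : forall x y, Omega x y -> \forall z \near x, Omega z y;
  slit_openy : forall x y, Omega x y -> \forall z \near y, Omega x z;
  slit_denom : forall x y, Omega x y -> D x y != 0
}.

(** Functions on [Omega] that are polynomial in [y] over the smooth functions
    of [x], with [1 / D] adjoined when [b] holds.  The class is stable under all
    derivatives, which settles every question of differentiability, and it keeps
    track of denominators, which is what the pole argument needs. *)
Inductive ratfun (b : bool) : (V -> V -> R) -> Prop :=
| rat_coef c : smooth_on U c -> ratfun b (fun x _ => c x)
| rat_coord j : ratfun b (fun _ y => y 0 j)
| rat_inv : b -> ratfun b (fun x y => (D x y)^-1)
| rat_add f g : ratfun b f -> ratfun b g -> ratfun b (fun x y => f x y + g x y)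
| rat_mul f g : ratfun b f -> ratfun b g -> ratfun b (fun x y => f x y * g x y)
| rat_eq f g : ratfun b f -> (forall x y, Omega x y -> f x y = g x y) ->
    ratfun b g.

Lemma rat_cst b k : ratfun b (fun _ _ => k).
Proof.
apply: (rat_coef b (c := fun=> k)) => s x _.
suff [k' ->] : exists k', foldr (@partial R n) (fun=> k) s = fun=> k'.
  exact: differentiable_cst.
elim: s => [|i s [k' IH]]; first by exists k.
by exists 0; rewrite /= IH; apply/funext => z; exact: derive_cst.
Qed.

Lemma rat_opp b f : ratfun b f -> ratfun b (fun x y => - f x y).
Proof.
move=> rf; apply: rat_eq (rat_mul (rat_cst b (-1)) rf) _ => x y _.
exact: mulN1r.
Qed.

Lemma rat_sum b (I : Type) (s : seq I) (f : I -> V -> V -> R) :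
  (forall i, ratfun b (f i)) ->
  ratfun b (fun x y => \sum_(i <- s) f i x y).
Proof.
move=> rf; elim: s => [|i s IHs].
  by apply: rat_eq (rat_cst b 0) _ => x y _; rewrite big_nil.
apply: rat_eq (rat_add (rf i) IHs) _ => x y _.
by rewrite big_cons.
Qed.

Lemma ratW b f : ratfun false f -> ratfun b f.
Proof.
elim=> [c sc|j|//|{}f g _ IHf _ IHg|{}f g _ IHf _ IHg|{}f g _ IHf fg].
- exact: rat_coef.
- exact: rat_coord.
- exact: rat_add.
- exact: rat_mul.
- exact: rat_eq IHf fg.
Qed.

Hypothesis sO : slit_domain.
Hypothesis rD : ratfun false D.
Let openU := slit_base_open sO.

Lemma dirx_eq f g v x y : (forall x y, Omega x y -> f x y = g x y) ->
  Omega x y -> dirx v f x y = dirx v g x y.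
Proof.
move=> fg Oxy; apply: near_eq_derive.
by apply: filterS (slit_openx sO Oxy) => z; exact: fg.
Qed.

Lemma diry_eq f g v x y : (forall x y, Omega x y -> f x y = g x y) ->
  Omega x y -> diry v f x y = diry v g x y.
Proof.
move=> fg Oxy; apply: near_eq_derive.
by apply: filterS (slit_openy sO Oxy) => z; exact: fg.
Qed.

Let both f x y := differentiable (fun z => f z y) x /\ differentiable (f x) y.

(* The case [b = false] supplies the differentiability of [D] for [b = true]. *)
Let rat_both_ind b f : ratfun b f ->
  (b -> forall x y, Omega x y -> both D x y) ->
  forall x y, Omega x y -> both f x y.
Proof.
move=> rf hD; elim: f / rf.
- move=> c sc x y Oxy; split; last exact: differentiable_cst.
  exact: smooth_on_differentiable sc (slit_base sO Oxy).
- move=> j x y Oxy; split; first exact: differentiable_cst.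
  exact: differentiable_coord.
- move=> hb x y Oxy; have [dx dy] := hD hb x y Oxy; have D0 := slit_denom sO Oxy.
  by split; [exact: differentiableV dx D0|exact: differentiableV dy D0].
- move=> f g _ IHf _ IHg x y Oxy.
  have [fx fy] := IHf x y Oxy; have [gx gy] := IHg x y Oxy.
  by split; [exact: differentiableD fx gx|exact: differentiableD fy gy].
- move=> f g _ IHf _ IHg x y Oxy.
  have [fx fy] := IHf x y Oxy; have [gx gy] := IHg x y Oxy.
  by split; [exact: differentiableM fx gx|exact: differentiableM fy gy].
- move=> f g _ IHf fg x y Oxy; have [fx fy] := IHf x y Oxy.
  split; [apply: near_eq_differentiable fx|apply: near_eq_differentiable fy].
    by apply: filterS (slit_openx sO Oxy) => z; exact: fg.
  by apply: filterS (slit_openy sO Oxy) => z; exact: fg.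
Qed.

Let rat_both b f x y : ratfun b f -> Omega x y -> both f x y.
Proof.
move=> rf; move: x y; apply: rat_both_ind rf _ => _ x y.
exact: (rat_both_ind rD).
Qed.

Lemma rat_diffx b f x y : ratfun b f -> Omega x y ->
  differentiable (fun z => f z y) x.
Proof. by move=> rf Oxy; case: (rat_both rf Oxy). Qed.

Lemma rat_diffy b f x y : ratfun b f -> Omega x y -> differentiable (f x) y.
Proof. by move=> rf Oxy; case: (rat_both rf Oxy). Qed.

Lemma rat_is_dirx b f v x y : ratfun b f -> Omega x y ->
  is_derive x v (fun z => f z y) (dirx v f x y).
Proof. by move=> rf Oxy; exact/differentiable_is_derive/(rat_diffx rf). Qed.

Lemma rat_is_diry b f v x y : ratfun b f -> Omega x y ->
  is_derive y v (f x) (diry v f x y).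
Proof. by move=> rf Oxy; exact/differentiable_is_derive/(rat_diffy rf). Qed.

Lemma dirxD b f g v x y : ratfun b f -> ratfun b g -> Omega x y ->
  dirx v (fun x y => f x y + g x y) x y = dirx v f x y + dirx v g x y.
Proof.
move=> rf rg Oxy.
exact: (derive_val (is_derive := is_derive_add (rat_is_dirx v rf Oxy)
  (rat_is_dirx v rg Oxy))).
Qed.

Lemma diryD b f g v x y : ratfun b f -> ratfun b g -> Omega x y ->
  diry v (fun x y => f x y + g x y) x y = diry v f x y + diry v g x y.
Proof.
move=> rf rg Oxy.
exact: (derive_val (is_derive := is_derive_add (rat_is_diry v rf Oxy)
  (rat_is_diry v rg Oxy))).
Qed.

Lemma dirxM b f g v x y : ratfun b f -> ratfun b g -> Omega x y ->
  dirx v (fun x y => f x y * g x y) x y =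
  dirx v f x y * g x y + f x y * dirx v g x y.
Proof.
move=> rf rg Oxy.
exact: (derive_val (is_derive := is_derive_mul (rat_is_dirx v rf Oxy)
  (rat_is_dirx v rg Oxy))).
Qed.

Lemma diryM b f g v x y : ratfun b f -> ratfun b g -> Omega x y ->
  diry v (fun x y => f x y * g x y) x y =
  diry v f x y * g x y + f x y * diry v g x y.
Proof.
move=> rf rg Oxy.
exact: (derive_val (is_derive := is_derive_mul (rat_is_diry v rf Oxy)
  (rat_is_diry v rg Oxy))).
Qed.

Lemma diry_coord v j x y : diry v (fun _ y => y 0 j) x y = v 0 j.
Proof.
have /derive_mx E : derivable (id : V -> V) y v by exact: derivable_id.
by rewrite derive_id in E; rewrite [in RHS]E mxE.
Qed.

Let rat_dir_ind b f v : ratfun b f ->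
  (b -> ratfun b (dirx v D) /\ ratfun b (diry v D)) ->
  ratfun b (dirx v f) /\ ratfun b (diry v f).
Proof.
move=> rf hD; elim: f / rf.
- move=> c sc; split.
    exact: (rat_coef b (c := 'D_v c)) (smooth_on_derive openU v sc).
  by apply: rat_eq (rat_cst b 0) _ => x y _; apply/esym; exact: derive_cst.
- move=> j; split.
    by apply: rat_eq (rat_cst b 0) _ => x y _; apply/esym; exact: derive_cst.
  by apply: rat_eq (rat_cst b (v 0 j)) _ => x y _; rewrite diry_coord.
- move=> hb; have [rx ry] := hD hb; have ri := rat_inv hb.
  have rDb := ratW b rD.
  split.
    apply: rat_eq (rat_mul (rat_opp rx) (rat_mul ri ri)) _ => x y Oxy.
    apply: esym; apply: derive_val.
    apply: is_derive_cast (is_derive_inv (slit_denom sO Oxy) (rat_is_dirx v rDb Oxy)) _.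
    by rewrite expr2 invfM.
  apply: rat_eq (rat_mul (rat_opp ry) (rat_mul ri ri)) _ => x y Oxy.
  apply: esym; apply: derive_val.
  apply: is_derive_cast (is_derive_inv (slit_denom sO Oxy) (rat_is_diry v rDb Oxy)) _.
  by rewrite expr2 invfM.
- move=> f g rf [fx fy] rg [gx gy]; split.
    by apply: rat_eq (rat_add fx gx) _ => x y Oxy; rewrite -(dirxD v rf rg).
  by apply: rat_eq (rat_add fy gy) _ => x y Oxy; rewrite -(diryD v rf rg).
- move=> f g rf [fx fy] rg [gx gy]; split.
    apply: rat_eq (rat_add (rat_mul fx rg) (rat_mul rf gx)) _ => x y Oxy.
    by rewrite -(dirxM v rf rg).
  apply: rat_eq (rat_add (rat_mul fy rg) (rat_mul rf gy)) _ => x y Oxy.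
  by rewrite -(diryM v rf rg).
- move=> f g rf [fx fy] fg; split.
    by apply: rat_eq fx _ => x y Oxy; exact: dirx_eq.
  by apply: rat_eq fy _ => x y Oxy; exact: diry_eq.
Qed.

Let rat_dir b f v : ratfun b f -> ratfun b (dirx v f) /\ ratfun b (diry v f).
Proof.
move=> rf; apply: rat_dir_ind (rf) _ => _.
by have [] := rat_dir_ind (v := v) rD => // rx ry; split; exact: ratW.
Qed.

Lemma rat_dirx b f v : ratfun b f -> ratfun b (dirx v f).
Proof. by move=> /(rat_dir v)[]. Qed.

Lemma rat_diry b f v : ratfun b f -> ratfun b (diry v f).
Proof. by move=> /(rat_dir v)[]. Qed.

Lemma dirx_sum b f v x y : ratfun b f -> Omega x y ->
  dirx v f x y = \sum_k v 0 k * dx k f x y.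
Proof. by move=> rf Oxy; exact/derive_sum_partial/(rat_diffx rf). Qed.

Lemma diry_sum b f v x y : ratfun b f -> Omega x y ->
  diry v f x y = \sum_k v 0 k * dy k f x y.
Proof. by move=> rf Oxy; exact/derive_sum_partial/(rat_diffy rf). Qed.

Lemma rat_dx b f k : ratfun b f -> ratfun b (dx k f).
Proof. exact: rat_dirx. Qed.
Lemma rat_dy b f k : ratfun b f -> ratfun b (dy k f).
Proof. exact: rat_diry. Qed.

Lemma rat_dirx_var b f (X : V -> V -> V) : ratfun b f ->
  (forall j, ratfun b (fun x y => X x y 0 j)) ->
  ratfun b (fun x y => dirx (X x y) f x y).
Proof.
move=> rf rX.
apply: rat_eq (rat_sum _ (fun k => rat_mul (rX k) (rat_dx k rf))) _ => x y Oxy.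
by rewrite (dirx_sum _ rf).
Qed.

Lemma rat_diry_var b f (X : V -> V -> V) : ratfun b f ->
  (forall j, ratfun b (fun x y => X x y 0 j)) ->
  ratfun b (fun x y => diry (X x y) f x y).
Proof.
move=> rf rX.
apply: rat_eq (rat_sum _ (fun k => rat_mul (rX k) (rat_dy k rf))) _ => x y Oxy.
by rewrite (diry_sum _ rf).
Qed.

Lemma diryP b f k v w x y : ratfun b f -> Omega x y ->
  diry (k *: v + w) f x y = k * diry v f x y + diry w f x y.
Proof. by move=> rf Oxy; apply: derive_linear; exact: rat_diffy rf Oxy. Qed.

Lemma rat_line b f x y v : ratfun b f ->
  (forall t, Omega x (y + t *: v)) -> (forall t, D x (y + t *: v) = 1) ->
  exists p : {poly R}, forall t, f x (y + t *: v) = p.[t].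
Proof.
move=> rf hO hD; elim: f / rf.
- by move=> c _; exists (c x)%:P => t; rewrite hornerC.
- by move=> j; exists ((y 0 j)%:P + v 0 j *: 'X) => t; rewrite !rowE !hornerE mulrC.
- by move=> _; exists 1 => t; rewrite hD invr1 hornerE.
- by move=> f g _ [p hp] _ [q hq]; exists (p + q) => t; rewrite hornerD hp hq.
- by move=> f g _ [p hp] _ [q hq]; exists (p * q) => t; rewrite hornerM hp hq.
- by move=> f g _ [p hp] fg; exists p => t; rewrite -fg.
Qed.

(** The curvature [R^i_k v^k] of a spray with coefficients [G]. *)
Definition spray_curvature (G : V -> V -> V) v (i : 'I_n) x y : R :=
  let Gi := fun i x y => G x y 0 i in
  2 * dirx v (Gi i) x y - dirx y (diry v (Gi i)) x y
  + 2 * diry (G x y) (diry v (Gi i)) x y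
  - diry (\row_j diry v (Gi j) x y) (Gi i) x y.

(** Contraction with [v] turns the sums over indices into derivatives along the
    directions [v], [y] and [G x y]. *)
Lemma finsler_curvature_contract (F : V -> V -> R) (G : V -> V -> V) b v i x y :
  (forall i, ratfun b (fun x y => G x y 0 i)) ->
  (forall i x y, Omega x y -> spray F i x y = G x y 0 i) -> Omega x y ->
  \sum_k v 0 k * finsler_curvature F i k x y = spray_curvature G v i x y.
Proof.
move=> rG FG Oxy; rewrite /spray_curvature /finsler_curvature.
have Ek k z w : Omega z w -> dy k (spray F i) z w = dy k (fun x y => G x y 0 i) z w.
  by apply: diry_eq => *; exact: FG.
have Ex k : dx k (spray F i) x y = dx k (fun x y => G x y 0 i) x y.
  by apply: dirx_eq Oxy => *; exact: FG.
have sum_dir (X : V) (d : V -> (V -> V -> R) -> V -> V -> R) :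
    d = dirx \/ d = diry ->
    d X (diry v (fun x y => G x y 0 i)) x y =
    \sum_k v 0 k * d X (dy k (spray F i)) x y.
  move=> hd; transitivity (d X (fun x y => \sum_k v 0 k * dy k (spray F i) x y) x y).
    have eqv z w : Omega z w -> diry v (fun x y => G x y 0 i) z w =
        \sum_k v 0 k * dy k (spray F i) z w.
      by move=> Ozw; rewrite (diry_sum _ (rG i))//; apply: eq_bigr => k _; rewrite Ek.
    by case: hd => ->; [exact: dirx_eq|exact: diry_eq].
  have rk k : ratfun b (dy k (spray F i)).
    apply: rat_eq (rat_dy k (rG i)) _ => z w Ozw; exact/esym/Ek.
  case: hd => ->; apply: derive_val; apply: is_derive_bigsum => k;
  apply: is_derive_scale; [exact: rat_is_dirx (rk k) Oxy|exact: rat_is_diry (rk k) Oxy].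
rewrite (sum_dir y dirx (or_introl erefl)) (sum_dir _ diry (or_intror erefl)).
have rk k : ratfun b (dy k (spray F i)).
  apply: rat_eq (rat_dy k (rG i)) _ => z w Ozw; exact/esym/Ek.
have split4 (p q r t : 'I_n -> R) :
    \sum_k v 0 k * (2 * p k - q k + 2 * r k - t k) =
    2 * (\sum_k v 0 k * p k) - \sum_k v 0 k * q k
    + 2 * (\sum_k v 0 k * r k) - \sum_k v 0 k * t k.
  rewrite !mulr_sumr -!sumrB -big_split -sumrB; apply: eq_bigr => k _ /=; ring.
rewrite split4; congr (2 * _ - _ + 2 * _ - _).
- by rewrite (dirx_sum v (rG i))//; apply: eq_bigr => k _; rewrite Ex.
- by apply: eq_bigr => k _; congr (_ * _); rewrite (dirx_sum _ (rk k)).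
- apply: eq_bigr => k _; congr (_ * _); rewrite (diry_sum _ (rk k))//.
  by apply: eq_bigr => j _; rewrite FG.
- rewrite (diry_sum _ (rG i))//.
  under eq_bigr => k _ do rewrite mulr_sumr.
  rewrite exchange_big; apply: eq_bigr => j _ /=.
  rewrite mxE (diry_sum _ (rG j))// mulr_suml; apply: eq_bigr => k _.
  have -> : dy k (spray F j) x y = dy k (fun x y => G x y 0 j) x y.
    by apply: diry_eq Oxy => *; exact: FG.
  by rewrite Ek// -mulrA; congr (_ * _); exact: mulrC.
Qed.

End DirectionalOperators.

(** * Projective change of a spray *)

Ltac abstract_dir :=
  repeat match goal with
  | |- context [dirx ?v ?f ?x ?y] =>
    let t := fresh "t" in generalize (dirx v f x y); intro t
  | |- context [diry ?v ?f ?x ?y] =>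
    let t := fresh "t" in generalize (diry v f x y); intro t
  end.

Section SprayChange.
Variables (R : realType) (n : nat).
Local Notation V := 'rV[R]_n.
Variables (U : set V) (D : V -> V -> R) (Omega : V -> V -> Prop).
Hypothesis sO : slit_domain U D Omega.
Local Notation ratfun := (ratfun U D Omega).
Hypothesis rD : ratfun false D.
Implicit Types (f g P : V -> V -> R) (x y v w : V) (G : V -> V -> V).

Lemma diryDv b f v w x y : ratfun b f -> Omega x y ->
  diry (v + w) f x y = diry v f x y + diry w f x y.
Proof.
by move=> rf Oxy; rewrite -[v]scale1r (diryP sO rD _ _ _ rf)// mul1r scale1r.
Qed.

Lemma diryZv b f k v x y : ratfun b f -> Omega x y ->
  diry (k *: v) f x y = k * diry v f x y.
Proof.
move=> rf Oxy; rewrite -[k *: v]addr0 (diryP sO rD _ _ _ rf)//.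
by rewrite [diry 0 f x y]derive0 addr0.
Qed.

(** Euler's relation. *)
Lemma diry_homogeneous b f (d : nat) x y : ratfun b f -> Omega x y ->
  (forall t, 0 < t -> f x (t *: y) = t ^+ d * f x y) ->
  diry y f x y = d%:R * f x y.
Proof.
move=> rf Oxy fh.
have E1 : is_derive (1 : R) 1 (fun t : R => f x (t *: y + 0)) (diry y f x y).
  have := @is_derive_line R _ (f x) 0 y 1.
  by rewrite scale1r addr0; apply; exact: rat_diffy rf Oxy.
have E2 : is_derive (1 : R) 1 (fun t : R => t ^+ d * f x y) (d%:R * f x y).
  have dX := is_deriveX d (is_derive_id (1 : R) 1).
  have := is_derive_mul dX (is_derive_const (1 : R) 1 (f x y)).
  rewrite mulr0 addr0 expr1n mulr1 /GRing.scale /= mulr1.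
  congr is_derive; apply/funext => t; congr (_ * _).
  by rewrite exprfctE.
rewrite -(derive_val (is_derive := E1)) -(derive_val (is_derive := E2)).
apply: near_eq_derive; near=> t.
by rewrite addr0 fh//; near: t; exact: lt_nbhsr.
Unshelve. all: by end_near. Qed.

(** Adding a multiple of the radial field [y] to a spray changes its curvature
    by a multiple of the identity, up to a multiple of [y] and to a term that
    vanishes when the first spray is homogeneous. *)
Lemma projective_change b G P v x y :
  (forall i, ratfun b (fun x y => G x y 0 i)) -> ratfun b P -> Omega x y ->
  (forall i, diry y (fun x y => G x y 0 i) x y = 2 * G x y 0 i) ->
  diry y P x y = P x y ->
  exists c, forall i,
    spray_curvature (fun x y => G x y + P x y *: y) v i x y =
    spray_curvature G v i x y
    + (P x y ^+ 2 - dirx y P x y + 2 * diry (G x y) P x y) * v 0 i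
    + 2 * P x y * (diry y (diry v (fun x y => G x y 0 i)) x y
                   - diry v (fun x y => G x y 0 i) x y)
    + c * y 0 i.
Proof.
move=> rG rP Oxy GE PE.
have ry j : ratfun b (fun _ y => y 0 j) by exact: rat_coord.
pose A := \row_j diry v (fun x y => G x y 0 j) x y.
pose Z := A + (diry v P x y *: y + P x y *: v).
exists (2 * dirx v P x y - dirx y (diry v P) x y
  + 2 * diry (G x y + P x y *: y) (diry v P) x y + 2 * diry v P x y * P x y
  - diry Z P x y - P x y * diry v P x y) => i.
pose g := fun x y => G x y 0 i.
have rg : ratfun b g by exact: rG.
have rPy j : ratfun b (fun x y => P x y * y 0 j) by exact: rat_mul.
have rgv := rat_diry sO rD v rg; have rPv := rat_diry sO rD v rP.
have Ei j : (fun x y => (G x y + P x y *: y) 0 j) =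
    (fun x y => G x y 0 j + P x y * y 0 j).
  by apply/funext => z; apply/funext => w; rewrite !rowE.
have Ev j z w : Omega z w -> diry v (fun x y => (G x y + P x y *: y) 0 j) z w =
    diry v (fun x y => G x y 0 j) z w + (diry v P z w * w 0 j + P z w * v 0 j).
  move=> Ozw; rewrite Ei (diryD sO rD v (rG j) (rPy j))//.
  by rewrite (diryM sO rD v rP (ry j))// diry_coord.
have rE : ratfun b (fun z w => diry v P z w * w 0 i + P z w * v 0 i).
  by apply: rat_add; [exact: rat_mul|apply: rat_mul => //; exact: rat_cst].
have Exy : dirx y (diry v (fun x y => (G x y + P x y *: y) 0 i)) x y =
    dirx y (diry v g) x y + (dirx y (diry v P) x y * y 0 i + dirx y P x y * v 0 i).
  rewrite (dirx_eq sO y (Ev i))// (dirxD sO rD y rgv rE)//.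
  rewrite (dirxD sO rD (b := b)) //; last 2 first.
  - exact: rat_mul.
  - by apply: rat_mul => //; exact: rat_cst.
  rewrite (dirxM sO rD y rPv (ry i))// (dirxM sO rD y rP (rat_cst _ _ _ _ (v 0 i)))//.
  have dx0 (k : R) : dirx y (fun _ _ => k) x y = 0 by exact: derive_cst.
  have dx1 : dirx y (fun _ w => w 0 i) x y = 0 by exact: derive_cst.
  by rewrite dx0 dx1 !mulr0 !addr0.
have Eyy X : diry X (diry v (fun x y => (G x y + P x y *: y) 0 i)) x y =
    diry X (diry v g) x y + (diry X (diry v P) x y * y 0 i
      + diry v P x y * X 0 i + diry X P x y * v 0 i).
  rewrite (diry_eq sO X (Ev i))// (diryD sO rD X rgv rE)//.
  rewrite (diryD sO rD (b := b)) //; last 2 first.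
  - exact: rat_mul.
  - by apply: rat_mul => //; exact: rat_cst.
  rewrite (diryM sO rD X rPv (ry i))// (diryM sO rD X rP (rat_cst _ _ _ _ (v 0 i)))//.
  have dy0 (k : R) : diry X (fun _ _ => k) x y = 0 by exact: derive_cst.
  by rewrite dy0 diry_coord !mulr0 !addr0.
rewrite /spray_curvature.
have -> : \row_j diry v (fun x y => (G x y + P x y *: y) 0 j) x y = Z.
  by apply/rowP => j; rewrite mxE Ev// /Z /A !rowE [in RHS]mxE.
rewrite Exy Eyy.
rewrite Ei.
rewrite (dirxD sO rD v rg (rPy i))// (dirxM sO rD v rP (ry i))//.
have -> : dirx v (fun _ w => w 0 i) x y = 0 by exact: derive_cst.
rewrite (diryD sO rD Z rg (rPy i))// (diryM sO rD Z rP (ry i))// diry_coord.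
have lin f w : ratfun b f ->
    diry (G x y + P x y *: w) f x y = diry (G x y) f x y + P x y * diry w f x y.
  by move=> rf; rewrite (diryDv _ _ rf)// (diryZv _ _ rf).
rewrite !lin// PE.
have -> : diry Z g x y = diry A g x y + (diry v P x y * (2 * g x y) + P x y * diry v g x y).
  by rewrite /Z !(diryDv _ _ rg)// !(diryZv _ _ rg)// GE.
rewrite /Z !rowE [A 0 i]mxE -/g -/A -/(g x y).
by abstract_dir; move: (P x y) (g x y) (v 0 i) (y 0 i) => *; ring.
Qed.

End SprayChange.

(** * The domain of the metric and its rational functions *)


Section KropinaMetric.
Variables (R : realType) (n : nat) (U : set 'rV[R]_n).
Local Notation V := 'rV[R]_n.
Variables (h : V -> 'M[R]_n) (W : V -> V).
Hypothesis gW : local_unit_field U h W.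
Let gh := unit_field_metric gW.
Let openU : open U := local_metric_open gh.
Implicit Types (x y a b c u v w : V).

Local Notation "<[ a , b ]_ x" := (inner h x a b)
  (at level 0, x at level 2, format "<[ a ,  b ]_ x").
Local Notation chr := (chr h).
Local Notation cov := (cov h W).

Definition slit x y : Prop := U x /\ 0 < <[W x, y]_x.

Lemma slit_neq0 x y : slit x y -> <[W x, y]_x != 0.
Proof. by move=> [_ /lt0r_neq0]. Qed.

Lemma slit_normsq_gt0 x y : slit x y -> 0 < <[y, y]_x.
Proof.
move=> [Ux Wy]; apply: (local_metric_pos gh Ux); apply/eqP => y0.
by move: Wy; rewrite y0 inner0r ltxx.
Qed.

Lemma is_derive_inner_y x y v a : is_derive y v (fun y => <[a, y]_x) <[a, v]_x.
Proof.
have hB i j := is_derive_const y v (h x i j).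
have hX i := is_derive_row_cst a y v i.
have hY i : is_derive y v (fun y => y 0 i) (v 0 i).
  apply: is_derive_cast (differentiable_is_derive v (differentiable_coord _ _ _)) _.
  exact: (diry_coord v i 0 y).
apply: is_derive_cast (is_derive_bform hB hX hY) _.
have -> : bform (fun _ _ => 0) a y = 0.
  by apply: big1 => i _; apply: big1 => j _; rewrite !mul0r.
rewrite add0r; have := inner0l h x y; rewrite /inner /bform => ->.
by rewrite add0r.
Qed.

Lemma is_derive_normsq_y x y v : U x ->
  is_derive y v (fun y => <[y, y]_x) (2 * <[y, v]_x).
Proof.
move=> Ux.
have hB i j := is_derive_const y v (h x i j).
have hY i : is_derive y v (fun y => y 0 i) (v 0 i).
  apply: is_derive_cast (differentiable_is_derive v (differentiable_coord _ _ _)) _.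
  exact: (diry_coord v i 0 y).
apply: is_derive_cast (is_derive_bform hB hY hY) _.
have -> : bform (fun _ _ => 0) y y = 0.
  by apply: big1 => i _; apply: big1 => j _; rewrite !mul0r.
rewrite add0r -[bform _ v y]/(<[v, y]_x) -[bform _ y v]/(<[y, v]_x).
by rewrite (innerC gh v y Ux) mulr_natl mulr2n.
Qed.

Lemma near_gt0 (f : V -> R) z : differentiable f z -> 0 < f z ->
  \forall w \near z, 0 < f w.
Proof.
move=> df fz; have /differentiable_continuous cf := df.
exact: (@cvgr_gt R V (nbhs z) _ f (f z) cf 0 fz).
Qed.

Lemma slit_slit_domain (D : V -> V -> R) :
  (forall x y, slit x y -> D x y != 0) -> slit_domain U D slit.
Proof.
move=> D0; split=> //.
- by move=> x y [].
- move=> x y [Ux Wy].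
  have dW : differentiable (fun z => <[W z, y]_z) x.
    pose s := smooth_on_differentiable.
    apply: (s _ _ U) Ux; apply: smooth_on_bigsum => // i.
    apply: smooth_on_bigsum => // j; apply: smooth_on_mul => //; last exact: smooth_on_cst.
    by apply: smooth_on_mul => //; [exact: (local_metric_smooth gh)|exact: (unit_field_smooth gW)].
  exact: filterI (near_open openU Ux) (near_gt0 dW Wy).
- move=> x y [Ux Wy].
  have dy : differentiable (fun z => <[W x, z]_x) y.
    apply: differentiable_bigsum => i; apply: differentiable_bigsum => j.
    apply: differentiableM; last exact: differentiable_coord.
    exact: differentiable_cst.
  by apply: filterS (near_gt0 dy Wy) => z; split.
Qed.

End KropinaMetric.

Section RationalTensors.
Variables (R : realType) (n : nat) (U : set 'rV[R]_n).
Local Notation V := 'rV[R]_n.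
Variables (h : V -> 'M[R]_n) (W : V -> V).
Hypothesis gW : local_unit_field U h W.
Let gh := unit_field_metric gW.
Let openU : open U := local_metric_open gh.
Variables (D : V -> V -> R).
Local Notation slit := (slit U h W).
Local Notation ratfun := (ratfun U D slit).
Implicit Types (x y : V) (X Y : V -> V -> V) (b : bool).

Lemma rat_bform b (B : 'I_n -> 'I_n -> V -> R) X Y :
  (forall i j, smooth_on U (B i j)) ->
  (forall i, ratfun b (fun x y => X x y 0 i)) ->
  (forall i, ratfun b (fun x y => Y x y 0 i)) ->
  ratfun b (fun x y => bform (fun i j => B i j x) (X x y) (Y x y)).
Proof.
move=> sB rX rY; apply: rat_sum => i; apply: rat_sum => j.
by apply: rat_mul => //; apply: rat_mul => //; exact: rat_coef.
Qed.

Lemma rat_inner b X Y :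
  (forall i, ratfun b (fun x y => X x y 0 i)) ->
  (forall i, ratfun b (fun x y => Y x y 0 i)) ->
  ratfun b (fun x y => inner h x (X x y) (Y x y)).
Proof.
move=> rX rY; apply: (rat_bform (B := fun i j x => h x i j)) => // i j.
exact: (local_metric_smooth gh).
Qed.

Lemma rat_chr b X Y i :
  (forall i, ratfun b (fun x y => X x y 0 i)) ->
  (forall i, ratfun b (fun x y => Y x y 0 i)) ->
  ratfun b (fun x y => chr h x (X x y) (Y x y) 0 i).
Proof.
move=> rX rY.
apply: rat_eq (rat_bform (B := fun j k => christoffel h i j k) _ rX rY) _ => [j k|x y _].
  exact: (smooth_christoffel gh).
by rewrite chrE.
Qed.

Lemma rat_field b i : ratfun b (fun x _ => W x 0 i).
Proof. exact: (rat_coef _ _ _ (unit_field_smooth gW i)). Qed.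

Lemma rat_y b i : ratfun b (fun _ y => y 0 i).
Proof. exact: rat_coord. Qed.

Lemma rat_rowD b X Y i :
  (forall i, ratfun b (fun x y => X x y 0 i)) ->
  (forall i, ratfun b (fun x y => Y x y 0 i)) ->
  ratfun b (fun x y => (X x y + Y x y) 0 i).
Proof.
by move=> rX rY; apply: rat_eq (rat_add (rX i) (rY i)) _ => x y _; rewrite rowE.
Qed.

Lemma rat_rowZ b f X i : ratfun b f ->
  (forall i, ratfun b (fun x y => X x y 0 i)) ->
  ratfun b (fun x y => (f x y *: X x y) 0 i).
Proof.
by move=> rf rX; apply: rat_eq (rat_mul rf (rX i)) _ => x y _; rewrite rowE.
Qed.

Lemma rat_cov b X i :
  (forall i, ratfun b (fun x y => X x y 0 i)) ->
  ratfun b (fun x y => cov h W x (X x y) 0 i).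
Proof.
move=> rX; pose f x y := \sum_k X x y 0 k * partial k (fun z => W z 0 i) x
   + chr h x (X x y) (W x) 0 i.
apply: (@rat_eq _ _ _ _ _ _ f).
  apply: rat_add; last by apply: rat_chr => // j; exact: rat_field.
  apply: rat_sum => k; apply: rat_mul => //; apply: rat_coef.
  exact/smooth_on_partial/(unit_field_smooth gW).
move=> x y [Ux _]; rewrite covE rowE dfieldE derive_sum_partial//.
exact: smooth_on_differentiable (unit_field_smooth gW i) Ux.
Qed.

Lemma rat_sharp b (l : 'I_n -> V -> V -> R) i : (forall j, ratfun b (l j)) ->
  ratfun b (fun x y => sharp h x (fun j => l j x y) 0 i).
Proof.
move=> rl; apply: rat_eq (rat_sum _ (fun j => rat_mul (rat_coef D slit b
  (smooth_on_invmx openU (fun x => unit_h gh (x := x)) (local_metric_smooth gh) i j)) (rl j))) _.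
by move=> x y _; rewrite mxE.
Qed.

End RationalTensors.

(** * The spray of the Kropina metric *)

Section KropinaSpray.
Variables (R : realType) (n : nat) (U : set 'rV[R]_n).
Local Notation V := 'rV[R]_n.
Variables (h : V -> 'M[R]_n) (W : V -> V).
Hypothesis gW : local_unit_field U h W.
Let gh := unit_field_metric gW.
Let openU : open U := local_metric_open gh.
Implicit Types (x y a b c u v w : V).

Local Notation "<[ a , b ]_ x" := (inner h x a b)
  (at level 0, x at level 2, format "<[ a ,  b ]_ x").
Local Notation chr := (chr h).
Local Notation cov := (cov h W).
Local Notation slit := (slit U h W).

(** The metric [F] in terms of its navigation data.  The four functions after
    it are its derivatives, a letter [x] or [y] in the name standing for the
    variable; derivatives in [x] are expressed by the connection of [h] and the
    covariant derivative of [W]. *)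
Definition nav x y : R := <[y, y]_x / (2 * <[W x, y]_x).
Definition nav_y x y v : R :=
  (<[y, v]_x - nav x y * <[W x, v]_x) / <[W x, y]_x.
Definition nav_yy x y a b : R :=
  (<[a, b]_x - nav_y x y a * <[W x, b]_x - nav_y x y b * <[W x, a]_x)
  / <[W x, y]_x.
Definition nav_x x y v : R :=
  nav_y x y (chr x v y) - nav x y * <[y, cov x v]_x / <[W x, y]_x.
Definition nav_yx x y w v : R :=
  (<[chr x w y, v]_x + <[y, chr x w v]_x - nav_x x y w * <[W x, v]_x
   - nav x y * (<[cov x w, v]_x + <[W x, chr x w v]_x)
   - nav_y x y v * (<[cov x w, y]_x + <[W x, chr x w y]_x)) / <[W x, y]_x.

Lemma normsq_nav x y : slit x y -> <[y, y]_x = 2 * nav x y * <[W x, y]_x.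
Proof.
by move=> /slit_neq0; rewrite /nav; abstract_inner => w0; field.
Qed.

Lemma nav_gt0 x y : slit x y -> 0 < nav x y.
Proof.
move=> Oxy; apply: divr_gt0; first exact: slit_normsq_gt0 Oxy.
by apply: mulr_gt0 => //; case: Oxy.
Qed.

Lemma is_derive_nav_y x y v : slit x y ->
  is_derive y v (nav x) (nav_y x y v).
Proof.
move=> Oxy; have [Ux _] := Oxy; have w0 := slit_neq0 Oxy.
have D2 := is_derive_scale 2 (is_derive_inner_y h x y v (W x)).
have w20 : 2 * <[W x, y]_x != 0 by rewrite mulf_neq0// pnatr_eq0.
have D := is_derive_mul (is_derive_normsq_y gW y v Ux)
  (is_derive_inv (f := fun y => 2 * <[W x, y]_x) w20 D2).
apply: is_derive_cast D _; rewrite /nav_y /nav.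
by move: w0 {w20 D2}; abstract_inner => *; field.
Qed.

Lemma is_derive_nav_x x y v : slit x y ->
  is_derive x v (fun z => nav z y) (nav_x x y v).
Proof.
move=> Oxy; have [Ux _] := Oxy; have w0 := slit_neq0 Oxy.
have D2 := is_derive_scale 2 (is_derive_dual gW v y Ux).
have w20 : 2 * <[W x, y]_x != 0 by rewrite mulf_neq0// pnatr_eq0.
have D := is_derive_mul (is_derive_inner_cst gh v y y Ux)
  (is_derive_inv (f := fun z => 2 * <[W z, y]_z) w20 D2).
apply: is_derive_cast D _; rewrite /nav_x /nav_y /nav (metric_compat gh)//.
rewrite (innerC gh (chr x v y))// (innerC gh y (cov x v))//.
by move: w0 {w20 D2}; abstract_inner => *; field.
Qed.

Lemma is_derive_nav_yy x y a b : slit x y ->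
  is_derive y a (fun y => nav_y x y b) (nav_yy x y a b).
Proof.
move=> Oxy; have [Ux _] := Oxy; have w0 := slit_neq0 Oxy.
have N : is_derive y a (fun y => <[y, b]_x) <[a, b]_x.
  have -> : (fun y => <[y, b]_x) = (fun y => <[b, y]_x).
    by apply/funext => z; rewrite (innerC gh).
  by rewrite (innerC gh a b Ux); exact: is_derive_inner_y.
have c0 := is_derive_const y a <[W x, b]_x.
have D := is_derive_mul
  (is_derive_add N (is_derive_opp (is_derive_mul (is_derive_nav_y a Oxy) c0)))
  (is_derive_inv (f := fun y => <[W x, y]_x) w0 (is_derive_inner_y h x y a (W x))).
apply: is_derive_cast D _; rewrite /nav_yy.
move: (nav_y x y a) => q; rewrite /nav_y; move: (nav x y) => F.
by move: w0; abstract_inner => *; field.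
Qed.

Lemma is_derive_nav_yx x y w v : slit x y ->
  is_derive x w (fun z => nav_y z y v) (nav_yx x y w v).
Proof.
move=> Oxy; have [Ux _] := Oxy; have w0 := slit_neq0 Oxy.
have D := is_derive_mul
  (is_derive_add (is_derive_inner_cst gh w y v Ux)
     (is_derive_opp (is_derive_mul (is_derive_nav_x w Oxy) (is_derive_dual gW w v Ux))))
  (is_derive_inv (f := fun z => <[W z, y]_z) w0 (is_derive_dual gW w y Ux)).
apply: is_derive_cast D _; rewrite /nav_yx (metric_compat gh)//.
move: (nav_x x y w) => q; rewrite /nav_y; move: (nav x y) => F.
by move: w0; abstract_inner => *; field.
Qed.

(** The skew part of the endomorphism [cov], whose adjoint is written with
    [sharp]. *)
Fact skew_sig : {f : V -> V -> V | forall x y, f x y =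
  2^-1 *: (cov x y - sharp h x (fun j => <[y, cov x (delta_mx 0 j)]_x))}.
Proof. by eexists. Qed.
Definition skew := sval skew_sig.
Lemma skewE x y : skew x y =
  2^-1 *: (cov x y - sharp h x (fun j => <[y, cov x (delta_mx 0 j)]_x)).
Proof. exact: (svalP skew_sig). Qed.

Lemma inner_skew x y b : U x ->
  <[skew x y, b]_x = 2^-1 * (<[cov x y, b]_x - <[y, cov x b]_x).
Proof.
move=> Ux; rewrite skewE innerZl innerDl innerNl (inner_sharp gh)//.
congr (_ * (_ - _)).
rewrite [RHS](linear_expand (f := fun b => <[y, cov x b]_x)) => [|k u v]; last first.
  by rewrite (covP gW)// innerDr innerZr.
by apply: eq_bigr => j _; rewrite mulrC.
Qed.

Definition shear x y : R := <[cov x y, y]_x.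
Definition skew_field x y : R := <[W x, skew x y]_x.

(** [spray_pole] collects what is singular where [<y, y> = 0], a condition on
    complex [y]; the rest of the spray has powers of [<W, y>] as its only
    denominators. *)
Definition spray_reg x y : V :=
  2^-1 *: chr x y y - nav x y *: skew x y
  + (nav x y * skew_field x y + 2^-1 * shear x y) *: W x
  - skew_field x y *: y.
Definition spray_pole x y : R := - (shear x y * <[W x, y]_x / <[y, y]_x).
Definition nav_spray x y : V := spray_reg x y + spray_pole x y *: y.

Lemma nav_y_linear x y k u v :
  nav_y x y (k *: u + v) = k * nav_y x y u + nav_y x y v.
Proof.
rewrite /nav_y !innerDr !innerZr; move: (nav _ _).
by abstract_inner => *; ring.
Qed.

Lemma nav_yy_linear x y a k u v :
  nav_yy x y a (k *: u + v) = k * nav_yy x y a u + nav_yy x y a v.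
Proof.
rewrite /nav_yy nav_y_linear !innerDr !innerZr; move: (nav_y x y u) (nav_y x y v) (nav_y x y a).
by abstract_inner => *; ring.
Qed.

(** The Euler-Lagrange equation of [F ^+ 2] paired with [v].  Once [<y, y>] is
    replaced by [2 F <W, y>] it is an identity between rational functions of
    inner products. *)
Lemma nav_spray_euler_lagrange x y v : slit x y ->
  4 * (nav_y x y v * nav_y x y (nav_spray x y)
       + nav x y * nav_yy x y v (nav_spray x y)) =
  2 * (nav_x x y y * nav_y x y v + nav x y * nav_yx x y y v)
  - 2 * nav x y * nav_x x y v.
Proof.
move=> Oxy; have [Ux _] := Oxy; have w0 := slit_neq0 Oxy.
have HF := normsq_nav Oxy; have F0 := lt0r_neq0 (nav_gt0 Oxy).
have WG : <[W x, nav_spray x y]_x = 2^-1 * <[W x, chr x y y]_x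
    + 2^-1 * shear x y - skew_field x y * <[W x, y]_x
    + spray_pole x y * <[W x, y]_x.
  rewrite /nav_spray /spray_reg !(innerDr, innerNr, innerZr) (unit_field_norm gW Ux).
  rewrite -/(skew_field x y); move: (nav x y) (skew_field x y) (shear x y) (spray_pole x y).
  by abstract_inner => *; ring.
have aG a : <[a, nav_spray x y]_x = 2^-1 * <[a, chr x y y]_x
    - nav x y * <[skew x y, a]_x
    + (nav x y * skew_field x y + 2^-1 * shear x y) * <[W x, a]_x
    - skew_field x y * <[y, a]_x + spray_pole x y * <[y, a]_x.
  rewrite /nav_spray /spray_reg !(innerDr, innerNr, innerZr).
  by rewrite (innerC gh (skew x y))// (innerC gh (W x) a)// (innerC gh y a).
have Fy a : nav_y x y a = (<[y, a]_x - nav x y * <[W x, a]_x) / <[W x, y]_x by [].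
rewrite /nav_yy /nav_yx /nav_x !Fy WG !aG.
rewrite !(inner_skew _ _ Ux) HF /spray_pole HF.
rewrite -/(shear x y) (innerC gh y (cov x y))// -/(shear x y).
rewrite (innerC gh y (cov x v))//.
rewrite (innerC gh (chr x y y) v)// (chrC gh v y)//.
rewrite (innerC gh v (chr x y y))//.
move: (nav x y) (shear x y) (skew_field x y) w0 F0 => {HF WG aG Fy}.
by abstract_inner => F r s w0 F0; field; rewrite ?F0 ?w0.
Qed.

Definition nav_tensor x y a b : R :=
  nav_y x y a * nav_y x y b + nav x y * nav_yy x y a b.

Lemma nav_yyC x y a b : slit x y -> nav_yy x y a b = nav_yy x y b a.
Proof.
move=> [Ux _]; rewrite /nav_yy (innerC gh a b)//; congr (_ / _).
exact: addrAC.
Qed.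

(** With [u] the [nav_y]-horizontal part of [a], the value on [(a, a)] is
    [(nav_y a)^2] plus a positive multiple of [<u, u>]. *)
Lemma nav_tensor_definite x y a : slit x y -> nav_tensor x y a a = 0 -> a = 0.
Proof.
move=> Oxy a0; have [Ux Wy] := Oxy; have w0 := slit_neq0 Oxy.
have F0 := nav_gt0 Oxy; have HF := normsq_nav Oxy.
pose u := a - (nav_y x y a / nav x y) *: y.
have E : nav_tensor x y a a =
    nav_y x y a ^+ 2 + nav x y / <[W x, y]_x * <[u, u]_x.
  rewrite /u !(innerDl, innerDr, innerNl, innerNr, innerZl, innerZr) HF.
  rewrite (innerC gh a y)// /nav_tensor /nav_yy /nav_y.
  move: (nav x y) w0 (lt0r_neq0 F0) => {HF}.
  by abstract_inner => F w0 F1; field; rewrite ?F1 ?w0.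
have uu0 : 0 <= <[u, u]_x.
  by have [->|u0] := eqVneq u 0; [rewrite inner0l|exact/ltW/(local_metric_pos gh)].
have c0 : 0 < nav x y / <[W x, y]_x by rewrite divr_gt0.
move: a0; rewrite E => /eqP; rewrite paddr_eq0 ?sqr_ge0//; last by rewrite mulr_ge0// ltW.
rewrite sqrf_eq0 => /andP[/eqP aF]; rewrite mulf_eq0 (gt_eqF c0) /=.
move=> /eqP/(inner_eq0 gh Ux) u0.
by move: u0; rewrite /u aF mul0r scale0r subr0.
Qed.

Lemma nav_x_linear x y k v w : U x ->
  nav_x x y (k *: v + w) = k * nav_x x y v + nav_x x y w.
Proof.
move=> Ux; rewrite /nav_x (chrPl h) nav_y_linear (covP gW)// innerDr innerZr.
move: (nav_y x y _) (nav_y x y _) (nav x y).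
by abstract_inner => *; ring.
Qed.

Lemma nav_yx_linear x y k v w a : U x ->
  nav_yx x y (k *: v + w) a = k * nav_yx x y v a + nav_yx x y w a.
Proof.
move=> Ux; rewrite /nav_yx nav_x_linear// !(chrPl h) (covP gW)//.
rewrite !(innerDr, innerZr, innerDl, innerZl).
move: (nav_y x y _) (nav_x x y v) (nav_x x y w) (nav x y).
by abstract_inner => *; ring.
Qed.

Lemma nav_tensor_linear x y a k u v :
  nav_tensor x y a (k *: u + v) = k * nav_tensor x y a u + nav_tensor x y a v.
Proof.
rewrite /nav_tensor nav_y_linear nav_yy_linear; ring.
Qed.

Variable F : V -> V -> R.
Hypothesis navF : forall x y, slit x y -> F x y = nav x y.

Let sO : slit_domain U (fun x y => <[W x, y]_x) slit.
Proof. by apply: (slit_slit_domain gW) => x y; exact: slit_neq0. Qed.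

Lemma diry_nav x y v : slit x y -> diry v F x y = nav_y x y v.
Proof.
move=> Oxy; rewrite (diry_eq sO v navF)//.
exact: (derive_val (is_derive := is_derive_nav_y v Oxy)).
Qed.

Let F2 x y := F x y ^+ 2.

Let diry_F2 x y v : slit x y -> diry v F2 x y = 2 * (nav x y * nav_y x y v).
Proof.
move=> Oxy; rewrite (diry_eq (g := fun x y => nav x y * nav x y) sO v)//; last first.
  by move=> z w Ozw; rewrite /F2 navF// expr2.
have N := is_derive_nav_y v Oxy.
rewrite [LHS](derive_val (is_derive := is_derive_mul N N)); ring.
Qed.

Let dirx_F2 x y v : slit x y -> dirx v F2 x y = 2 * (nav x y * nav_x x y v).
Proof.
move=> Oxy; rewrite (dirx_eq (g := fun x y => nav x y * nav x y) sO v)//; last first.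
  by move=> z w Ozw; rewrite /F2 navF// expr2.
have N := is_derive_nav_x v Oxy.
rewrite [LHS](derive_val (is_derive := is_derive_mul N N)); ring.
Qed.

Let dirxy_F2 x y w v : slit x y -> dirx w (diry v F2) x y =
  2 * (nav_x x y w * nav_y x y v + nav x y * nav_yx x y w v).
Proof.
move=> Oxy; rewrite (dirx_eq (g := fun x y => 2 * (nav x y * nav_y x y v)) sO w)//; last first.
  by move=> *; exact: diry_F2.
exact: (derive_val (is_derive := is_derive_scale 2
  (is_derive_mul (is_derive_nav_x w Oxy) (is_derive_nav_yx w v Oxy)))).
Qed.

Let diryy_F2 x y w v : slit x y -> diry w (diry v F2) x y = 2 * nav_tensor x y w v.
Proof.
move=> Oxy; rewrite (diry_eq (g := fun x y => 2 * (nav x y * nav_y x y v)) sO w)//; last first.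
  by move=> *; exact: diry_F2.
exact: (derive_val (is_derive := is_derive_scale 2
  (is_derive_mul (is_derive_nav_y w Oxy) (is_derive_nav_yy w v Oxy)))).
Qed.

(** The fundamental tensor is invertible, so the Euler-Lagrange equation
    determines the spray. *)
Lemma spray_nav x y i : slit x y -> spray F i x y = nav_spray x y 0 i.
Proof.
move=> Oxy; have [Ux _] := Oxy.
pose e := fun i : 'I_n => delta_mx 0 i : V.
have gE : fundamental_tensor F x y = \matrix_(i, j) nav_tensor x y (e i) (e j).
  apply/matrixP => j k; rewrite !mxE [dy _ _ _ _]diryy_F2//.
  by rewrite mulrA mulVf ?mul1r// pnatr_eq0.
have EE l : \sum_k dx k (dy l F2) x y * y 0 k - dx l F2 x y =
    4 * nav_tensor x y (e l) (nav_spray x y).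
  rewrite [RHS]nav_spray_euler_lagrange// [dx l F2 x y]dirx_F2// -mulrA; congr (_ - _).
  rewrite [RHS](linear_expand (f := fun w => 2 * (nav_x x y w * nav_y x y (e l)
    + nav x y * nav_yx x y w (e l)))) => [|k u v]; last first.
    rewrite nav_x_linear// nav_yx_linear//; ring.
  by apply: eq_bigr => k _; rewrite [dx _ _ _ _]dirxy_F2// mulrC.
have tC a b : nav_tensor x y a b = nav_tensor x y b a.
  by rewrite /nav_tensor nav_yyC// [nav_y x y a * _]mulrC.
have ug : fundamental_tensor F x y \in unitmx.
  rewrite -row_free_unit -kermx_eq0; apply/eqP/row_matrixP => j; rewrite row0.
  set r := row j _.
  have r0 : r *m fundamental_tensor F x y = 0.
    by rewrite -row_mul mulmx_ker row0.
  apply: (nav_tensor_definite Oxy).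
  rewrite (linear_expand (f := nav_tensor x y r)) => [|k u v]; last exact: nav_tensor_linear.
  apply: big1 => k _; have := congr1 (fun M : 'rV_n => M 0 k) r0.
  rewrite gE [LHS]mxE [RHS]mxE => rk.
  rewrite [nav_tensor _ _ _ _](_ : _ = 0) ?mulr0// tC.
  rewrite (linear_expand (f := nav_tensor x y (e k))) => [|t u v]; last exact: nav_tensor_linear.
  rewrite -[RHS]rk; apply: eq_bigr => m _; congr (_ * _).
  by rewrite mxE tC.
rewrite /spray.
have -> : nav_spray x y 0 i = (nav_spray x y)^T i 0 by rewrite [RHS]mxE.
rewrite -[(nav_spray x y)^T](mulKmx ug) [RHS]mxE mulr_sumr; apply: eq_bigr => l _.
rewrite -/F2 EE mulrCA; congr (_ * _).
rewrite mulrA mulVf ?pnatr_eq0// mul1r [RHS]mxE.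
rewrite (linear_expand (f := nav_tensor x y (e l))) => [|k u v]; last exact: nav_tensor_linear.
by apply: eq_bigr => k _; rewrite gE [X in _ = X * _]mxE [X in _ = _ * X]mxE mulrC.
Qed.

End KropinaSpray.

(** * Curvature in the Killing case *)

Ltac abstract_entries :=
  repeat match goal with |- context [@fun_of_matrix ?T ?m ?k ?M ?i ?j] =>
    let t := fresh "t" in generalize (@fun_of_matrix T m k M i j); intro t end.

Section KillingCurvature.
Variables (R : realType) (n : nat) (U : set 'rV[R]_n).
Local Notation V := 'rV[R]_n.
Variables (h : V -> 'M[R]_n) (W : V -> V).
Hypothesis gW : local_unit_field U h W.
Let gh := unit_field_metric gW.
Let openU : open U := local_metric_open gh.
Implicit Types (x y a b c u v w : V).

Local Notation "<[ a , b ]_ x" := (inner h x a b)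
  (at level 0, x at level 2, format "<[ a ,  b ]_ x").
Local Notation chr := (chr h).
Local Notation dchr := (dchr h).
Local Notation curv := (curv h).
Local Notation cov := (cov h W).
Local Notation slit := (slit U h W).
Local Notation nav := (nav h W).
Local Notation nav_x := (nav_x h W).
Local Notation nav_y := (nav_y h W).
Local Notation nav_yx := (nav_yx h W).
Local Notation nav_yy := (nav_yy h W).

Lemma is_derive_linear (f : V -> R) y v :
  (forall k u w, f (k *: u + w) = k * f u + f w) -> is_derive y v f (f v).
Proof.
move=> fl; rewrite (linear_expand v fl).
have E : f = (fun z => \sum_i z 0 i * f (delta_mx 0 i)).
  by apply/funext => z; exact: linear_expand.
rewrite {1}E {E}.
apply: is_derive_bigsum => i.
have Di : is_derive y v (fun z => z 0 i) (v 0 i).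
  apply: is_derive_cast (differentiable_is_derive v (differentiable_coord _ _ _)) _.
  exact: (diry_coord v i 0 y).
apply: is_derive_cast (is_derive_mul Di (is_derive_const y v _)) _.
by rewrite mulr0 addr0.
Qed.

Lemma is_derive_chr_y x y v i : is_derive y v (fun y => chr x y y 0 i)
  ((chr x v y + chr x y v) 0 i).
Proof.
have hY j : is_derive y v (fun y => y 0 j) (v 0 j).
  by apply: is_derive_linear => k u w; rewrite !rowE.
have hB j k := is_derive_const y v (christoffel h i j k x).
have -> : (fun y => chr x y y 0 i) =
    (fun y => bform (fun j k => christoffel h i j k x) y y).
  by apply/funext => z; rewrite chrE.
apply: is_derive_cast (is_derive_bform hB hY hY) _.
have -> : bform (fun _ _ => 0) y y = 0.
  by apply: big1 => j _; apply: big1 => k _; rewrite !mul0r.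
by rewrite rowE !chrE add0r.
Qed.

Hypothesis killingW : forall x, U x ->
  forall a b, <[cov x a, b]_x + <[a, cov x b]_x = 0.

Lemma skew_killing x y : U x -> skew h W x y = cov x y.
Proof.
move=> Ux; apply: (inner_nondeg gh Ux) => b.
rewrite (inner_skew gW)// -[in X in _ - X](opprK <[y, cov x b]_x).
rewrite -(cov_skew killingW)//.
by abstract_inner => *; field.
Qed.

Lemma shear_killing x y : U x -> <[cov x y, y]_x = 0.
Proof.
move=> Ux; have := killingW Ux y y; rewrite (innerC gh y)//.
by abstract_inner => *; lra.
Qed.

Definition killing_spray x y : V := 2^-1 *: chr x y y - nav x y *: cov x y.

Lemma nav_spray_killing x y : U x -> nav_spray h W x y = killing_spray x y.
Proof.
move=> Ux; rewrite /nav_spray /spray_reg /spray_pole /skew_field /shear.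
rewrite skew_killing// shear_killing// (inner_field_cov gW)//.
by rewrite !(mulr0, mul0r, oppr0, scale0r, addr0, subr0).
Qed.

(** The coordinate derivative along [v] of [cov] with a constant argument. *)
Definition dcov x v a : V :=
  d2field W x v a + dchr x v a (W x) + chr x a (dfield W x v).

Lemma dcov_killing x v a : U x ->
  dcov x v a = cov x (chr x v a) - chr x v (cov x a) - curv x (W x) v a.
Proof.
move=> Ux; rewrite -(cov2_killing gW killingW)// /cov2 -/(dcov x v a).
by apply/rowP => i; rewrite !rowE; ring.
Qed.

Let Gi (i : 'I_n) x y := killing_spray x y 0 i.

Let GiE i : Gi i = fun x y => 2^-1 * chr x y y 0 i - nav x y * cov x y 0 i.
Proof.
by apply/funext => x; apply/funext => y; rewrite /Gi /killing_spray !rowE.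
Qed.

Let is_derive_cov_y x y v i : U x ->
  is_derive y v (fun y => cov x y 0 i) (cov x v 0 i).
Proof.
move=> Ux; apply: (is_derive_linear (f := fun y => cov x y 0 i)) => k u w.
by rewrite (covP gW)// !rowE.
Qed.

Let sO : slit_domain U (fun x y => <[W x, y]_x) slit.
Proof. by apply: (slit_slit_domain gW) => x y; exact: slit_neq0. Qed.

Definition killing_spray_y x y v : V :=
  chr x y v - nav_y x y v *: cov x y - nav x y *: cov x v.

Let diryG x y v i : slit x y ->
  diry v (Gi i) x y = killing_spray_y x y v 0 i.
Proof.
move=> Oxy; have [Ux _] := Oxy; rewrite GiE.
have D := is_derive_add (is_derive_scale 2^-1 (is_derive_chr_y x y v i))
  (is_derive_opp (is_derive_mul (is_derive_nav_y gW v Oxy) (is_derive_cov_y y v i Ux))).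
rewrite [LHS](derive_val (is_derive := D)) /killing_spray_y (chrC gh v y)// !rowE.
by field.
Qed.

Let dirxG x y v i : slit x y -> dirx v (Gi i) x y =
  (2^-1 *: dchr x v y y - nav_x x y v *: cov x y - nav x y *: dcov x v y) 0 i.
Proof.
move=> Oxy; have [Ux _] := Oxy; rewrite GiE.
have Dc := is_derive_chr gh i Ux (is_derive_row_cst y x v) (is_derive_row_cst y x v).
have D := is_derive_add (is_derive_scale 2^-1 Dc)
  (is_derive_opp (is_derive_mul (is_derive_nav_x gW v Oxy) (is_derive_cov gW v y i Ux))).
rewrite [LHS](derive_val (is_derive := D)) chr0l chr0r /dcov !rowE.
by ring.
Qed.

Let GyE v i : (fun x y => killing_spray_y x y v 0 i) = (fun x y =>
  chr x y v 0 i - nav_y x y v * cov x y 0 i - nav x y * cov x v 0 i).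
Proof.
by apply/funext => x; apply/funext => y; rewrite /killing_spray_y !rowE.
Qed.

Let dirxyG x y w v i : slit x y -> dirx w (diry v (Gi i)) x y =
  (dchr x w y v - nav_yx x y w v *: cov x y - nav_y x y v *: dcov x w y
   - nav_x x y w *: cov x v - nav x y *: dcov x w v) 0 i.
Proof.
move=> Oxy; have [Ux _] := Oxy.
rewrite (dirx_eq sO w (fun x y Oxy => diryG v i Oxy))// GyE.
have Dc := is_derive_chr gh i Ux (is_derive_row_cst y x w) (is_derive_row_cst v x w).
have D := is_derive_add (is_derive_add Dc (is_derive_opp
    (is_derive_mul (is_derive_nav_yx gW w v Oxy) (is_derive_cov gW w y i Ux))))
  (is_derive_opp (is_derive_mul (is_derive_nav_x gW w Oxy) (is_derive_cov gW w v i Ux))).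
rewrite [LHS](derive_val (is_derive := D)) chr0l chr0r /dcov !rowE.
by ring.
Qed.

Let diryyG x y w v i : slit x y -> diry w (diry v (Gi i)) x y =
  (chr x w v - nav_yy x y w v *: cov x y - nav_y x y v *: cov x w
   - nav_y x y w *: cov x v) 0 i.
Proof.
move=> Oxy; have [Ux _] := Oxy.
rewrite (diry_eq sO w (fun x y Oxy => diryG v i Oxy))// GyE.
have Dc : is_derive y w (fun y => chr x y v 0 i) (chr x w v 0 i).
  by apply: (is_derive_linear (f := fun y => chr x y v 0 i)) => k a b;
     rewrite (chrPl h) !rowE.
have D := is_derive_add (is_derive_add Dc (is_derive_opp
    (is_derive_mul (is_derive_nav_yy gW w v Oxy) (is_derive_cov_y y w i Ux))))
  (is_derive_opp (is_derive_mul (is_derive_nav_y gW w Oxy)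
     (is_derive_const y w (cov x v 0 i)))).
rewrite [LHS](derive_val (is_derive := D)) !rowE.
by ring.
Qed.

(** The flag curvature operator of the Kropina metric at [y] is the Riemannian
    one at the unit-speed direction [y - F W] of the navigation problem, applied
    to the part of [v] tangent to the indicatrix. *)
Lemma killing_spray_curvature x y v i : slit x y ->
  let u := y - nav x y *: W x in
  spray_curvature killing_spray v i x y =
  curv x (v - (nav_y x y v / nav x y) *: y) u u 0 i.
Proof.
move=> Oxy u; have [Ux _] := Oxy.
have w0 := slit_neq0 Oxy; have F0 := lt0r_neq0 (nav_gt0 gW Oxy).
have HF := normsq_nav Oxy.
rewrite /spray_curvature -/(Gi i).
have -> : \row_j diry v (fun x y => killing_spray x y 0 j) x y = killing_spray_y x y v.
  by apply/rowP => j; rewrite mxE; exact: diryG.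
rewrite dirxG// dirxyG// diryyG// diryG//.
rewrite !dcov_killing// /killing_spray_y /killing_spray.
have EC : dchr x v y y = curv x v y y + dchr x y v y - chr x v (chr x y y)
    + chr x y (chr x v y).
  by rewrite curvE; apply/rowP => j; rewrite !rowE; ring.
rewrite EC (dchrC gh y y v)// {EC}.
rewrite /u !(curvDl gh, curvDm gh, curvDr, curvNl gh, curvNm gh, curvNr,
  curvZl gh, curvZm gh, curvZr)//.
rewrite !curv_diag !(curv_anti h x (W x) y) !(curv_anti h x (W x) v).
have -> : curv x v y (W x) = curv x (W x) y v - curv x (W x) v y.
  have := bianchi gh (W x) v y Ux; rewrite (curv_anti h x (W x) y) => B.
  by apply/rowP => j; move/rowP/(_ j): B; rewrite !rowE; lra.
rewrite !(covD gW, covN gW, covZ gW)// !(cov_cov gW killingW)//.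
rewrite !(chrDl h, chrDr h, chrZl h, chrZr h).
have chrNl a b : chr x (- a) b = - chr x a b.
  by rewrite -[- a]scaleN1r chrZl scaleN1r.
have chrNr a b : chr x b (- a) = - chr x b a.
  by rewrite -[- a]scaleN1r chrZr scaleN1r.
rewrite !chrNl !chrNr !(chrZl h) !(chrZr h).
rewrite (chrC gh v y)// (chrC gh (chr x y y) v)// (chrC gh (cov x y) v)//.
have yS a : <[y, cov x a]_x = - <[cov x y, a]_x.
  by rewrite (cov_skew killingW)// opprK.
have Wcov a : <[W x, cov x a]_x = 0 by exact: (inner_field_cov gW).
have covW a : <[cov x a, W x]_x = 0 by exact: (inner_cov_field gW).
have yy0 : <[cov x y, y]_x = 0 by exact: shear_killing.
rewrite /nav_yy /nav_yx /nav_x /nav_y.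
rewrite !(innerDr, innerNr, innerZr, innerDl, innerNl, innerZl).
rewrite !(yS, Wcov, covW, yy0) (innerC gh (chr x y y) v)// (innerC gh v (chr x y y))//.
rewrite (chrC gh v y)// !rowE.
move: (nav x y) F0 w0 => {HF}.
by abstract_inner; abstract_entries => F F0 w0; field; rewrite ?F0 ?w0.
Qed.

End KillingCurvature.

(** * A Kropina metric of scalar curvature has a Killing field *)

Section QuadraticPole.
Variable R : realFieldType.

Lemma poly_fun_eq0 (p : {poly R}) : (forall t, p.[t] = 0) -> p = 0.
Proof.
move=> p0; apply: (@roots_geq_poly_eq0 _ p [seq i%:R | i <- iota 0 (size p)]).
- by apply/allP => t _; rewrite /root p0.
- by rewrite map_inj_uniq ?iota_uniq// => i j /eqP; rewrite eqr_nat => /eqP.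
- by rewrite size_map size_iota.
Qed.

(** [1 + c t ^+ 2] is prime to [t], hence divides [(A + B t) ^+ 2]; by
    degrees the quotient is a constant, and the values at [0], [1] and [- 1]
    give [A * B = 0] and [B ^+ 2 = c * A ^+ 2]. *)
Lemma quadratic_pole (c k A B : R) (p : {poly R}) : 0 < c -> k != 0 ->
  (forall t, k * (t * A + t ^+ 2 * B) ^+ 2 = (1 + c * t ^+ 2) * p.[t]) ->
  A = 0 /\ B = 0.
Proof.
move=> c0 k0 E.
pose q : {poly R} := A%:P + B *: 'X.
pose s : {poly R} := 1 + c *: 'X^2.
have E1 : k *: ('X^2 * q ^+ 2) = s * p.
  apply/eqP; rewrite -subr_eq0; apply/eqP/poly_fun_eq0 => t.
  have Et := E t; rewrite /s /q.
  rewrite !(hornerD, hornerN, hornerZ, hornerM, horner_exp, hornerX, hornerC).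
  by move: (p.[t]) Et => pt Et; lra.
(* Multiply [1 = s - c 'X^2] by [q ^+ 2]. *)
pose r : {poly R} := q ^+ 2 - (c / k) *: p.
have E2 : q ^+ 2 = s * r.
  rewrite /r mulrBr -scalerAr -E1 scalerA divfK// /s mulrDl mul1r -scalerAl.
  by rewrite addrK.
have sz_s : size s = 3%N.
  rewrite /s addrC size_polyDl ?size_polyC ?oner_eq0 size_scale ?lt0r_neq0//.
    by rewrite size_polyXn.
  by rewrite size_polyXn.
have sz_q : (size q <= 2)%N.
  rewrite /q (leq_trans (size_polyD _ _))// geq_max size_polyC.
  rewrite (leq_trans (size_scale_leq _ _)) ?size_polyX// andbT.
  by case: (A != 0).
have sz_q2 : (size (q ^+ 2) <= 3)%N.
  rewrite (leq_trans (size_poly_exp_leq _ _))//.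
  by rewrite ltnS -[2%N]/((2.-1 * 2)%N) leq_mul2r -!subn1 leq_sub2r.
have [d rE] : exists d, r = d%:P.
  have [->|r0] := eqVneq r 0; first by exists 0.
  exists r`_0; apply: size1_polyC; move: sz_q2; rewrite E2.
  by rewrite size_mul -?size_poly_eq0 ?sz_s ?size_poly_eq0.
have F t : (A + B * t) ^+ 2 = (1 + c * t ^+ 2) * d.
  have := congr1 (horner^~ t) E2; rewrite rE /s /q /=.
  by rewrite !(hornerD, hornerN, hornerZ, hornerM, horner_exp, hornerX, hornerC).
have F0 := F 0; have F1 := F 1; have F2 := F (- 1).
have dE : d = A ^+ 2 by lra.
rewrite dE in F1 F2; have AB : A * B = 0 by lra.
have BB : B ^+ 2 = c * A ^+ 2 by lra.
move/eqP: AB; rewrite mulf_eq0 => /orP[]/eqP Z; move: BB; rewrite Z.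
  by rewrite expr0n mulr0 => /eqP; rewrite sqrf_eq0 => /eqP.
rewrite expr0n /= => /esym/eqP; rewrite mulf_eq0 (gt_eqF c0) sqrf_eq0 /=.
by move/eqP.
Qed.

End QuadraticPole.

Section KillingFromCurvature.
Variables (R : realType) (n : nat) (U : set 'rV[R]_n).
Local Notation V := 'rV[R]_n.
Variables (h : V -> 'M[R]_n) (W : V -> V).
Hypothesis gW : local_unit_field U h W.
Let gh := unit_field_metric gW.
Let openU : open U := local_metric_open gh.
Implicit Types (x y a b c u v w : V).

Local Notation "<[ a , b ]_ x" := (inner h x a b)
  (at level 0, x at level 2, format "<[ a ,  b ]_ x").
Local Notation chr := (chr h).
Local Notation cov := (cov h W).
Local Notation slit := (slit U h W).
Local Notation nav := (nav h W).
Local Notation nav_y := (nav_y h W).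
Local Notation spray_reg := (spray_reg h W).
Local Notation spray_pole := (spray_pole h W).
Local Notation shear := (shear h W).
Local Notation skew := (skew h W).
Local Notation skew_field := (skew_field h W).

Let D1 x y := <[W x, y]_x.
Let D2 x y := <[W x, y]_x * <[y, y]_x.

Section AnyDenominator.
Variables (D : V -> V -> R) (bb : bool).
Local Notation ratfun := (ratfun U D slit bb).

Lemma rat_dual : ratfun (fun x y => <[W x, y]_x).
Proof.
apply: (rat_inner gW (X := fun x _ => W x) (Y := fun _ y => y)) => i.
  exact: (rat_field gW).
exact: rat_y.
Qed.

Lemma rat_normsq : ratfun (fun x y => <[y, y]_x).
Proof.
by apply: (rat_inner gW (X := fun _ y => y) (Y := fun _ y => y)) => i; exact: rat_y.
Qed.

Lemma rat_cov_y i : ratfun (fun x y => cov x y 0 i).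
Proof. by apply: (rat_cov gW (X := fun _ y => y)) => j; exact: rat_y. Qed.

Lemma rat_shear : ratfun shear.
Proof.
apply: (rat_inner gW (X := fun x y => cov x y) (Y := fun _ y => y)) => i.
  exact: rat_cov_y.
exact: rat_y.
Qed.

Lemma rat_skew i : ratfun (fun x y => skew x y 0 i).
Proof.
pose l j x y := <[y, cov x (delta_mx 0 j)]_x.
have rl j : ratfun (l j).
  apply: (rat_inner gW (X := fun _ y => y) (Y := fun x _ => cov x (delta_mx 0 j))) => k.
    exact: rat_y.
  by apply: (rat_cov gW (X := fun _ _ => delta_mx 0 j)) => m; exact: rat_cst.
have rs := rat_sharp gW i rl.
apply: rat_eq (rat_mul (rat_cst _ _ _ _ 2^-1)
  (rat_add (rat_cov_y i) (rat_opp rs))) _ => x y _.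
by rewrite skewE !rowE.
Qed.

Lemma rat_skew_field : ratfun skew_field.
Proof.
apply: (rat_inner gW (X := fun x _ => W x) (Y := skew)) => i.
  exact: (rat_field gW).
exact: rat_skew.
Qed.

Lemma rat_spray_reg i : ratfun nav -> ratfun (fun x y => spray_reg x y 0 i).
Proof.
move=> rN.
have rc j : ratfun (fun x y => chr x y y 0 j).
  by apply: (rat_chr gW (X := fun _ y => y) (Y := fun _ y => y)) => k; exact: rat_y.
have r2 := rat_cst U D slit bb 2^-1.
apply: rat_eq (rat_add (rat_add (rat_add (rat_mul r2 (rc i))
  (rat_opp (rat_mul rN (rat_skew i))))
  (rat_mul (rat_add (rat_mul rN rat_skew_field) (rat_mul r2 rat_shear))
     (rat_field gW D bb i)))
  (rat_opp (rat_mul rat_skew_field (rat_y _ _ _ _ bb i)))) _ => x y _.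
by rewrite /spray_reg !rowE.
Qed.

End AnyDenominator.

Let D1_neq0 x y : slit x y -> D1 x y != 0. Proof. exact: slit_neq0. Qed.
Let D2_neq0 x y : slit x y -> D2 x y != 0.
Proof.
by move=> O; apply: mulf_neq0; [exact: slit_neq0 O|exact/lt0r_neq0/(slit_normsq_gt0 gW O)].
Qed.

Let sO1 : slit_domain U D1 slit := slit_slit_domain gW D1_neq0.
Let sO2 : slit_domain U D2 slit := slit_slit_domain gW D2_neq0.
Let rD1 : ratfun U D1 slit false D1 := rat_dual D1 false.
Let rD2 : ratfun U D2 slit false D2 :=
  rat_mul (rat_dual D2 false) (rat_normsq D2 false).

Let rN1 : ratfun U D1 slit true nav.
Proof.
apply: rat_eq (rat_mul (rat_mul (rat_cst _ _ _ _ 2^-1) (rat_normsq D1 true))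
  (rat_inv _ _ _ isT)) _ => x y _.
by rewrite /nav /D1 invfM; ring.
Qed.

Let rN2 : ratfun U D2 slit true nav.
Proof.
apply: rat_eq (rat_mul (rat_mul (rat_cst _ _ _ _ 2^-1)
  (rat_mul (rat_normsq D2 true) (rat_normsq D2 true)))
  (rat_inv _ _ _ isT)) _ => x y O.
have H0 := lt0r_neq0 (slit_normsq_gt0 gW O); have w0 := slit_neq0 O.
rewrite /nav /D2; move: H0 w0.
by abstract_inner => H0 w0; field; rewrite ?H0 ?w0.
Qed.

Let rho x y := shear x y * <[W x, y]_x.
Let rat_rho D bb : ratfun U D slit bb rho.
Proof. by apply: rat_mul; [exact: rat_shear|exact: rat_dual]. Qed.

Let rP : ratfun U D2 slit true spray_pole.
Proof.
apply: rat_eq (rat_opp (rat_mul (rat_mul (rat_rho D2 true) (rat_dual D2 true))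
  (rat_inv _ _ _ isT))) _ => x y O.
have H0 := lt0r_neq0 (slit_normsq_gt0 gW O); have w0 := slit_neq0 O.
rewrite /spray_pole /rho /D2; move: (shear x y) H0 w0.
by abstract_inner => s H0 w0; field; rewrite ?H0 ?w0.
Qed.

Lemma rat_nav_spray i : ratfun U D2 slit true
  (fun x y => nav_spray h W x y 0 i).
Proof.
apply: (rat_rowD (X := spray_reg) (Y := fun x y => spray_pole x y *: y)) => j.
  exact: rat_spray_reg rN2.
by apply: (rat_rowZ _ rP) => k; exact: rat_y.
Qed.

Lemma nav_scale x y t : 0 < t -> nav x (t *: y) = t * nav x y.
Proof.
move=> /lt0r_neq0 t0; rewrite /nav !innerZr innerZl.
have [->|w0] := eqVneq <[W x, y]_x 0; first by rewrite !mulr0 !invr0 !mulr0.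
by move: w0; abstract_inner => w0; field; rewrite w0.
Qed.

Lemma skew_scale x y t : U x -> skew x (t *: y) = t *: skew x y.
Proof.
move=> Ux; apply: (inner_nondeg gh Ux) => c.
rewrite innerZl !(inner_skew gW)// (covZ gW)// !innerZl.
by abstract_inner => *; ring.
Qed.

Lemma spray_reg_scale x y t : U x -> 0 < t ->
  spray_reg x (t *: y) = t ^+ 2 *: spray_reg x y.
Proof.
move=> Ux t0; rewrite /spray_reg /skew_field /shear nav_scale// skew_scale//.
rewrite (covZ gW)// (chrZl h) (chrZr h) !innerZl !innerZr.
apply/rowP => i; rewrite !rowE.
move: (nav x y) (cov x y) (skew x y) => F c s.
by abstract_inner; abstract_entries => *; ring.
Qed.

Lemma spray_pole_scale x y t : U x -> 0 < t ->
  spray_pole x (t *: y) = t * spray_pole x y.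
Proof.
move=> Ux /lt0r_neq0 t0; rewrite /spray_pole /shear (covZ gW)// !innerZl !innerZr.
have [->|w0] := eqVneq <[y, y]_x 0; first by rewrite !mulr0 !invr0 !mulr0 oppr0 mulr0.
by move: w0; move: (cov x y) => c; abstract_inner => w0; field; rewrite w0.
Qed.

Let euler_reg x y i : slit x y ->
  diry y (fun x y => spray_reg x y 0 i) x y = 2 * spray_reg x y 0 i.
Proof.
move=> O; have [Ux _] := O.
apply: (diry_homogeneous (d := 2) sO1 rD1 (rat_spray_reg i rN1) O) => t t0.
by rewrite spray_reg_scale// rowE.
Qed.

Let euler_pole x y : slit x y -> diry y spray_pole x y = spray_pole x y.
Proof.
move=> O; have [Ux _] := O.
rewrite (diry_homogeneous (d := 1) sO2 rD2 rP O) ?mul1r// => t t0.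
by rewrite spray_pole_scale// expr1.
Qed.

(* The square of [spray_pole] contributes [rho ^+ 2]; its derivative along the
   spray contributes [2 rho ^+ 2], because the derivative of [<y, y>] along the
   regular part of the spray is [- 2 rho] up to a multiple of [<y, y>]. *)
Let pole_coefficient x y : slit x y ->
  <[y, y]_x ^+ 2 * (spray_pole x y ^+ 2 - dirx y spray_pole x y
     + 2 * diry (spray_reg x y) spray_pole x y) =
  3 * rho x y ^+ 2 + <[y, y]_x * (dirx y rho x y - 2 * diry (spray_reg x y) rho x y
     - 2 * rho x y * skew_field x y).
Proof.
move=> O; have [Ux _] := O.
have H0 := lt0r_neq0 (slit_normsq_gt0 gW O).
have Ex : dirx y spray_pole x y = - (dirx y rho x y / <[y, y]_x
    + rho x y * (- (2 * <[chr x y y, y]_x) / <[y, y]_x ^+ 2)).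
  have D := is_derive_opp (is_derive_mul (rat_is_dirx sO1 rD1 y (rat_rho D1 true) O)
    (is_derive_inv (f := fun z => <[y, y]_z) H0 (is_derive_inner_cst gh y y y Ux))).
  rewrite [LHS](derive_val (is_derive := D)) (metric_compat gh)//.
  by rewrite (innerC gh y (chr x y y))// mulr_natl mulr2n.
have Ey X : diry X spray_pole x y = - (diry X rho x y / <[y, y]_x
    + rho x y * (- (2 * <[y, X]_x) / <[y, y]_x ^+ 2)).
  have D := is_derive_opp (is_derive_mul (rat_is_diry sO1 rD1 X (rat_rho D1 true) O)
    (is_derive_inv (f := fun y => <[y, y]_x) H0 (is_derive_normsq_y gW y X Ux))).
  exact: (derive_val (is_derive := D)).
have yG : <[y, spray_reg x y]_x = 2^-1 * <[chr x y y, y]_x + 2^-1 * rho x y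
    - 2^-1 * skew_field x y * <[y, y]_x.
  rewrite /spray_reg !(innerDr, innerNr, innerZr) (innerC gh y (chr x y y))//.
  rewrite (innerC gh y (skew x y))// (inner_skew gW)// (innerC gh y (cov x y))//.
  rewrite /rho (innerC gh y (W x))// -/(shear x y).
  have HF := normsq_nav O; rewrite HF.
  move: (shear x y) (skew_field x y) (nav x y).
  by abstract_inner => *; field.
rewrite Ex Ey yG /spray_pole -/(rho x y).
move: (rho x y) (skew_field x y) H0; abstract_dir.
by abstract_inner => r s H0; field; rewrite ?H0.
Qed.

Lemma rat_spray_curvature D bb (G : V -> V -> V) v i : slit_domain U D slit ->
  ratfun U D slit false D -> (forall i, ratfun U D slit bb (fun x y => G x y 0 i)) ->
  ratfun U D slit bb (spray_curvature G v i).
Proof.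
move=> sO rD rG; have rv := fun i => rat_diry sO rD v (rG i).
have r2 := rat_cst U D slit bb 2.
have ry j : ratfun U D slit bb (fun x y => y 0 j) by exact: rat_coord.
apply: rat_add; last first.
  apply: rat_opp; apply: (rat_diry_var sO rD (X := fun x y =>
    \row_j diry v (fun x y => G x y 0 j) x y) (rG i)) => j.
  by apply: rat_eq (rv j) _ => x y _; rewrite mxE.
apply: rat_add; last first.
  by apply: (rat_mul r2); apply: (rat_diry_var sO rD (X := G)).
apply: rat_add; first by apply: (rat_mul r2); exact: rat_dirx.
by apply: rat_opp; apply: (rat_dirx_var sO rD (X := fun _ y => y)).
Qed.

Section FixedPoint.
Variables (x0 : V) (K : R).
Hypothesis Ux0 : U x0.
Hypothesis curvK : forall y v i, slit x0 y ->
  spray_curvature (nav_spray h W) v i x0 y =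
  K * (nav x0 y ^+ 2 * v 0 i - nav x0 y * nav_y x0 y v * y 0 i).

Let clear_pole (N k c r1 r2 r3 r4 r5 : R) :
  N ^+ 2 * (k * r5 ^+ 2 * c) = N ^+ 2 * r1 + c * (3 * r4 ^+ 2 + N * r3)
    + 2 * N * - r4 * r2 ->
  3 * c * r4 ^+ 2 = N * (k * r5 ^+ 2 * c * N - N * r1 - c * r3 + 2 * r4 * r2).
Proof. by move=> E; lra. Qed.

(** On the line [y = W + t f] one has [<W, y> = 1].  Multiplied by
    [<y, y> ^+ 2] and projected along [y], the curvature equation becomes
    [3 <f, f> rho ^+ 2 = <y, y> Q] with [Q] a polynomial in [t]. *)
Lemma cov_transverse (f : V) : f != 0 -> <[W x0, f]_x0 = 0 ->
  <[cov x0 (W x0), f]_x0 = 0 /\ <[cov x0 f, f]_x0 = 0.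
Proof.
move=> f0 Wf.
pose c0 := <[f, f]_x0; have c00 : 0 < c0 by exact: (local_metric_pos gh).
have WW := unit_field_norm gW Ux0.
have fW : <[f, W x0]_x0 = 0 by rewrite (innerC gh).
pose line t := W x0 + t *: f.
have dual_line t : <[W x0, line t]_x0 = 1.
  by rewrite innerDr innerZr Wf WW mulr0 addr0.
have slit_line t : slit x0 (line t) by split; rewrite // dual_line.
(* [xi] is a functional that vanishes on the line and is positive on [f]. *)
pose xi (i : 'I_n) x y := <[delta_mx 0 i, f]_x - <[y, f]_x * <[delta_mx 0 i, W x]_x.
have xiE (y z : V) : \sum_i xi i x0 y * z 0 i = <[z, f]_x0 - <[y, f]_x0 * <[z, W x0]_x0.
  rewrite [RHS](linear_expand (f := fun z => <[z, f]_x0 - <[y, f]_x0 * <[z, W x0]_x0)).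
    by apply: eq_bigr => i _; rewrite mulrC.
  by move=> k u w; rewrite !innerDl !innerZl; abstract_inner => *; ring.
have rxi i : ratfun U D1 slit true (xi i).
  have re := rat_cst U D1 slit true.
  apply: rat_add; first by apply: (rat_inner gW (X := fun _ _ => delta_mx 0 i)
    (Y := fun _ _ => f)) => j; exact: re.
  apply: rat_opp; apply: rat_mul.
    by apply: (rat_inner gW (X := fun _ y => y) (Y := fun _ _ => f)) => j;
       [exact: rat_coord|exact: re].
  by apply: (rat_inner gW (X := fun _ _ => delta_mx 0 i) (Y := fun x _ => W x)) => j;
     [exact: re|exact: (rat_field gW)].
have rreg i := rat_spray_reg i rN1.
pose A x y := dirx y rho x y - 2 * diry (spray_reg x y) rho x y
  - 2 * rho x y * skew_field x y.
pose T (i : 'I_n) x y := diry y (diry f (fun x y => spray_reg x y 0 i)) x y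
  - diry f (fun x y => spray_reg x y 0 i) x y.
pose S1 x y := \sum_i xi i x y * spray_curvature spray_reg f i x y.
pose S2 x y := \sum_i xi i x y * T i x y.
pose Q x y := K * nav x y ^+ 2 * c0 * <[y, y]_x - <[y, y]_x * S1 x y
  - c0 * A x y + 2 * rho x y * S2 x y.
have rQ : ratfun U D1 slit true Q.
  have rc k := rat_cst U D1 slit true k.
  have rr := rat_rho D1 true.
  have rA : ratfun U D1 slit true A.
    apply: rat_add; first apply: rat_add.
    - apply: (rat_dirx_var sO1 rD1 (X := fun _ y => y)) => // j; exact: rat_coord.
    - by apply: rat_opp; apply: (rat_mul (rc _)); apply: (rat_diry_var sO1 rD1 (X := spray_reg)).
    - apply: rat_opp; apply: rat_mul; last exact: rat_skew_field.
      exact: rat_mul (rc _) rr.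
  have rS1 : ratfun U D1 slit true S1.
    apply: rat_sum => i; apply: rat_mul => //; exact: rat_spray_curvature sO1 rD1 rreg.
  have rS2 : ratfun U D1 slit true S2.
    apply: rat_sum => i; apply: rat_mul => //; have rd := rat_diry sO1 rD1 f (rreg i).
    apply: rat_add; last exact: rat_opp.
    by apply: (rat_diry_var sO1 rD1 (X := fun _ y => y)) => // j; exact: rat_coord.
  apply: rat_add; last by apply: rat_mul rS2; exact: rat_mul (rc _) rr.
  apply: rat_add; last by apply: rat_opp; exact: rat_mul (rc _) rA.
  apply: rat_add; last by apply: rat_opp; exact: rat_mul (rat_normsq _ _) rS1.
  apply: rat_mul (rat_normsq _ _); apply: rat_mul (rc _).
  by apply: (rat_mul (rc _)); exact: rat_mul rN1 rN1.
have QE t : let y := line t in 3 * c0 * rho x0 y ^+ 2 = <[y, y]_x0 * Q x0 y.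
  move=> y; have O : slit x0 y by exact: slit_line.
  have H0 := lt0r_neq0 (slit_normsq_gt0 gW O).
  have [c pc] := projective_change sO2 rD2 f
    (fun i => rat_spray_reg i rN2) rP O (fun i => euler_reg i O) (euler_pole O).
  have pole := pole_coefficient O.
  rewrite -/(A x0 y) in pole.
  set Xi := (X in <[y, y]_x0 ^+ 2 * X) in pole.
  have E : K * nav x0 y ^+ 2 * c0 = S1 x0 y + Xi * c0 + 2 * spray_pole x0 y * S2 x0 y.
    have fE : \sum_i xi i x0 y * f 0 i = c0 by rewrite xiE fW mulr0 subr0.
    have yE : \sum_i xi i x0 y * y 0 i = 0.
      by rewrite xiE (innerC gh y (W x0))// dual_line mulr1 subrr.
    transitivity (\sum_i xi i x0 y * (K * (nav x0 y ^+ 2 * f 0 i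
        - nav x0 y * nav_y x0 y f * y 0 i))).
      transitivity (K * nav x0 y ^+ 2 * (\sum_i xi i x0 y * f 0 i)
          - K * nav x0 y * nav_y x0 y f * (\sum_i xi i x0 y * y 0 i)).
        by rewrite fE yE mulr0 subr0.
      rewrite !mulr_sumr -sumrB; apply: eq_bigr => i _.
      by move: (nav x0 y) (nav_y x0 y f) (xi i x0 y) (f 0 i) (y 0 i) => *; ring.
    transitivity (S1 x0 y + Xi * (\sum_i xi i x0 y * f 0 i)
        + 2 * spray_pole x0 y * S2 x0 y + c * (\sum_i xi i x0 y * y 0 i)).
      rewrite /S1 /S2 !mulr_sumr -!big_split; apply: eq_bigr => i _ /=.
      rewrite -(curvK f i O) [spray_curvature _ _ _ _ _]pc -/Xi -/(T i x0 y).
      move: (spray_curvature _ _ _ _ _) (spray_pole x0 y) (xi i x0 y) (T i x0 y).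
      by move: (f 0 i) (y 0 i) => *; ring.
    by rewrite fE yE mulr0 addr0.
  have HP : <[y, y]_x0 * spray_pole x0 y = - rho x0 y.
    by rewrite /spray_pole -/(rho x0 y) mulrN mulrC divfK.
  have : <[y, y]_x0 ^+ 2 * (K * nav x0 y ^+ 2 * c0) = <[y, y]_x0 ^+ 2 * S1 x0 y
      + c0 * (<[y, y]_x0 ^+ 2 * Xi)
      + 2 * <[y, y]_x0 * (<[y, y]_x0 * spray_pole x0 y) * S2 x0 y.
    rewrite E; move: (S1 _ _) (S2 _ _) (spray_pole _ _).
    by abstract_inner => *; ring.
  rewrite pole HP /Q.
  move: (S1 _ _) (S2 _ _) (A _ _) (rho _ _) (nav _ _) => r1 r2 r3 r4 r5.
  exact: clear_pole.
have [p pE] := rat_line rQ slit_line dual_line.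
have c30 : 3 * c0 != 0 by rewrite mulf_neq0 ?pnatr_eq0 ?lt0r_neq0.
apply: (quadratic_pole (p := p) c00 c30) => t.
have := QE t; rewrite /= [Q _ _]pE => Et.
have Hline : <[line t, line t]_x0 = 1 + c0 * t ^+ 2.
  rewrite /line !(innerDl, innerDr, innerZl, innerZr) Wf fW WW -/c0; ring.
have rline : rho x0 (line t) =
    t * <[cov x0 (W x0), f]_x0 + t ^+ 2 * <[cov x0 f, f]_x0.
  rewrite /rho dual_line mulr1 /shear /line (covD gW)// (covZ gW)//.
  rewrite !(innerDl, innerDr, innerZl, innerZr) !(inner_cov_field gW)//.
  by abstract_inner => *; ring.
by rewrite -Hline -rline.
Qed.

(** [<cov c, c>] vanishes for [c] orthogonal to [W], for [c = W] and on mixed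
    terms; polarization does the rest. *)
Lemma killing_of_curvature a b : <[cov x0 a, b]_x0 + <[a, cov x0 b]_x0 = 0.
Proof.
have cov0' f : <[W x0, f]_x0 = 0 ->
    <[cov x0 (W x0), f]_x0 = 0 /\ <[cov x0 f, f]_x0 = 0.
  have [->|f0] := eqVneq f 0; first by rewrite !inner0r.
  exact: cov_transverse.
have quad c : <[cov x0 c, c]_x0 = 0.
  have [k [f [-> Wf]]] : exists k f, c = f + k *: W x0 /\ <[W x0, f]_x0 = 0.
    exists <[W x0, c]_x0, (c - <[W x0, c]_x0 *: W x0); rewrite subrK; split=> //.
    by rewrite innerDr innerNr innerZr (unit_field_norm gW Ux0) mulr1 subrr.
  have [E1 E2] := cov0' f Wf.
  rewrite (covD gW)// (covZ gW)// !(innerDl, innerDr, innerZl, innerZr).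
  by rewrite E1 E2 !(inner_cov_field gW)// !(mulr0, addr0).
have := quad (a + b); rewrite (covD gW)// !(innerDl, innerDr) !quad.
by rewrite (innerC gh (cov x0 b))// add0r addr0.
Qed.

End FixedPoint.

Section FinslerCurvature.
Variable F : V -> V -> R.
Hypothesis navF : forall x y, slit x y -> F x y = nav x y.

Lemma finsler_curvature_nav v i x y : slit x y ->
  \sum_k v 0 k * finsler_curvature F i k x y =
  spray_curvature (nav_spray h W) v i x y.
Proof.
by apply: (finsler_curvature_contract sO2 rD2 v i rat_nav_spray) => j z w;
  exact: (spray_nav gW navF).
Qed.

Lemma finsler_curvature_killing v i x y :
  (forall x, U x -> forall a b, <[cov x a, b]_x + <[a, cov x b]_x = 0) ->
  slit x y ->
  let u := y - nav x y *: W x in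
  \sum_k v 0 k * finsler_curvature F i k x y =
  curv h x (v - (nav_y x y v / nav x y) *: y) u u 0 i.
Proof.
move=> kW O u; rewrite -(killing_spray_curvature gW kW)//.
apply: (finsler_curvature_contract (b := true) sO2 rD2 v i) O => j.
  apply: rat_eq (rat_nav_spray j) _ => z w [Uz _].
  by rewrite (nav_spray_killing gW kW).
by move=> z w O; have [Uz _] := O; rewrite -(nav_spray_killing gW kW)//;
  exact: (spray_nav gW navF).
Qed.

End FinslerCurvature.

End KillingFromCurvature.

(** * Pointwise curvature conditions *)

Section SectionalCurvature.
Variables (R : realType) (n : nat) (U : set 'rV[R]_n).
Local Notation V := 'rV[R]_n.
Variables (h : V -> 'M[R]_n).
Hypothesis gh : local_metric U h.
Implicit Types (x y a b c u v w : V).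

Local Notation "<[ a , b ]_ x" := (inner h x a b)
  (at level 0, x at level 2, format "<[ a ,  b ]_ x").
Local Notation curv := (curv h).

Lemma sectional_curvatureE x u v : U x -> sectional_curvature h x u v =
  <[curv x u v v, u]_x / (<[u, u]_x * <[v, v]_x - <[u, v]_x ^+ 2).
Proof.
move=> Ux; rewrite /sectional_curvature.
set r := \row_i _; have -> // : r = curv x u v v.
by apply/rowP => i; rewrite mxE (riemann_curvatureE gh).
Qed.

Lemma cauchy_schwarz_row_free x u v : U x ->
  row_free (col_mx u v) -> 0 < <[u, u]_x * <[v, v]_x - <[u, v]_x ^+ 2.
Proof.
move=> Ux fr.
have v0 : v != 0.
  apply: contraTneq fr => ->; rewrite -row_leq_rank -addsmxE addsmx0.
  by rewrite -ltnNge (leq_ltn_trans (rank_leq_row _)).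
have vv : 0 < <[v, v]_x by exact: (local_metric_pos gh).
pose w := u - (<[u, v]_x / <[v, v]_x) *: v.
have w0 : w != 0.
  apply: contraTneq fr => /eqP; rewrite subr_eq0 => /eqP uE.
  rewrite -row_leq_rank -addsmxE (addsmx_idPr _) ?rank_leq_row//.
    by rewrite -ltnNge (leq_ltn_trans (rank_leq_row _)).
  by rewrite uE; exact: scalemx_sub.
have ww := local_metric_pos gh Ux w0.
have E : <[u, u]_x * <[v, v]_x - <[u, v]_x ^+ 2 = <[v, v]_x * <[w, w]_x.
  rewrite /w !(innerDl, innerDr, innerNl, innerNr, innerZl, innerZr).
  rewrite (innerC gh v u)//; move: (lt0r_neq0 vv).
  by abstract_inner => vv0; field.
by rewrite E mulr_gt0.
Qed.

Lemma orthogonal_row_free x u v : U x -> u != 0 -> v != 0 ->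
  <[u, v]_x = 0 -> row_free (col_mx u v).
Proof.
move=> Ux u0 v0 uv; rewrite -kermx_eq0; apply/eqP/row_matrixP => i; rewrite row0.
set z := row i _; have : z *m col_mx u v = 0 by rewrite -row_mul mulmx_ker row0.
rewrite -(hsubmxK z) mul_row_col.
move: (lsubmx z) (rsubmx z) => a b.
rewrite (mx11_scalar a) (mx11_scalar b) !mul_scalar_mx => ab.
have a0 : a 0 0 = 0.
  have := congr1 (inner h x ^~ u) ab.
  rewrite innerDl !innerZl (innerC gh v u)// uv mulr0 addr0 inner0l => /eqP.
  by rewrite mulf_eq0 (gt_eqF (local_metric_pos gh Ux u0)) orbF => /eqP.
move: ab; rewrite a0 scale0r add0r => /eqP; rewrite scaler_eq0 (negbTE v0) orbF.
by move=> /eqP ->; rewrite !(raddf0 (@scalar_mx _ _)) row_mx0.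
Qed.

(** Sectional curvatures are the diagonal values of the operators
    [curv x _ u u], which are symmetric, so they determine them. *)
Lemma sectional_operator x K : U x ->
  (forall u v, row_free (col_mx u v) -> sectional_curvature h x u v = K) <->
  (forall u v, curv x v u u = K *: (<[u, u]_x *: v - <[u, v]_x *: u)).
Proof.
move=> Ux; split=> [sK u v|cK u v fr]; last first.
  have D0 := lt0r_neq0 (cauchy_schwarz_row_free Ux fr).
  rewrite sectional_curvatureE// cK !(innerZl, innerDl, innerNl) (innerC gh v u)//.
  apply: (canLR (mulfK D0)).
  by abstract_inner => *; ring.
have [->|u0] := eqVneq u 0.
  by rewrite curv0r !inner0l !scale0r subrr scaler0.
pose B p := curv x p u u - K *: (<[u, u]_x *: p - <[u, p]_x *: u).
have BE p : B p = curv x p u u - K *: (<[u, u]_x *: p - <[u, p]_x *: u) by [].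
clearbody B.
have BD p q : B (p + q) = B p + B q.
  rewrite !BE (curvDl gh)// innerDr; apply/rowP => i; rewrite !rowE.
  by abstract_inner; abstract_entries => *; ring.
have BZ k p : B (k *: p) = k *: B p.
  rewrite !BE (curvZl gh)// innerZr; apply/rowP => i; rewrite !rowE.
  by abstract_inner; abstract_entries => *; ring.
have Bu : B u = 0 by rewrite !BE curv_diag subrr scaler0 subrr.
have Bsym p q : <[B p, q]_x = <[p, B q]_x.
  rewrite !BE !(innerDl, innerDr, innerNl, innerNr, innerZl, innerZr).
  rewrite (curv_pair gh)// (curv_anti h) innerNl (curv_skew gh)// opprK.
  rewrite (innerC gh p u)//.
  by abstract_inner => *; ring.
have diag0 w : <[u, w]_x = 0 -> <[B w, w]_x = 0.
  have [->|w0 uw] := eqVneq w 0; first by rewrite !inner0r.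
  have wu : <[w, u]_x = 0 by rewrite (innerC gh).
  have fr := orthogonal_row_free Ux w0 u0 wu.
  have D0 := lt0r_neq0 (cauchy_schwarz_row_free Ux fr).
  have := sK w u fr; rewrite sectional_curvatureE// => /(canRL (divfK D0)) E.
  rewrite !BE !(innerDl, innerNl, innerZl) E uw wu.
  by abstract_inner => *; ring.
have diag p : <[B p, p]_x = 0.
  have uu := lt0r_neq0 (local_metric_pos gh Ux u0).
  have [k [w [-> uw]]] : exists k w, p = w + k *: u /\ <[u, w]_x = 0.
    exists (<[u, p]_x / <[u, u]_x), (p - (<[u, p]_x / <[u, u]_x) *: u).
    by rewrite subrK innerDr innerNr innerZr divfK// subrr.
  rewrite BD BZ Bu scaler0 addr0 innerDr innerZr diag0//.
  by rewrite Bsym Bu inner0r mulr0 addr0.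
apply/eqP; rewrite -subr_eq0 -BE; apply/eqP/(inner_nondeg gh Ux) => q.
have := diag (v + q); rewrite BD !(innerDl, innerDr) !diag Bsym (innerC gh v)//.
by rewrite [<[B q, v]_x]Bsym inner0l (innerC gh q)//; abstract_inner => *; lra.
Qed.

(** For [v] orthogonal to [W], [<cov v, cov v> = <R(v, W) W, v> = K <v, v>]. *)
Lemma curv_operator_nonneg (W : V -> V) x K : (2 <= n)%N ->
  local_unit_field U h W ->
  (forall x, U x -> forall a b, <[cov h W x a, b]_x + <[a, cov h W x b]_x = 0) ->
  U x ->
  (forall u v, curv x v u u = K *: (<[u, u]_x *: v - <[u, v]_x *: u)) ->
  0 <= K.
Proof.
move=> n2 gW kW Ux cK.
have WW := unit_field_norm gW Ux.
have [v v0 Wv] : exists2 v, v != 0 & <[W x, v]_x = 0.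
  (* The orthogonal complement of [W] in the span of two basis vectors. *)
  pose e (i : 'I_n) : V := delta_mx 0 i.
  pose i0 := Ordinal (ltnW n2); pose i1 := Ordinal n2.
  have [W0|W0] := eqVneq <[W x, e i0]_x 0.
    exists (e i0) => //; apply/eqP => /rowP/(_ i0)/eqP.
    by rewrite !mxE !eqxx oner_eq0.
  exists (<[W x, e i1]_x *: e i0 - <[W x, e i0]_x *: e i1); last first.
    by rewrite innerDr innerNr !innerZr mulrC subrr.
  apply: contraNneq W0 => /rowP/(_ i1)/eqP.
  by rewrite !rowE !mxE !eqxx /= mulr0 add0r mulr1 oppr_eq0.
have vv : 0 < <[v, v]_x by exact: (local_metric_pos gh).
have := inner_cov_cov gW kW v v Ux.
rewrite (curv_anti h) innerNl (curv_skew gh)// opprK (innerC gh)// cK.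
rewrite Wv WW scale0r subr0 scale1r innerZl => E.
have : 0 <= <[cov h W x v, cov h W x v]_x.
  have [->|c0] := eqVneq (cov h W x v) 0; first by rewrite inner0l.
  exact/ltW/(local_metric_pos gh).
by rewrite E pmulr_lge0.
Qed.

End SectionalCurvature.

Section ScalarCurvature.
Variables (R : realType) (n : nat) (U : set 'rV[R]_n).
Local Notation V := 'rV[R]_n.
Variables (h : V -> 'M[R]_n) (W : V -> V).
Hypothesis gW : local_unit_field U h W.
Let gh := unit_field_metric gW.
Implicit Types (x y a b c u v w : V).

Local Notation "<[ a , b ]_ x" := (inner h x a b)
  (at level 0, x at level 2, format "<[ a ,  b ]_ x").
Local Notation curv := (curv h).
Local Notation cov := (cov h W).
Local Notation slit := (slit U h W).
Local Notation nav := (nav h W).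
Local Notation nav_y := (nav_y h W).

Variable F : V -> V -> R.
Hypothesis navF : forall x y, slit x y -> F x y = nav x y.

Lemma scalar_flag_contract x K :
  (forall y, slit x y -> forall i k, finsler_curvature F i k x y =
     K * (F x y ^+ 2 * (i == k)%:R - F x y * dy k F x y * y 0 i)) <->
  (forall y v i, slit x y -> \sum_k v 0 k * finsler_curvature F i k x y =
     K * (nav x y ^+ 2 * v 0 i - nav x y * nav_y x y v * y 0 i)).
Proof.
have dyF y k : slit x y -> dy k F x y = nav_y x y (delta_mx 0 k).
  exact: (diry_nav gW navF).
split=> [H y v i O|H y O i k].
  under eq_bigr => k _ do rewrite (H y O) navF// dyF//.
  rewrite [nav_y x y v](linear_expand (f := nav_y x y)); last first.
    by move=> *; exact: nav_y_linear.
  rewrite [v 0 i in RHS](_ : _ = \sum_k v 0 k * (i == k)%:R); last first.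
    rewrite (bigD1 i)//= eqxx mulr1 big1 ?addr0// => k /negbTE ki.
    by rewrite eq_sym ki mulr0.
  rewrite mulrBr !mulr_sumr mulr_suml mulr_sumr -sumrB.
  by apply: eq_bigr => k _; move: (nav x y) (nav_y _ _ _) => *; ring.
have := H y (delta_mx 0 k) i O.
rewrite (bigD1 k)//= big1 ?addr0 => [|l lk]; last first.
  by rewrite mxE eqxx (negbTE lk) mul0r.
by rewrite !mxE !eqxx mul1r navF// dyF// => ->.
Qed.

Lemma killing_of_scalar_flag x K : U x ->
  (forall y, slit x y -> forall i k, finsler_curvature F i k x y =
     K * (F x y ^+ 2 * (i == k)%:R - F x y * dy k F x y * y 0 i)) ->
  forall a b, <[cov x a, b]_x + <[a, cov x b]_x = 0.
Proof.
move=> Ux /scalar_flag_contract H.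
apply: (killing_of_curvature gW Ux (K := K)) => y v i O.
by rewrite -(finsler_curvature_nav gW navF)// H.
Qed.

Hypothesis killingW : forall x, U x ->
  forall a b, <[cov x a, b]_x + <[a, cov x b]_x = 0.

(** [y - F W] takes all nonzero values [e] with [0 <= <W, e>], and both sides of
    the equation on the right are even in [u]. *)
Lemma scalar_flag_killing x K : U x ->
  (forall y, slit x y -> forall i k, finsler_curvature F i k x y =
     K * (F x y ^+ 2 * (i == k)%:R - F x y * dy k F x y * y 0 i)) <->
  (forall u v, curv x v u u = K *: (<[u, u]_x *: v - <[u, v]_x *: u)).
Proof.
move=> Ux; have WW := unit_field_norm gW Ux.
apply: iff_trans (scalar_flag_contract x K) _; split=> [H|H y v i O]; last first.
  rewrite (finsler_curvature_killing gW navF v i killingW O) H.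
  have F0 := lt0r_neq0 (nav_gt0 gW O); have w0 := slit_neq0 O.
  have HF := normsq_nav O.
  rewrite !(innerDl, innerDr, innerNl, innerNr, innerZl, innerZr).
  rewrite (innerC gh y (W x))// WW HF !rowE /nav_y.
  move: (nav x y) F0 w0 (v 0 i) (y 0 i) (W x 0 i) => {HF}.
  by abstract_inner => F0 Fn w0 p q r; field; rewrite ?Fn ?w0.
have pos e : 0 <= <[W x, e]_x -> e != 0 -> forall v, <[e, v]_x = 0 ->
    curv x v e e = K *: (<[e, e]_x *: v).
  move=> We e0 v ev; have ee := local_metric_pos gh Ux e0.
  (* [y] is chosen such that [F = l] and [y - F W = e]. *)
  pose l := Num.sqrt <[e, e]_x; have l0 : 0 < l by rewrite sqrtr_gt0.
  have ll : l ^+ 2 = <[e, e]_x by rewrite sqr_sqrtr// ltW.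
  pose y := e + l *: W x.
  have Wy : <[W x, y]_x = <[W x, e]_x + l by rewrite innerDr innerZr WW mulr1.
  have O : slit x y by split=> //; rewrite Wy ltr_wpDl.
  have yl : nav x y = l.
    rewrite /nav Wy /y !(innerDl, innerDr, innerZl, innerZr) WW -ll (innerC gh e (W x))//.
    have : <[W x, e]_x + l != 0 by rewrite lt0r_neq0// ltr_wpDl.
    by move: l {ll l0 y Wy O}; abstract_inner => l H0; field.
  have yv : nav_y x y v = 0.
    by rewrite /nav_y yl /y innerDl innerZl ev add0r subrr mul0r.
  apply/rowP => i; have := H y v i O.
  rewrite (finsler_curvature_killing gW navF v i killingW O) yv mul0r scale0r subr0.
  by rewrite yl /y addrK mulr0 mul0r subr0 ll !rowE => ->; rewrite mulrA.
have orth e v : <[e, v]_x = 0 -> curv x v e e = K *: (<[e, e]_x *: v).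
  have [->|e0] := eqVneq e 0; first by rewrite curv0r !inner0l scale0r scaler0.
  have [We|We] := lerP 0 <[W x, e]_x; first exact: pos.
  have := pos (- e); rewrite innerNr oppr_ge0 (ltW We) oppr_eq0 => /(_ isT e0 v).
  by rewrite innerNl => P ev; move: (P); rewrite ev oppr0 (curvNm gh)// curvNr opprK
    innerNl innerNr opprK => ->.
move=> e v.
have [->|e0] := eqVneq e 0.
  by rewrite curv0r !inner0l !scale0r subrr scaler0.
have ee := lt0r_neq0 (local_metric_pos gh Ux e0).
pose k := <[e, v]_x / <[e, e]_x; pose w := v - k *: e.
have ew : <[e, w]_x = 0 by rewrite innerDr innerNr innerZr divfK// subrr.
have := orth e w ew; rewrite {1}/w (curvDl gh)// (curvNl gh)// (curvZl gh)//.
rewrite curv_diag scaler0 subr0 => ->.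
by rewrite /w scalerBr scalerA mulrC divfK.
Qed.

End ScalarCurvature.

(** * Navigation data of a Kropina space *)

Section NavigationData.
Variables (R : realType) (n : nat) (M : topologicalType) (A : smooth_atlas R n M).
Local Notation V := 'rV[R]_n.
Variables (a : field2 A) (b : field1 A) (kappa : M -> R).
Hypotheses (ha : riemannian_metric a) (hb : one_form b).
Hypothesis hkappa : navigation_factor a b kappa.
Variable c : chart A.
Implicit Types (x y : V).

Let U := cod c.
Let h : V -> 'M[R]_n := nav_metric kappa a c.
Let W : V -> V := nav_field kappa a b c.
Let e x : R := expR (kappa (psi c x)).

Let openU : open U := @cod_open _ _ _ A c.

Let sqnorm_neq0 x : U x -> sqnorm_form (a c) (b c) x != 0.
Proof.
move=> Ux; apply/eqP => s0; have := hkappa Ux.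
by rewrite s0 mulr0 => /esym/eqP; rewrite pnatr_eq0.
Qed.

Let smooth_a i j : smooth_on U (fun x => a c x i j).
Proof. by case: ha => + _ _ _; exact. Qed.

Let smooth_b i : smooth_on U (fun x => b c x 0 i).
Proof. by case: hb => + _; exact. Qed.

Let metric_a : local_metric U (a c).
Proof.
case: ha => _ sa pa _; split=> //.
- by move=> x; exact: sa.
- by move=> x Ux y y0; rewrite innerE; exact: pa.
Qed.

(* [kappa] is given as a mere function; its smoothness comes from
   [expR kappa = 4 / b ^+ 2]. *)
Let smooth_e : smooth_on U e.
Proof.
have sS : smooth_on U (sqnorm_form (a c) (b c)).
  apply: smooth_on_bigsum => // i; apply: smooth_on_bigsum => // j.
  apply: smooth_on_mul => //; apply: smooth_on_mul => //.
  by apply: smooth_on_invmx => // x; exact: (unit_h metric_a).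
have sI := smooth_on_inv openU sqnorm_neq0 sS.
have s4 := smooth_on_mul openU (smooth_on_cst openU (4 : R)) sI.
apply: (smooth_on_eq openU _ s4) => x Ux.
by rewrite /e -(hkappa Ux) mulfK// sqnorm_neq0.
Qed.

Lemma inner_nav_metric x u v : inner h x u v = e x * inner (a c) x u v.
Proof.
rewrite /inner mulr_sumr; apply: eq_bigr => i _; rewrite mulr_sumr.
by apply: eq_bigr => j _; rewrite !mxE !mulrA.
Qed.

Lemma nav_local_metric : local_metric U h.
Proof.
split=> //.
- move=> i j; apply: (smooth_on_eq openU _ (smooth_on_mul openU smooth_e (smooth_a i j))).
  by move=> x _; rewrite mxE.
- by move=> x Ux; rewrite linearZ /= (local_metric_sym metric_a).
- move=> x Ux y y0; rewrite inner_nav_metric mulr_gt0 ?expR_gt0//.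
  exact: (local_metric_pos metric_a).
Qed.

Lemma nav_fieldE x : W x = sharp h x (fun j => nav_form kappa b c x 0 j).
Proof. by apply/rowP => i; rewrite !mxE. Qed.

Lemma inner_nav_field x y : U x -> inner h x (W x) y = e x / 2 * beta (b c) x y.
Proof.
move=> Ux; rewrite nav_fieldE (inner_sharp nav_local_metric)// /beta mulr_sumr.
by apply: eq_bigr => j _; rewrite mxE mulrA.
Qed.

Lemma nav_local_unit_field : local_unit_field U h W.
Proof.
split; first exact: nav_local_metric.
- move=> i.
  have sW : smooth_on U (fun x => \sum_j invmx (h x) i j * (e x * 2^-1 * b c x 0 j)).
    apply: smooth_on_bigsum => // j; apply: smooth_on_mul => //.
      apply: smooth_on_invmx => // [x|]; first exact: (unit_h nav_local_metric).
      exact: (local_metric_smooth nav_local_metric).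
    apply: smooth_on_mul => //; apply: smooth_on_mul => //; exact: smooth_on_cst.
  apply: (smooth_on_eq openU _ sW) => x _.
  by rewrite mxE; apply: eq_bigr => j _; rewrite mxE.
- move=> x Ux; rewrite inner_nav_field//.
  have e0 : e x != 0 by rewrite gt_eqF// expR_gt0.
  have ih : invmx (h x) = (e x)^-1 *: invmx (a c x).
    by rewrite /h /nav_metric invmxZ//; exact: (unit_h nav_local_metric Ux).
  have -> : beta (b c) x (W x) = 2^-1 * sqnorm_form (a c) (b c) x.
    rewrite /beta /sqnorm_form mulr_sumr; apply: eq_bigr => i _.
    rewrite mxE !mulr_sumr; apply: eq_bigr => j _.
    rewrite ih !mxE -/(e x).
    by move: (invmx (a c x) i j) (b c x 0 i) (b c x 0 j) (e x) e0 => p q r s s0; field.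
  have := hkappa Ux; rewrite -/(e x) => E.
  by move: (e x) (sqnorm_form (a c) (b c) x) E => r s E; lra.
Qed.

Lemma kropina_nav x y : U x -> kropina (a c) (b c) x y = nav h W x y.
Proof.
move=> Ux; rewrite /kropina /nav inner_nav_field// inner_nav_metric /alpha.
have e0 : e x != 0 by rewrite gt_eqF// expR_gt0.
have aa : 0 <= inner (a c) x y y.
  have [->|y0] := eqVneq y 0; first by rewrite inner0l.
  exact/ltW/(local_metric_pos metric_a).
rewrite sqr_sqrtr; last exact: aa.
rewrite -/(inner (a c) x y y) mulrA [2 * _]mulrC divfK ?pnatr_eq0//.
by rewrite -mulf_div divff// mul1r.
Qed.

Lemma slit_nav x y : slit U h W x y <-> U x /\ 0 < beta (b c) x y.
Proof.
split=> -[Ux] Hb; split=> //; move: Hb; rewrite inner_nav_field// pmulr_rgt0//;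
by rewrite divr_gt0// expR_gt0.
Qed.

End NavigationData.

Theorem theorem4p1 (R : realType) (n : nat) (hn : (2 <= n)%N)
    (M : topologicalType) (M_hausdorff : hausdorff_space M)
    (M_second_countable : @second_countable M)
    (A : smooth_atlas R n M)
    (a : field2 A) (ha : riemannian_metric a)
    (b : field1 A) (hb : one_form b) (hb0 : nowhere_vanishing b)
    (kappa : M -> R) (hkappa : navigation_factor a b kappa)
    (K : M -> R) :
  let h := nav_metric kappa a in
  let W := nav_field kappa a b in
  (p_scalar_flag_curvature a b K <->
     killing h W /\ scalar_sectional_curvature h K) /\
  (p_scalar_flag_curvature a b K -> forall p : M, 0 <= K p).
Proof.
move=> h W.
have gW c : local_unit_field (cod c) (h c) (W c) := nav_local_unit_field ha hb hkappa c.
have navF c x y : slit (cod c) (h c) (W c) x y ->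
    kropina (a c) (b c) x y = nav (h c) (W c) x y.
  by move=> [Ux _]; exact: (kropina_nav ha hb hkappa).
pose flagK c x := forall y, slit (cod c) (h c) (W c) x y -> forall i k : 'I_n,
  finsler_curvature (kropina (a c) (b c)) i k x y =
  K (psi c x) * (kropina (a c) (b c) x y ^+ 2 * (i == k)%:R
    - kropina (a c) (b c) x y * dy k (kropina (a c) (b c)) x y * y 0 i).
have flagE : p_scalar_flag_curvature a b K <-> forall c x, cod c x -> flagK c x.
  split=> [H c x Ux y /(slit_nav ha hb hkappa)[_ by0] i k|H c x y Ux by0 F i k].
    exact: H.
  by apply: H => //; apply/(slit_nav ha hb hkappa).
pose kill c := forall x, cod c x -> forall u v,
  inner (h c) x (cov (h c) (W c) x u) v + inner (h c) x u (cov (h c) (W c) x v) = 0.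
have killE : killing h W <-> forall c, kill c.
  split=> [H c x Ux|H c x Ux].
    by apply/(local_killing_basis (gW c) Ux); exact: H.
  by apply/(local_killing_basis (gW c) Ux); exact: H.
have flag_kill : (forall c x, cod c x -> flagK c x) -> forall c, kill c.
  by move=> H c x Ux; exact: (killing_of_scalar_flag (gW c) (navF c) Ux (H c x Ux)).
have opE c x (kc : kill c) (Ux : cod c x) :=
  scalar_flag_killing (gW c) (navF c) kc (K (psi c x)) Ux.
have secE c x (Ux : cod c x) :=
  sectional_operator (unit_field_metric (gW c)) (K (psi c x)) Ux.
split.
  split=> [/flagE H|[/killE kW sK]].
    have kW := flag_kill H; split; first exact/killE.
    move=> c x Ux; apply/(secE c x Ux)/(opE c x (kW c) Ux); exact: H.
  apply/flagE => c x Ux; apply/(opE c x (kW c) Ux)/(secE c x Ux); exact: sK.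
move=> /flagE H p; have [c dp] := dom_cover A p.
have Ux := phi_cod dp; have kW := flag_kill H.
rewrite -(phiK dp).
apply: (curv_operator_nonneg (unit_field_metric (gW c)) hn (gW c) (kW c) Ux).
exact/(opE c _ (kW c) Ux)/H.
Qed.
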